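(* There exist absolute constants $C_1, C_2, C_3, C_4>0$ for which the following holds. Let $(\Omega,\mu)$ be a probability space, let $F\subset L_2(\mu)\cap B(L_\infty)$ be a $\mu$-pre-Gaussian class of functions, let $T\in B(L_\infty)$, and let $\ell(x,y)=(x-y)^2$ be the squared loss. Assume that $f\mapsto \mathbb{E}\,\ell(f(X),T(X))$ attains its minimum in $F$ and fix a minimizer $f^*\in F$. Put $Q=\{\mathcal{L}(f) : f\in F,\ \mathbb{E}\mathcal{L}(f)=0\}$, where $\mathcal{L}(f)=\ell(f,T)-\ell(f^*,T)$. Then there is an integer $N(F)$ (for the fixed data $\Omega,\mu,F,T,f^*$) with the following property. If $\delta>0$ is such that for every integer $n\ge N(F)$ $$\operatorname{osc}_n(F,f^*,\delta)\le C_3\, H(Q),$$ then for every $n\ge N(F)$, setting $\lambda_n=C_4\,\dfrac{H(Q)}{\sqrt n}$, with $\mu^n$-probability at least $C_1$, $$\mathbb{E}\big[\mathcal{L}_{\lambda_n}(\hat f_{\lambda_n})\,\big|\,D\big]\ \ge\ C_2\,\frac{H(Q)}{\sqrt n}\,\delta^2\,\|T-f^*\| .$$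
   Context: $X$ is a random variable with values in $\Omega$ distributed according to $\mu$, and $X_1,\dots,X_n$ are independent copies of $X$. $B(L_\infty)$ is the unit ball of $L_\infty(\mu)$; $\|\cdot\|$ and $\langle\cdot,\cdot\rangle$ are the norm and inner product of $L_2(\mu)$. For functions $f,g$, $\ell(f,g)$ denotes the function $x\mapsto \ell(f(x),g(x))$; $\mathbb{E}h=\mathbb{E}h(X)$ and $P_nh=\frac1n\sum_{i=1}^n h(X_i)$. For $0\le\lambda\le1$, $T_\lambda=(1-\lambda)T+\lambda f^*$ and $\mathcal{L}_\lambda(f)=\ell(f,T_\lambda)-\ell(f^*,T_\lambda)$ (excess loss relative to the target $T_\lambda$; $f^*$ is also a minimizer of $f\mapsto\mathbb{E}\ell(f,T_\lambda)$ in $F$). The empirical risk minimizer $\hat f_\lambda$ for the target $T_\lambda$ is an element of $\operatorname{Arg}\min_{f\in F}P_n\ell(f,T_\lambda)$; it depends on the data $D$ (the sample $X_1,\dots,X_n$ together with the values of the target on it), and $\mathbb{E}[\mathcal{L}_\lambda(\hat f_\lambda)|D]$ is the conditional expectation given the data, i.e. the value at $f=\hat f_\lambda$ of $f\mapsto\mathbb{E}\mathcal{L}_\lambda(f)$. For $A\subset L_2(\mu)$, $\{G_f: f\in A\}$ is the canonical Gaussian process indexed by $A$, i.e. the centered Gaussian process with covariance $\mathbb{E}G_sG_t=\langle s,t\rangle$, and $H(A)=\mathbb{E}\sup_{f\in A}G_f$. ''$\mu$-pre-Gaussian'' is the standard notion from the theory of Gaussian/empirical processes (Dudley, Uniform Central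 Limit Theorems). For $f\in F$, $\delta>0$ and an integer $n$, $$\operatorname{osc}_n(F,f,\delta)=\frac1{\sqrt n}\,\mathbb{E}\sup_{\{h\in F:\ \|f-h\|\le\delta\}}\Big|\sum_{i=1}^n g_i\,(f-h)(X_i)\Big|,$$ where $g_1,\dots,g_n$ are independent standard Gaussian random variables, independent of $X_1,\dots,X_n$. A constant is absolute if it does not depend on $\Omega,\mu,F,T,f^*,\delta,n$. *)

(* Defs.v *)
From HB Require Import structures.
From mathcomp Require Import all_boot all_order all_algebra.
From mathcomp Require Import all_classical all_reals all_analysis.
From mathcomp Require Import measurable_realfun.

Set Implicit Arguments.
Unset Strict Implicit.
Unset Printing Implicit Defensive.

Import Order.TTheory GRing.Theory Num.Theory.
Import numFieldNormedType.Exports.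

Local Open Scope classical_set_scope.
Local Open Scope ring_scope.

Section product_power.
Context d (T : measurableType d) (R : realType).
Variable P : probability T R.

Definition tcons n (p : T * n.-tuple T) : n.+1.-tuple T :=
  [the n.+1.-tuple T of p.1 :: p.2].

Lemma measurable_tcons n : measurable_fun [set: T * n.-tuple T] (@tcons n).
Proof. by apply: measurable_cons; [exact: measurable_fst|exact: measurable_snd]. Qed.

HB.instance Definition _ n := isMeasurableFun.Build _ _ _ _ _ (@measurable_tcons n).

(* the law P^n of n independent variables of law P *)
Fixpoint prob_pow n : probability (n.-tuple T) R :=
  match n with
  | 0 => \d_[tuple]
  | m.+1 => distribution (P \x prob_pow m)%E (@tcons m)
  end.

Lemma prob_pow_rect n (A : 'I_n -> set T) : (forall i, measurable (A i)) ->
  prob_pow n [set x | forall i, A i (tnth x i)] = (\prod_(i < n) P (A i))%E.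
Proof.
elim: n A => [|n ih] A mA.
  rewrite big_ord0 /= diracE (_ : _ \in _)//.
  by rewrite inE => -[].
rewrite big_ord_recl -ih//= /pushforward /=.
rewrite -product_measure1E//; last first.
  rewrite [X in measurable X](_ : _ =
      \bigcap_(i in [set: 'I_n]) ((@tnth _ T)^~ i @^-1` A (lift ord0 i))).
    apply: fin_bigcap_measurable => // i _.
    by rewrite -[X in measurable X]setTI; exact: measurable_tnth.
  by apply/seteqP; split => x /= h i; [move=> _|]; exact: h.
congr (_ _); apply/seteqP; split => -[x t] /=.
  move=> h; split; first by have := h ord0; rewrite tnth0.
  by move=> i; have := h (lift ord0 i); rewrite tnthS.
by move=> [Ax At] i; case: (unliftP ord0 i) => [j ->|->]; rewrite ?tnth0// tnthS.
Qed.

End product_power.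

Definition outer_expectation d (T : measurableType d) (R : realType)
    (P : probability T R) (h : T -> \bar R) : \bar R :=
  ereal_inf [set (\int[P]_x phi x)%E | phi in
    [set phi : T -> \bar R |
      measurable_fun [set: T] phi /\ forall x, (h x <= phi x)%E]].

Section gaussian_processes.
Context d (Omega : measurableType d) (R : realType).
Implicit Types (mu : probability Omega R) (A F : set (Omega -> R)).

Definition l2norm mu (f : Omega -> R) : R := fine ('N[mu]_2%:E[EFin \o f])%E.

Definition l2inner mu (f h : Omega -> R) : R := \int[mu]_x (f x * h x).

Definition Linfty_ball mu : set (Omega -> R) :=
  [set f | f \in Lfun mu +oo%E /\ ('N[mu]_+oo[EFin \o f] <= 1)%E].

(* normal_prob 0 0 is not the degenerate law, hence the case distinction *)
Definition centered_normal (s : R) (B : set R) : \bar R :=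
  if s == 0 then \d_(0 : R) B else normal_prob 0 s B.

(* {G f : f in A} is a centered Gaussian process with covariance K: all its
   finite linear combinations are centered normal, and E(G_f G_h) = K f h *)
Definition gaussian_process (K : (Omega -> R) -> (Omega -> R) -> R) A
    d' (S : measurableType d') (P : probability S R)
    (G : (Omega -> R) -> {RV P >-> R}) : Prop :=
  (forall m (f : 'I_m -> Omega -> R) (c : 'I_m -> R), (forall i, A (f i)) ->
     exists2 s : R, 0 <= s & forall B : set R, measurable B ->
       P [set w | B (\sum_(i < m) c i * G (f i) w)] = centered_normal s B) /\
  (forall f h, A f -> A h ->
     'E_P[fun w => (G f w * G h w)%R] = (K f h)%:E)%E.

(* Dudley: the Brownian bridge G_mu indexed by F (covariance cov_mu(f, h)) has
   a version all of whose sample functions are bounded and uniformly continuous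
   on F for rho_mu(f, h) = Var_mu(f - h)^(1/2). *)
Definition pre_gaussian mu F : Prop :=
  exists d' (S : measurableType d') (P : probability S R)
    (G : (Omega -> R) -> {RV P >-> R}),
    gaussian_process (fun f h => fine (covariance mu f h)) F G /\
    forall w : S,
      (exists M : R, forall f, F f -> `|G f w| <= M) /\
      (forall e : R, 0 < e -> exists2 eta : R, 0 < eta &
         forall f h, F f -> F h ->
           Num.sqrt (fine ('V_mu[(f \- h)%R])%E) < eta ->
           `|G f w - G h w| < e).

(* H(A) = E sup_{f in A} G_f for the canonical Gaussian process G indexed by A.
   As usual for a possibly uncountable A, this is the supremum of
   E max(G_{f_0}, ..., G_{f_m}) over the finite families in A (which is
   E sup_{f in A} G_f for any separable version of G). These numbers only depend
   on the covariance, so ranging over all realizations of the process is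
   harmless. The value is finite for the loss classes built below from a
   pre-Gaussian class of functions bounded by 1. *)
Definition gaussian_sup mu A : \bar R :=
  ereal_sup [set e | exists d' (S : measurableType d') (P : probability S R)
    (G : (Omega -> R) -> {RV P >-> R}),
    gaussian_process (l2inner mu) A G /\
    exists m (f : 'I_m.+1 -> Omega -> R), (forall i, A (f i)) /\
      e = ('E_P[fun w => (\big[Num.max/G (f ord0) w]_(i < m.+1) G (f i) w)%R])%E].

(* osc_n(F, f, delta). The supremum need not be measurable, so its expectation
   is the outer expectation over the product space carrying (X_i)_i and (g_i)_i;
   it is the ordinary expectation whenever the supremum is measurable. *)
Definition osc mu n F (f : Omega -> R) (delta : R) : \bar R :=
  ((Num.sqrt n%:R)^-1%:E *
   outer_expectation (prob_pow mu n \x prob_pow (normal_prob (0 : R) 1) n)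
     (fun p : n.-tuple Omega * n.-tuple R =>
       ereal_sup [set `|\sum_(i < n)
            tnth p.2 i * (f (tnth p.1 i) - h (tnth p.1 i))|%:E
         | h in [set h | F h /\ (l2norm mu (f \- h) <= delta)%R]]))%E.

End gaussian_processes.

Section squared_loss.
Context d (Omega : measurableType d) (R : realType).
Implicit Types (mu : probability Omega R) (F : set (Omega -> R)).
Implicit Types (f h T fstar : Omega -> R).

Definition sq_loss (a b : R) : R := (a - b) ^+ 2.

Definition loss f T : Omega -> R := fun x => sq_loss (f x) (T x).

Definition risk_minimizer mu F T fstar : Prop :=
  F fstar /\
  forall f, F f -> \int[mu]_x loss fstar T x <= \int[mu]_x loss f T x.

Definition excess_loss T fstar f : Omega -> R :=
  fun x => loss f T x - loss fstar T x.

Definition zero_excess_losses mu F T fstar : set (Omega -> R) :=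
  [set excess_loss T fstar f | f in
    [set f | F f /\ \int[mu]_x excess_loss T fstar f x = 0]].

Definition moved_target (lambda : R) T fstar : Omega -> R :=
  fun x => (1 - lambda) * T x + lambda * fstar x.

Definition empirical_mean n (x : n.-tuple Omega) h : R :=
  n%:R^-1 * \sum_(i < n) h (tnth x i).

Definition empirical_minimizer F T n (x : n.-tuple Omega) f : Prop :=
  F f /\
  forall h, F h -> empirical_mean x (loss f T) <= empirical_mean x (loss h T).

End squared_loss.

(* Main.v *)
(* The excess loss for the target [T_lam] is (1 - lam) L(f) + lam (f - fstar)^2, so
   that its mean is at least lam ||f - fstar||^2: it suffices to show that, with
   constant probability, the empirical minimizer is at distance more than [delta]
   from [fstar].

   Far from [fstar]: choose finitely many members of Q whose Gaussian maximum has
   mean more than H(Q)/2. By Fernique's inequality this maximum is not much smaller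
   than its mean with constant probability, and by the central limit theorem (tested
   on trigonometric polynomials) so is the largest of the normalized sums of their
   opposites. Hence, for large n, some f with L(f) in Q has an empirical sum of at
   most - H(Q) sqrt n / 8 with probability at least 1/40. Moving the target costs no
   more than 4 lam n, so that the minimal empirical sum is at most
   - H(Q) sqrt n / 32.

   Near [fstar]: the true means are nonnegative, and Gaussian symmetrization and
   contraction bound the mean of the largest deviation of the empirical sums by a
   multiple of sqrt n * osc_n. By Markov's inequality all of these sums exceed
   - H(Q) sqrt n / 32, except on an event of probability 1/80. *)

Require Import Defs.
From mathcomp Require Import all_boot all_order all_algebra.
From mathcomp Require Import all_classical all_reals all_analysis.
From mathcomp Require Import measurable_realfun ess_sup_inf ring lra.

Set Implicit Arguments.
Unset Strict Implicit.
Unset Printing Implicit Defensive.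

Import Order.TTheory GRing.Theory Num.Theory.
Import numFieldNormedType.Exports.

Local Open Scope classical_set_scope.
Local Open Scope ring_scope.

(** Two obstacles shape the proof. Suprema over [F] need not be measurable, so the part near [fstar]
    never integrates one: the outer expectation is replaced at once by the integral of a measurable
    majorant, and symmetrization and contraction are carried out on majorants, with the class
    replaced by a countable grid of rounded sample values. Secondly, a Gaussian process is given
    only through the laws of its finite linear combinations. A Gaussian vector is therefore handled
    through its real characteristic function E cos (th + <u, Y>), which serves both the limit
    theorem and the rotation invariance behind Fernique's inequality.

    The threshold 1/10 of Fernique's argument drops to 1/20 when a sign is chosen for the Gaussian
    family and to 1/40 in the limit theorem. Only this part is asymptotic: N(F) depends on the
    finite family and on H(Q) <= sqrt n, while [delta] enters through the bound near [fstar], which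
    holds for each positive n. The factor ||T - fstar|| of the conclusion is at most 2, whence C2 =
    C4 / 2. *)

Lemma integral_prob_cst d (T : measurableType d) (R : realType)
  (P : probability T R) (c : \bar R) : (\int[P]_x c = c)%E.
Proof.
rewrite integral_cst// -[RHS]mule1; congr (_ * _)%E; exact: probability_setT.
Qed.

(** * Integration against product powers *)

Section prob_pow_integral.
Context d (T : measurableType d) (R : realType) (P : probability T R).
Local Open Scope ereal_scope.

Lemma ge0_integral_prob_powS n (h : n.+1.-tuple T -> \bar R) :
  measurable_fun setT h -> (forall x, 0 <= h x) ->
  \int[prob_pow P n.+1]_x h x =
  \int[P]_a \int[prob_pow P n]_t h (tcons (a, t)).
Proof.
move=> mh h0.
have mc : measurable_fun setT (h \o @tcons d T n).
  by apply: measurableT_comp; [exact: mh|exact: measurable_tcons].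
rewrite /= (@ge0_integral_distribution _ _ _ _ _ (P \x prob_pow P n) (@tcons d T n))//.
rewrite fubini_tonelli1// => x; exact: h0.
Qed.

Lemma measurable_tcons_section n (h : n.+1.-tuple T -> \bar R) a :
  measurable_fun setT h -> measurable_fun setT (fun t => h (tcons (a, t))).
Proof.
move=> mh; apply: measurableT_comp; first exact: mh.
exact: (measurable_cons (measurable_cst a) (@measurable_id _ _ setT)).
Qed.

Lemma ge0_integral_pow0 (h : 0.-tuple T -> \bar R) :
  (forall x, 0 <= h x) -> \int[prob_pow P 0]_x h x = h [tuple].
Proof.
move=> h0; rewrite /= integral_dirac//.
  by rewrite diracT mul1e.
apply: (eq_measurable_fun (cst (h [tuple]))) => //.
by move=> x _; rewrite (tuple0 x).
Qed.

Lemma integrable_le_ge0_integral (D : measure T R) (k : T -> R) (h : T -> \bar R) :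
  D.-integrable setT (EFin \o k) -> measurable_fun setT h ->
  (forall x, 0 <= h x) -> (forall x, (k x)%:E <= h x) ->
  \int[D]_x (k x)%:E <= \int[D]_x h x.
Proof.
move=> ik mh h0 kh.
rewrite integralE; apply: (@le_trans _ _ (\int[D]_x (EFin \o k)^\+ x)).
  rewrite -[leRHS]sube0; apply: leeB => //.
  by apply: integral_ge0.
apply: ge0_le_integral => //.
  exact: (measurable_funepos (measurable_int _ ik)).
by move=> x _; rewrite funeposE ge_max kh h0.
Qed.

Lemma ge_weighted_integral_prob_pow n (p : R) (w k : nat -> T -> R)
    (m : nat -> R) (b : R) (h : n.-tuple T -> \bar R) : (0 <= p)%R ->
  (forall i, measurable_fun setT (w i)) -> (forall i x, (0 <= w i x)%R) ->
  (forall i, P.-integrable setT (EFin \o w i)) ->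
  (forall i, P.-integrable setT (EFin \o (fun x => w i x * k i x)%R)) ->
  (forall i, \int[P]_x (w i x)%:E = p%:E) ->
  (forall i, \int[P]_x (w i x * k i x)%:E = (p * m i)%:E) ->
  measurable_fun setT h -> (forall x, 0 <= h x) ->
  (forall x, (b + \sum_(i < n) k i (tnth x i))%:E <= h x) ->
  (p ^+ n * (b + \sum_(i < n) m i))%:E <=
    \int[prob_pow P n]_x ((\prod_(i < n) w i (tnth x i))%:E * h x).
Proof.
move=> p0; elim: n w k m b h => [|n ih] w k m b h mw w0 iw iwk pw pm mh h0 kh.
  rewrite ge0_integral_pow0; last first.
    by move=> x; rewrite mule_ge0// lee_fin big_ord0.
  by have := kh [tuple]; rewrite !big_ord0 expr0 !mul1r mul1e.
have mprod j (ww : nat -> T -> R) : (forall i, measurable_fun setT (ww i)) ->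
    measurable_fun setT (fun x : j.-tuple T => (\prod_(i < j) ww i (tnth x i))%:E).
  move=> mww; apply/measurable_EFinP.
  apply: (eq_measurable_fun (fun x : j.-tuple T => \prod_(i <- index_enum 'I_j) ww i (tnth x i))%R) => //.
  apply: measurable_prod => i _.
  by apply: measurableT_comp; [exact: mww|exact: measurable_tnth].
rewrite ge0_integral_prob_powS; last 2 first.
- by apply: emeasurable_funM => //; exact: mprod.
- by move=> x; rewrite mule_ge0// lee_fin prodr_ge0.
have E a : \int[prob_pow P n]_t
      ((\prod_(i < n.+1) w i (tnth (tcons (a, t)) i))%:E * h (tcons (a, t))) =
    (w 0%N a)%:E * \int[prob_pow P n]_t
      ((\prod_(i < n) w i.+1 (tnth t i))%:E * h (tcons (a, t))).
  rewrite -ge0_integralZl//; last 3 first.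
  - apply: emeasurable_funM; [exact: (mprod n (fun i => w i.+1))|].
    exact: measurable_tcons_section.
  - by move=> x _; rewrite mule_ge0// lee_fin prodr_ge0.
  - by rewrite lee_fin.
  apply: eq_integral => t _; rewrite big_ord_recl tnth0 EFinM muleA.
  congr (_ * _ * _); congr EFin; apply: eq_bigr => i _.
  by rewrite tnthS.
under eq_integral do rewrite E.
have ik : P.-integrable setT (EFin \o (fun a => p ^+ n * (w 0%N a * k 0%N a +
   (b + \sum_(i < n) m i.+1) * w 0%N a))%R).
  apply: (eq_integrable _ (fun a => (p ^+ n)%:E * ((w 0%N a * k 0%N a)%:E +
   (b + \sum_(i < n) m i.+1)%:E * (w 0%N a)%:E))) => //.
  apply: integrableZl => //; apply: integrableD => //; first exact: iwk.
  by apply: integrableZl => //; exact: iw.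
rewrite (_ : (_)%:E = \int[P]_a (p ^+ n * (w 0%N a * k 0%N a +
   (b + \sum_(i < n) m i.+1) * w 0%N a))%:E); last first.
  under eq_integral do rewrite EFinM.
  rewrite integralZl//; last first.
    apply: (eq_integrable _ (fun a => ((w 0%N a * k 0%N a)%:E +
     (b + \sum_(i < n) m i.+1)%:E * (w 0%N a)%:E))) => //.
    apply: integrableD => //; first exact: iwk.
    by apply: integrableZl => //; exact: iw.
  under eq_integral do rewrite EFinD.
  rewrite integralD//; last 2 first.
  - exact: iwk.
  - under eq_fun do rewrite EFinM.
    by apply: integrableZl => //; exact: iw.
  rewrite pm.
  under eq_integral do rewrite EFinM.
  rewrite integralZl//; last exact: iw.
  rewrite pw -(EFinM (b + _)%R) -(EFinD (p * m 0%N)%R) -EFinM; congr EFin.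
  rewrite big_ord_recl exprS; set s := (\sum_(i < n) _)%R.
  ring.
apply: integrable_le_ge0_integral => //.
- apply: emeasurable_funM; first exact/measurable_EFinP.
  apply: (@measurable_fun_fubini_tonelli_F _ _ _ _ _ (prob_pow P n)
    (fun z => (\prod_(i < n) w i.+1 (tnth z.2 i))%:E * h (tcons z))) => //=.
    apply: emeasurable_funM.
      by apply: (measurableT_comp (mprod n (fun i => w i.+1) _)) => //.
    by apply: measurableT_comp; [exact: mh|exact: measurable_tcons].
  by move=> x; rewrite mule_ge0// lee_fin prodr_ge0.
- move=> a; rewrite mule_ge0 ?lee_fin// integral_ge0// => t _.
  by rewrite mule_ge0// lee_fin prodr_ge0.
move=> a.
have := ih (fun i => w i.+1) (fun i => k i.+1) (fun i => m i.+1) (b + k 0%N a)%R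
  (fun t => h (tcons (a, t))).
move=> /(_ (fun i => mw i.+1) (fun i => w0 i.+1) (fun i => iw i.+1)
  (fun i => iwk i.+1) (fun i => pw i.+1) (fun i => pm i.+1)
  (measurable_tcons_section _ mh) (fun t => h0 _)).
have H t : (b + k 0%N a + \sum_(i < n) k i.+1 (tnth t i))%:E <= h (tcons (a, t)).
  have := kh (tcons (a, t)); rewrite big_ord_recl tnth0 addrA.
  by under eq_bigr do rewrite tnthS.
move=> /(_ H) /(lee_wpmul2l (_ : 0 <= (w 0%N a)%:E)).
rewrite lee_fin w0 => /(_ isT); apply: le_trans.
by rewrite -EFinM lee_fin le_eqVlt; apply/orP; left; apply/eqP; ring.
Qed.

(** Exchanging coordinates between a sample and its independent copy is the operation on which
    symmetrization rests. *)
Definition mixt n (e : n.-tuple bool) (z : n.-tuple T * n.-tuple T) : n.-tuple T :=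
  [tuple (if tnth e i then tnth z.1 i else tnth z.2 i) | i < n].

Lemma measurable_mixt n (e : n.-tuple bool) : measurable_fun setT (mixt e).
Proof.
apply/measurable_fun_tnthP => i.
rewrite (_ : _ \o _ = fun z => if tnth e i then tnth z.1 i else tnth z.2 i); last first.
  by apply/funext => z /=; rewrite tnth_mktuple.
case: (tnth e i); apply: (measurableT_comp (measurable_tnth i)) => //.
Qed.

Lemma mixt_cons n b (e : n.-tuple bool) a t c s :
  mixt [tuple of b :: e] (tcons (a, t), tcons (c, s)) =
  tcons (if b then a else c, mixt e (t, s)).
Proof.
apply: eq_from_tnth => i; rewrite tnth_mktuple.
have [j ->|->] := unliftP ord0 i; last by rewrite !tnth0.
by rewrite !tnthS tnth_mktuple.
Qed.

(** Each coordinate of the mixture comes from one of two independent samples, and the coordinate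
    that is not chosen integrates out, so the mixture is again a sample of law P^n. *)
Lemma ge0_integral_mixt n (e : n.-tuple bool) (h : n.-tuple T -> \bar R) :
  measurable_fun setT h -> (forall x, 0 <= h x) ->
  \int[prob_pow P n \x prob_pow P n]_z h (mixt e z) = \int[prob_pow P n]_x h x.
Proof.
elim: n e h => [|n ih] e h mh h0.
  rewrite fubini_tonelli1//; last first.
    by apply: measurableT_comp; [exact: mh|exact: measurable_mixt].
  rewrite [RHS]ge0_integral_pow0// ge0_integral_pow0; last first.
    by move=> x; apply: integral_ge0 => y _; exact: h0.
  rewrite /fubini_F ge0_integral_pow0//; congr h.
  exact: tuple0.
have mhm : measurable_fun setT (fun z => h (mixt e z)).
  by apply: measurableT_comp; [exact: mh|exact: measurable_mixt].
rewrite fubini_tonelli1// [RHS]ge0_integral_prob_powS// ge0_integral_prob_powS; last 2 first.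
- exact: (@measurable_fun_fubini_tonelli_F _ _ _ _ _ (prob_pow P n.+1) (fun z => h (mixt e z)) mhm (fun z => h0 _)).
- by move=> x; apply: integral_ge0 => y _; exact: h0.
have E1 a t : fubini_F (prob_pow P n.+1) (fun z => h (mixt e z)) (tcons (a, t)) =
    \int[P]_c \int[prob_pow P n]_s h (mixt e (tcons (a, t), tcons (c, s))).
  rewrite /fubini_F ge0_integral_prob_powS//.
  exact: (@measurable_fun_pair2 _ _ _ _ _ _ _ (tcons (a, t)) mhm).
have mm c (e' : n.-tuple bool) :
    measurable_fun setT (fun z => h (tcons (c, mixt e' z))).
  apply: (measurableT_comp (measurable_tcons_section c mh)).
  exact: measurable_mixt.
case/tupleP: e mhm E1 => -[] e mhm E1.
- apply: eq_integral => a _.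
  rewrite -(ih e (fun t => h (tcons (a, t))) (measurable_tcons_section a mh) (fun t => h0 _)).
  rewrite fubini_tonelli1//; apply: eq_integral => t _.
  rewrite E1 (eq_integral (cst (\int[prob_pow P n]_s h (tcons (a, mixt e (t, s))))))//.
    exact: integral_prob_cst.
  by move=> c _; apply: eq_integral => s _; rewrite mixt_cons.
(* Here the chosen coordinate [c] belongs to the second sample: the integral over [a] is trivial,
   but [t] and [c] must be exchanged before the induction hypothesis applies. *)
- rewrite (eq_integral (cst (\int[P]_c \int[prob_pow P n]_t h (tcons (c, t)))))//.
    exact: integral_prob_cst.
  move=> a _ /=.
  have mf : measurable_fun setT (fun z : n.-tuple T * T =>
      \int[prob_pow P n]_s h (tcons (z.2, mixt e (z.1, s)))).
    apply: (@measurable_fun_fubini_tonelli_F _ _ _ _ _ (prob_pow P n)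
      (fun zs : (n.-tuple T * T) * n.-tuple T =>
        h (tcons (zs.1.2, mixt e (zs.1.1, zs.2))))) => //=.
    apply: measurableT_comp; first exact: mh.
    apply: measurable_cons.
      exact: (measurableT_comp measurable_snd measurable_fst).
    apply: (measurableT_comp (measurable_mixt e)).
    apply: measurable_fun_pair => //.
    exact: (measurableT_comp measurable_fst measurable_fst).
  rewrite (eq_integral (fun t => \int[P]_c \int[prob_pow P n]_s h (tcons (c, mixt e (t, s))))); last first.
    move=> t _; rewrite E1; apply: eq_integral => c _; apply: eq_integral => s _.
    by rewrite mixt_cons.
  have := @fubini_tonelli _ _ _ _ _ (prob_pow P n) P _ mf (fun z => @integral_ge0 _ _ _ _ _ _ (fun s _ => h0 _)).
  rewrite /fubini_F /fubini_G /= => ->.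
  apply: eq_integral => c _.
  rewrite -(ih e (fun t => h (tcons (c, t))) (measurable_tcons_section c mh) (fun t => h0 _)).
  by rewrite fubini_tonelli1.
Qed.

End prob_pow_integral.

Section bounded_integral.
Context d (T : measurableType d) (R : realType).

Lemma bounded_integrable (P : probability T R) (h : T -> R) (M : R) :
  measurable_fun setT h -> (forall x, `|h x| <= M) ->
  P.-integrable setT (EFin \o h).
Proof.
move=> mh hM; apply: (@le_integrable _ _ _ _ _ _ _ (cst M%:E)) => //.
- exact/measurable_EFinP.
- by move=> x _ /=; rewrite lee_fin (le_trans (hM x))// ler_norm.
- exact: finite_measure_integrable_cst.
Qed.

Lemma Rintegral_prob_cst (P : probability T R) (c : R) : \int[P]_x c = c.
Proof. by rewrite /Rintegral integral_prob_cst. Qed.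

Lemma Rintegral_le_bound (P : probability T R) (h : T -> R) (M : R) :
  measurable_fun setT h -> (forall x, `|h x| <= M) ->
  `|\int[P]_x h x| <= M.
Proof.
move=> mh hM; apply: (le_trans (le_normr_Rintegral _ _)) => //.
  exact: (@bounded_integrable _ _ M).
rewrite -(Rintegral_prob_cst P M).
apply: le_Rintegral => //.
- apply: (@bounded_integrable _ _ M); last by move=> x; rewrite normr_id.
  exact: measurableT_comp.
- exact: finite_measure_integrable_cst.
Qed.

Lemma EFin_Rintegral (P : probability T R) (h : T -> R) :
  P.-integrable setT (EFin \o h) ->
  (\int[P]_x h x)%:E = (\int[P]_x (h x)%:E)%E.
Proof. by move=> ih; rewrite fineK//; exact: integrable_fin_num. Qed.

Lemma integrable_EFinZl (P : probability T R) (k : R) (f : T -> R) :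
  P.-integrable setT (EFin \o f) ->
  P.-integrable setT (EFin \o (fun x => k * f x)).
Proof.
move=> if_; rewrite (_ : EFin \o _ = (fun x => k%:E * (EFin \o f) x)%E)//.
exact: integrableZl.
Qed.

Lemma integrable_EFinD (P : probability T R) (f g : T -> R) :
  P.-integrable setT (EFin \o f) -> P.-integrable setT (EFin \o g) ->
  P.-integrable setT (EFin \o (fun x => f x + g x)).
Proof.
move=> if_ ig; rewrite (_ : EFin \o _ = ((EFin \o f) \+ (EFin \o g))%E)//.
exact: integrableD.
Qed.

Lemma integrable_EFinB (P : probability T R) (f g : T -> R) :
  P.-integrable setT (EFin \o f) -> P.-integrable setT (EFin \o g) ->
  P.-integrable setT (EFin \o (fun x => f x - g x)).
Proof.
move=> if_ ig; rewrite (_ : EFin \o _ = ((EFin \o f) \- (EFin \o g))%E)//.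
exact: integrableB.
Qed.

Lemma integrable_EFin_norm (P : probability T R) (f : T -> R) :
  P.-integrable setT (EFin \o f) ->
  P.-integrable setT (EFin \o (fun x => `|f x|)).
Proof.
by move=> if_; rewrite (_ : EFin \o _ = abse \o (EFin \o f))//; exact: integrable_abse.
Qed.

Lemma integrable_EFin_cst (P : probability T R) (c : R) :
  P.-integrable setT (EFin \o (fun _ => c)).
Proof. exact: finite_measure_integrable_cst. Qed.

Lemma measurable_integrable_EFin (P : probability T R) (f : T -> R) :
  P.-integrable setT (EFin \o f) -> measurable_fun setT f.
Proof. by move=> if_; exact/measurable_EFinP/(measurable_int _ if_). Qed.

End bounded_integral.

Section bounded_fubini.
Context d (T : measurableType d) d' (S : measurableType d') (R : realType).

Lemma Rintegral_prod (P : probability T R) (Q : probability S R)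
    (h : T * S -> R) (M : R) :
  measurable_fun setT h -> (forall x, `|h x| <= M) ->
  \int[(P \x Q)%E]_z h z = \int[P]_x \int[Q]_y h (x, y).
Proof.
move=> mh hM.
have ih : (P \x Q)%E.-integrable setT (EFin \o h).
  exact: (@bounded_integrable _ _ _ (P \x Q)%E _ M).
rewrite /Rintegral -(integral12_prod_meas1 ih); congr fine.
apply: eq_integral => x _; rewrite /fubini_F /= fineK//.
apply: integrable_fin_num => //.
apply: (@bounded_integrable _ _ _ _ _ M) => //.
exact: (@measurable_fun_pair2 _ _ _ _ _ _ _ x mh).
Qed.

Lemma measurable_Rintegral_section (Q : probability S R)
    (h : T * S -> R) (M : R) :
  measurable_fun setT h -> (forall x, `|h x| <= M) ->
  measurable_fun setT (fun x => \int[Q]_y h (x, y)).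
Proof.
move=> mh hM.
have mx x : measurable_fun setT (fun y => h (x, y)).
  exact: (@measurable_fun_pair2 _ _ _ _ _ _ _ x mh).
(* Adding [M] makes the integrand nonnegative, as the measurability part of Tonelli's theorem
   requires. *)
have E x : \int[Q]_y h (x, y) = fine (\int[Q]_y (h (x, y) + M)%:E)%E - M.
  under eq_integral do rewrite EFinD.
  have ix : Q.-integrable setT (EFin \o (fun y => h (x, y))).
    exact: (@bounded_integrable _ _ _ _ _ M).
  rewrite integralD//; last exact: finite_measure_integrable_cst.
  rewrite integral_prob_cst -EFin_Rintegral//.
  by rewrite -EFinD /= addrK.
rewrite (_ : (fun x => _) = fun x => fine (\int[Q]_y (h (x, y) + M)%:E)%E - M); last first.
  by apply/funext => x; rewrite E.
apply: measurable_funB => //; apply: measurableT_comp => //.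
apply: (@measurable_fun_fubini_tonelli_F _ _ _ _ _ Q (fun z => (h z + M)%:E)).
  by apply/measurable_EFinP; apply: measurable_funD.
by move=> z; rewrite lee_fin -lerBlDr sub0r; have := hM z; rewrite ler_norml => /andP[].
Qed.

End bounded_fubini.

Lemma Rintegral_prob_powS d (T : measurableType d) (R : realType)
    (P : probability T R) n (h : n.+1.-tuple T -> R) (M : R) :
  measurable_fun setT h -> (forall x, `|h x| <= M) ->
  \int[prob_pow P n.+1]_x h x =
  \int[P]_a \int[prob_pow P n]_t h (tcons (a, t)).
Proof.
move=> mh hM.
have mc : measurable_fun setT (h \o @tcons d T n).
  by apply: measurableT_comp; [exact: mh|exact: measurable_tcons].
have := @Rintegral_prod _ _ _ _ R P (prob_pow P n) _ M mc (fun z => hM _).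
move=> /= <-; rewrite /Rintegral; congr fine.
rewrite /= (@integral_distribution _ _ _ _ _ (P \x prob_pow P n)%E (@tcons d T n) (EFin \o h))//.
  exact/measurable_EFinP.
exact: (@bounded_integrable _ _ _ (P \x prob_pow P n)%E _ M mc (fun z => hM _)).
Qed.

Lemma Rintegral_prob_pow0 d (T : measurableType d) (R : realType)
    (P : probability T R) (h : 0.-tuple T -> R) :
  \int[prob_pow P 0]_x h x = h [tuple].
Proof.
rewrite /Rintegral /= integral_dirac//; last first.
  apply: (eq_measurable_fun (cst (h [tuple])%:E)) => //.
  by move=> x _; rewrite (tuple0 x).
by rewrite diracT mul1e.
Qed.

(** * The normal law *)

Section normal_integral.
Context (R : realType).
Local Notation leb := (@lebesgue_measure R).

(** The Radon-Nikodym derivative and the density have the same integral over every measurable set,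
    hence agree almost everywhere. *)
Lemma ge0_integral_normal_prob (m s : R) (f : R -> \bar R) :
  measurable_fun setT f -> (forall x, (0 <= f x)%E) ->
  (\int[normal_prob m s]_x f x = \int[leb]_x (f x * (normal_pdf m s x)%:E))%E.
Proof.
move=> mf f0.
have dom := @normal_prob_dominates R m s.
rewrite -(Radon_Nikodym_SigmaFinite.change_of_variables dom)//.
apply: ae_eq_integral => //.
- apply: emeasurable_funM => //.
  exact: measurable_int (Radon_Nikodym_SigmaFinite.f_integrable dom).
- apply: emeasurable_funM => //; apply/measurable_EFinP.
  exact: measurable_normal_pdf.
- apply: ae_eqe_mul2l; apply: integral_ae_eq => //.
  + exact: Radon_Nikodym_SigmaFinite.f_integrable.
  + by apply/measurable_EFinP; exact: measurable_normal_pdf.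
  + by move=> A _ mA; rewrite -Radon_Nikodym_SigmaFinite.f_integral.
Qed.

Lemma ge0_integral_lebesgueN (f : R -> \bar R) :
  measurable_fun setT f -> (forall x, (0 <= f x)%E) ->
  (\int[leb]_x f (- x)%R = \int[leb]_x f x)%E.
Proof.
move=> mf f0.
have := @ge0_integral_pushforward _ _ _ _ R (-%R : measurableTypeR R -> measurableTypeR R)
  (@oppr_measurable _ _) leb setT f measurableT mf (fun x _ => f0 x).
rewrite preimage_setT => <-.
apply: eq_measure_integral => A mA _.
exact: lebesgue_measureN.
Qed.

Lemma ge0_integral_normal_probN (s : R) (f : R -> \bar R) : s != 0 ->
  measurable_fun setT f -> (forall x, (0 <= f x)%E) ->
  (\int[normal_prob 0 s]_x f (- x)%R = \int[normal_prob 0 s]_x f x)%E.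
Proof.
move=> s0 mf f0.
have mp := @measurable_normal_pdf R 0 s.
have mfN : measurable_fun setT (fun x : R => f (- x)).
  by apply: (measurableT_comp mf).
rewrite !ge0_integral_normal_prob//.
have mfp : measurable_fun setT (fun x => (f x * (normal_pdf 0 s x)%:E)%E).
  by apply: emeasurable_funM => //; exact/measurable_EFinP.
have fp0 x : (0 <= f x * (normal_pdf 0 s x)%:E)%E.
  by rewrite mule_ge0// lee_fin normal_pdf_ge0.
rewrite -(ge0_integral_lebesgueN mfp fp0).
apply: eq_integral => x _; rewrite !normal_pdfE// /normal_fun.
by rewrite !subr0 sqrrN.
Qed.

(** With u = x^2 / (4 s^2) the exponential is e^(-2u) and x^4 = 16 s^4 u^2. One factor e^(-u)
    absorbs u^2 <= 2 e^u, and the other is the exponential for the deviation s sqrt 2. *)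
Lemma normal_fun_moment4 (s x : R) : s != 0 ->
  x ^+ 4 * normal_fun 0 s x <= 32 * s ^+ 4 * normal_fun 0 (s * Num.sqrt 2) x.
Proof.
move=> s0; rewrite /normal_fun !subr0 exprMn sqr_sqrtr// mulr_natr.
set u := x ^+ 2 / (s ^+ 2 *+ 2 *+ 2).
have -> : - x ^+ 2 / (s ^+ 2 *+ 2) = - u + - u.
  by rewrite /u; field.
have -> : - x ^+ 2 / (s ^+ 2 *+ 2 *+ 2) = - u by rewrite mulNr.
have -> : x ^+ 4 = 16 * s ^+ 4 * u ^+ 2.
  by rewrite /u; field.
have u0 : 0 <= u by rewrite divr_ge0 ?sqr_ge0// !mulrn_wge0 ?sqr_ge0.
move: u u0 => u u0.
rewrite expRD mulrA ler_wpM2r ?expR_ge0//.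
rewrite expRN ler_pdivrMr ?expR_gt0//.
have h : u ^+ 2 <= 2 * expR u.
  have := @expR_ge1Dxn R u 1 u0; rewrite (_ : 2`!%:R = 2 :> R)//.
  by move: (expR u) => e; lra.
have s4 : 0 <= s ^+ 4 by rewrite exprn_even_ge0.
have := ler_wpM2l (mulr_ge0 (ler0n R 16) s4) h.
by move: (expR u) (u ^+ 2) (s ^+ 4) => e v w; lra.
Qed.

Lemma normal_prob_moment4 (s : R) : s != 0 ->
  (\int[normal_prob 0 s]_x (x ^+ 4)%:E < +oo)%E.
Proof.
move=> s0.
rewrite ge0_integral_normal_prob//; last 2 first.
- by apply/measurable_EFinP; exact: measurable_funX.
- by move=> x; rewrite lee_fin exprn_even_ge0.
have s20 : s * Num.sqrt 2 != 0 by rewrite mulf_neq0// gt_eqF// sqrtr_gt0.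
have s2s : (s * Num.sqrt 2) ^+ 2 = s ^+ 2 *+ 2.
  by rewrite exprMn sqr_sqrtr// mulr_natr.
pose C := normal_peak s / normal_peak (s * Num.sqrt 2) * (32 * s ^+ 4).
have C0 : 0 <= C.
  rewrite mulr_ge0 ?divr_ge0 ?normal_peak_ge0//.
  by rewrite mulr_ge0// exprn_even_ge0.
apply: (@le_lt_trans _ _ (\int[leb]_x (C%:E * (normal_pdf 0 (s * Num.sqrt 2) x)%:E))%E).
  apply: ge0_le_integral => //.
  - by move=> x _; rewrite mule_ge0// lee_fin ?exprn_even_ge0// normal_pdf_ge0.
  - apply: emeasurable_funM; apply/measurable_EFinP; first exact: measurable_funX.
    exact: measurable_normal_pdf.
  - apply: emeasurable_funM => //; apply/measurable_EFinP.
    exact: measurable_normal_pdf.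
  move=> x _; rewrite -!EFinM lee_fin !normal_pdfE//.
  have key := normal_fun_moment4 x s0.
  have p0 := normal_peak_gt0 s0; have p'0 := normal_peak_gt0 s20.
  move: key p0 p'0; rewrite /C.
  move: (normal_peak (s * Num.sqrt 2)) (normal_peak s).
  move: (normal_fun 0 (s * Num.sqrt 2) x) (normal_fun 0 s x).
  move=> e' e p' p key p0 p'0.
  have -> : p / p' * (32 * s ^+ 4) * (p' * e') = p * (32 * s ^+ 4 * e').
    by field; rewrite gt_eqF.
  by rewrite mulrCA ler_pM2l.
rewrite ge0_integralZl//; last 2 first.
- by apply/measurable_EFinP; exact: measurable_normal_pdf.
- by move=> x _; rewrite lee_fin normal_pdf_ge0.
by rewrite integral_normal_pdf mule1 ltry.
Qed.

(** Completing the square: the joint density of (x, y), with y = sqrt 2 z - x, is the density of z =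
    (x + y) / sqrt 2 times the conditional density of x given z. The factor sqrt 2 on the left is
    the Jacobian. *)
Lemma normal_pdf_convolution (s : R) (x z : R) : s != 0 ->
  normal_pdf 0 s x * normal_pdf 0 s (Num.sqrt 2 * z - x) * Num.sqrt 2 =
  normal_pdf 0 s z * normal_pdf (z / Num.sqrt 2) (s / Num.sqrt 2) x.
Proof.
move=> s0.
have r0 : 0 < Num.sqrt 2 :> R by rewrite sqrtr_gt0.
have r2 : Num.sqrt 2 * Num.sqrt 2 = 2 :> R by rewrite -expr2 sqr_sqrtr.
have sr0 : s / Num.sqrt 2 != 0 by rewrite mulf_neq0// invr_eq0 gt_eqF.
rewrite !normal_pdfE// /normal_fun !subr0.
have -> : normal_peak (s / Num.sqrt 2) = normal_peak s * Num.sqrt 2.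
  rewrite /normal_peak exprMn exprVn sqr_sqrtr//.
  rewrite (_ : s ^+ 2 * pi *+ 2 = s ^+ 2 / 2 * pi *+ 2 * 2); last first.
    by field.
  rewrite (sqrtrM 2); last first.
    by rewrite mulrn_wge0// mulr_ge0 ?pi_ge0// divr_ge0 ?sqr_ge0.
  by rewrite [in RHS]invfM -[RHS]mulrA mulVf ?mulr1 ?gt_eqF.
rewrite -!mulrA; congr (_ * _).
rewrite [LHS]mulrCA [RHS]mulrCA; congr (_ * _).
rewrite mulrA -expRD [RHS]mulrCA mulrC; congr (_ * _).
rewrite -expRD; congr expR.
rewrite exprMn exprVn sqr_sqrtr//.
have E : (Num.sqrt 2 * z - x) ^+ 2 = 2 * z ^+ 2 - 2 * Num.sqrt 2 * z * x + x ^+ 2.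
  by rewrite sqrrB exprMn sqr_sqrtr//; ring.
have E' : (x - z / Num.sqrt 2) ^+ 2 = x ^+ 2 - Num.sqrt 2 * z * x + z ^+ 2 / 2.
  rewrite sqrrB exprMn exprVn sqr_sqrtr//.
  have -> : (Num.sqrt 2)^-1 = Num.sqrt 2 / 2 :> R.
    by apply: (mulfI (lt0r_neq0 r0)); rewrite divff ?gt_eqF// mulrA r2 divff.
  by field.
by rewrite E E'; field.
Qed.

(** Substituting z for y and exchanging the integrals, the conditional density of x integrates to 1.
    This stability is the source of the functional equation for the characteristic function. *)
Lemma normal_prob_stable (s : R) (F : R -> R) : s != 0 ->
  continuous F -> (forall x, 0 <= F x) ->
  (\int[normal_prob 0 s]_x \int[normal_prob 0 s]_y (F ((x + y) / Num.sqrt 2))%:E =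
   \int[normal_prob 0 s]_z (F z)%:E)%E.
Proof.
move=> s0 cF F0.
have mF : measurable_fun setT F by exact: continuous_measurable_fun.
have mp m (s' : R) := @measurable_normal_pdf R m s'.
have r0 : 0 < Num.sqrt 2 :> R by rewrite sqrtr_gt0.
have mFxy : measurable_fun setT (fun z : R * R => (F ((z.1 + z.2) / Num.sqrt 2))%:E).
  apply/measurable_EFinP; apply: measurableT_comp => //.
  by apply: measurable_funM => //; apply: measurable_funD.
rewrite ge0_integral_normal_prob; last 2 first.
- by apply: (@measurable_fun_fubini_tonelli_F _ _ _ _ _ (normal_prob 0 s) _ mFxy (fun z => F0 _)).
- by move=> x; rewrite integral_ge0// => y _; rewrite lee_fin.
have mcomb : measurable_fun setT (fun w : R * R =>
    (F w.1 * normal_pdf 0 s w.1 * normal_pdf (w.1 / Num.sqrt 2) (s / Num.sqrt 2) w.2)%:E).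
  have sr0 : s / Num.sqrt 2 != 0 by rewrite mulf_neq0// invr_eq0 gt_eqF.
  apply/measurable_EFinP; under eq_fun do rewrite (normal_pdfE _ sr0).
  apply: measurable_funM.
    apply: measurable_funM; first exact: measurableT_comp.
    exact: (measurableT_comp (mp 0 s) measurable_fst).
  apply: measurable_funM => //.
  apply: measurableT_comp => //.
  apply: measurable_funM => //; apply: measurableT_comp => //.
  apply: measurable_funX; apply: measurable_funB => //.
  by apply: measurable_funM.
transitivity (\int[leb]_x \int[leb]_z
  ((F z * normal_pdf 0 s z * normal_pdf (z / Num.sqrt 2) (s / Num.sqrt 2) x)%:E))%E.
  apply: eq_integral => x _.
  rewrite ge0_integral_normal_prob; last 2 first.
  - exact: (@measurable_fun_pair2 _ _ _ _ _ _ _ x mFxy).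
  - by move=> y; rewrite lee_fin.
  rewrite muleC -ge0_integralZl//; last 3 first.
  - apply: emeasurable_funM; first exact: (@measurable_fun_pair2 _ _ _ _ _ _ _ x mFxy).
    by apply/measurable_EFinP; exact: mp.
  - by move=> y _; rewrite mule_ge0// lee_fin// normal_pdf_ge0.
  - by rewrite lee_fin normal_pdf_ge0.
  under eq_integral do rewrite -!EFinM.
  pose A (z : R^o) := (z - x / Num.sqrt 2) * Num.sqrt 2.
  have AE z : A z = Num.sqrt 2 * z - x.
    by rewrite /A mulrBl divfK ?gt_eqF// mulrC.
  have A' : A^`()%classic = cst (Num.sqrt 2).
    apply/funext => z; rewrite /A derive1E deriveM// deriveD// derive_cst scaler0.
    by rewrite add0r derive_id derive_cst addr0 /GRing.scale /= mulr1.
  rewrite (@increasing_ge0_integration_by_substitutionT _ A); last 9 first.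
  - by move=> a b ab; rewrite !AE ltrD2r ltr_pM2l.
  - by rewrite A' => ?; exact: cvg_cst.
  - by rewrite A'; exact: is_cvg_cst.
  - by rewrite A'; exact: is_cvg_cst.
  - by move=> y; rewrite /A; apply: derivableM => //; apply: derivableB.
  - by apply/gt0_cvgMlNy; [|exact: cvg_addrr_Ny].
  - by apply/gt0_cvgMly; [|exact: cvg_addrr].
  - move=> y; apply: cvgM; first exact: cvg_cst.
    apply: cvgM; last exact: continuous_normal_pdf.
    apply: continuous_comp; last exact: cF.
    by apply: cvgM; [apply: cvgD; [exact: cvg_cst|exact: cvg_id]|exact: cvg_cst].
  - by move=> y; rewrite !mulr_ge0 ?normal_pdf_ge0.
  apply: eq_integral => z _; rewrite A'; congr EFin.
  rewrite -(mulrA (F z)) -normal_pdf_convolution// !fctE /= AE.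
  rewrite (addrC x) subrK (mulrAC (Num.sqrt 2)) divff ?gt_eqF// mul1r.
  ring.
rewrite -(@fubini_tonelli _ _ _ _ R leb leb _ mcomb); last first.
  by move=> z; rewrite lee_fin !mulr_ge0 ?normal_pdf_ge0.
rewrite /fubini_F /= ge0_integral_normal_prob; last 2 first.
- by apply/measurable_EFinP => //; exact: mp.
- by move=> y; rewrite lee_fin.
apply: eq_integral => z _.
under eq_integral do rewrite EFinM.
rewrite ge0_integralZl//; last 3 first.
- by apply/measurable_EFinP => //; exact: mp.
- by move=> y _; rewrite lee_fin normal_pdf_ge0.
- by rewrite lee_fin mulr_ge0 ?normal_pdf_ge0.
by rewrite integral_normal_pdf mule1 EFinM.
Qed.

End normal_integral.

(** * A central limit theorem for cosines *)

Section taylor.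
Context (R : realType).
Implicit Types x h th : R.

(** The bounds on sine and cosine below are obtained in a chain, each supplying the sign of the
    derivative for the next. Their cubic constants are crude, since only the order of the error
    matters. *)
Lemma le_of_ge0_derive (f df : R -> R) x :
  (forall y : R, is_derive y 1 f (df y)) -> (forall y, 0 <= y -> 0 <= df y) ->
  0 <= x -> f 0 <= f x.
Proof.
move=> fdf df0 x0.
have [c + E] : exists2 c, c \in `[0, x]%R & f x - f 0 = df c * (x - 0).
  apply: MVT_segment => //; apply: continuous_subspaceT => y.
  by apply: differentiable_continuous; apply/derivable1_diffP; exact: ex_derive.
rewrite in_itv /= => /andP[c0 _].
by rewrite -subr_ge0 E subr0 mulr_ge0// df0.
Qed.

Lemma sin_le_id x : 0 <= x -> sin x <= x.
Proof.
move=> x0; rewrite -subr_ge0.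
have := @le_of_ge0_derive (fun y => y - sin y) (fun y => 1 - cos y) x.
rewrite /= sin0 subr0; apply => //.
Qed.

Lemma one_sub_cos_le x : 0 <= x -> 1 - cos x <= x ^+ 2 / 2.
Proof.
move=> x0; rewrite -subr_ge0.
have := @le_of_ge0_derive (fun y => y ^+ 2 / 2 + cos y) (fun y => y - sin y) x.
rewrite /= cos0 expr0n /= mul0r add0r => H.
suff : 1 <= x ^+ 2 / 2 + cos x by lra.
apply: H => //.
  move=> y; apply: is_derive_eq; rewrite /GRing.scale /=.
  by field.
by move=> y y0; rewrite subr_ge0 sin_le_id.
Qed.

Lemma sin_ge_cubic x : 0 <= x -> x - x ^+ 3 <= sin x.
Proof.
move=> x0.
have := @le_of_ge0_derive (fun y => sin y - y + y ^+ 3)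
  (fun y => cos y - 1 + 3 * y ^+ 2) x.
rewrite /= sin0 subr0 expr0n /= addr0 => H.
suff : 0 <= sin x - x + x ^+ 3 by lra.
apply: H => //.
  move=> y; apply: is_derive_eq; rewrite /GRing.scale /=.
  by ring.
by move=> y y0; have := one_sub_cos_le y0; have := sqr_ge0 y; lra.
Qed.

Lemma cos_le_cubic x : 0 <= x -> cos x <= 1 - x ^+ 2 / 2 + x ^+ 3.
Proof.
move=> x0.
have := @le_of_ge0_derive (fun y => y ^+ 3 - y ^+ 2 / 2 - cos y)
  (fun y => 3 * y ^+ 2 - y + sin y) x.
rewrite /= cos0 !expr0n /= mul0r subr0 sub0r => H.
suff : -1 <= x ^+ 3 - x ^+ 2 / 2 - cos x by lra.
apply: H => //.
  move=> y; apply: is_derive_eq; rewrite /GRing.scale /=.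
  by field.
move=> y y0; have := sin_ge_cubic y0; have := sin_geN1 y.
(* Up to 3 the cubic bound on the sine leaves 3 y^2 - y^3 >= 0; beyond 3 the bound sin y >= -1
   suffices. *)
have [y3|y3] := leP y 3; nra.
Qed.

Lemma cos_taylor th h :
  `|cos (th + h) - (cos th - h * sin th - h ^+ 2 / 2 * cos th)| <= 2 * `|h| ^+ 3.
Proof.
wlog h0 : th h / 0 <= h.
  move=> H; have [/H//|hN] := leP 0 h.
  have := H (- th) (- h); rewrite -opprD !cosN sinN sqrrN mulrNN normrN.
  by apply; rewrite oppr_ge0 ltW.
have e : cos (th + h) - (cos th - h * sin th - h ^+ 2 / 2 * cos th) =
    cos th * (cos h - 1 + h ^+ 2 / 2) + sin th * (h - sin h).
  by rewrite cosD; ring.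
rewrite e (le_trans (ler_normD _ _))// !normrM (ger0_norm h0).
have -> : 2 * h ^+ 3 = 1 * h ^+ 3 + 1 * h ^+ 3 by ring.
apply: lerD; apply: ler_pM => //; rewrite ?cos_max ?sin_max//.
  rewrite ger0_norm; first by have := cos_le_cubic h0; lra.
  by have := one_sub_cos_le h0; lra.
rewrite ger0_norm; first by have := sin_ge_cubic h0; lra.
by rewrite subr_ge0 sin_le_id.
Qed.

(** The upper bound rests on (1 - x + x^2) (1 + x) = 1 + x^3 >= 1 and on 1 + x <= e^x. *)
Lemma expRN_quadratic x : 0 <= x -> `|expR (- x) - (1 - x)| <= x ^+ 2.
Proof.
move=> x0; rewrite ger0_norm; last first.
  by rewrite subr_ge0; have := expR_ge1Dx (- x).
have h := expR_ge1Dx x; rewrite expRN.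
have e0 : 0 < expR x by exact: expR_gt0.
suff : (expR x)^-1 <= 1 - x + x ^+ 2 by lra.
rewrite -div1r ler_pdivrMr//.
have : (1 - x + x ^+ 2) * (1 + x) <= (1 - x + x ^+ 2) * expR x.
  by rewrite ler_wpM2l//; nra.
have : 0 <= x ^+ 3 by rewrite exprn_ge0.
nra.
Qed.

End taylor.

Lemma measurable_cos d (T : measurableType d) (R : realType) (f : T -> R) :
  measurable_fun setT f -> measurable_fun setT (fun x => cos (f x)).
Proof.
move=> mf; apply: measurableT_comp => //.
by apply: continuous_measurable_fun; exact: continuous_cos.
Qed.

Section cos_expectation.
Context d (T : measurableType d) (R : realType) (P : probability T R).
Implicit Types (r : T -> R) (th : R).

Lemma integrable_cos (f : T -> R) : measurable_fun setT f ->
  P.-integrable setT (EFin \o (fun x => cos (f x))).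
Proof.
move=> mf; apply: (@bounded_integrable _ _ _ _ _ 1); last by move=> x; exact: cos_max.
exact: measurable_cos.
Qed.

(** The phase [th] is arbitrary because the other terms of a sum will enter through it. Phases also
    cover sines, so that no complex exponential is needed. *)
Lemma cos_expectation_taylor r th : measurable_fun setT r ->
  P.-integrable setT (EFin \o r) ->
  P.-integrable setT (EFin \o (fun x => r x ^+ 2)) ->
  P.-integrable setT (EFin \o (fun x => `|r x| ^+ 3)) ->
  \int[P]_x r x = 0 ->
  `|\int[P]_x cos (th + r x) - (1 - (\int[P]_x (r x ^+ 2)) / 2) * cos th| <=
  2 * \int[P]_x (`|r x| ^+ 3).
Proof.
move=> mr ir ir2 ir3 r0.
have ic : P.-integrable setT (EFin \o (fun x => cos (th + r x))).
  by apply: integrable_cos; exact: measurable_funD.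
pose L x : R := cos th - sin th * r x - (cos th / 2) * r x ^+ 2.
have irs := integrable_EFinZl (sin th) ir.
have ir2s := integrable_EFinZl (cos th / 2) ir2.
have ic1 := integrable_EFinB (integrable_EFin_cst P (cos th)) irs.
have iL := integrable_EFinB ic1 ir2s.
have -> : (1 - (\int[P]_x (r x ^+ 2)) / 2) * cos th = \int[P]_x L x.
  rewrite /L (RintegralB measurableT ic1 ir2s).
  rewrite (RintegralB measurableT (integrable_EFin_cst P _) irs).
  rewrite Rintegral_prob_cst (RintegralZl _ measurableT ir) (RintegralZl _ measurableT ir2).
  by rewrite r0; field.
rewrite -RintegralB//.
have iD := integrable_EFinB ic iL.
apply: (le_trans (le_normr_Rintegral _ _)) => //.
rewrite -RintegralZl//; apply: le_Rintegral => //.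
- exact: integrable_EFin_norm.
- exact: integrable_EFinZl.
move=> x _; have := cos_taylor th (r x).
by rewrite (_ : cos th - _ - _ = L x)//; rewrite /L; field.
Qed.

(** The factor 1 - t^2 v / 2 is traded for an exponential, whose powers are exact; the cost is the
    square of t^2 v / 2. *)
Lemma cos_expectation_exp r (t th : R) : measurable_fun setT r ->
  P.-integrable setT (EFin \o r) ->
  P.-integrable setT (EFin \o (fun x => r x ^+ 2)) ->
  P.-integrable setT (EFin \o (fun x => `|r x| ^+ 3)) ->
  \int[P]_x r x = 0 ->
  `|\int[P]_x cos (th + t * r x) - expR (- (t ^+ 2 * \int[P]_x (r x ^+ 2) / 2)) * cos th| <=
  2 * `|t| ^+ 3 * \int[P]_x (`|r x| ^+ 3) + t ^+ 4 * (\int[P]_x (r x ^+ 2)) ^+ 2 / 4.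
Proof.
move=> mr ir ir2 ir3 r0.
have E2 : (fun x => (t * r x) ^+ 2) = (fun x => t ^+ 2 * r x ^+ 2).
  by apply/funext => x; rewrite exprMn.
have E3 : (fun x => `|t * r x| ^+ 3) = (fun x => `|t| ^+ 3 * `|r x| ^+ 3).
  by apply/funext => x; rewrite normrM exprMn.
have := @cos_expectation_taylor (fun x => t * r x) th.
rewrite E2 E3 !RintegralZl// r0 mulr0.
move=> /(_ (measurable_funM (measurable_cst t) mr) (integrable_EFinZl _ ir) (integrable_EFinZl _ ir2) (integrable_EFinZl _ ir3) erefl) /=.
set v := \int[P]_x (r x ^+ 2); set m3 := \int[P]_x (`|r x| ^+ 3).
set c := \int[P]_x cos _.
have v0 : 0 <= v by apply: Rintegral_ge0 => x _; exact: sqr_ge0.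
move=> h.
have u0 : 0 <= t ^+ 2 * v / 2 by rewrite divr_ge0// mulr_ge0// sqr_ge0.
have := expRN_quadratic u0.
have h1 := cos_max th.
set e := expR _ => he.
have -> : c - e * cos th = (c - (1 - t ^+ 2 * v / 2) * cos th) -
  (e - (1 - t ^+ 2 * v / 2)) * cos th by ring.
rewrite (le_trans (ler_normB _ _))// lerD// ?(le_trans h)//.
  by rewrite mulrA.
rewrite normrM (le_trans (ler_piMr _ h1))// (le_trans he)//.
by rewrite le_eqVlt; apply/orP; left; apply/eqP; field.
Qed.

(** The summands are integrated out one after the other, each becoming a factor [y] at cost [eps].
    The errors only add up because 0 <= y <= 1. *)
Lemma cos_sum_prob_pow r (y eps : R) : measurable_fun setT r ->
  0 <= y <= 1 ->
  (forall th, `|\int[P]_x cos (th + r x) - y * cos th| <= eps) ->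
  forall k th, `|\int[prob_pow P k]_x cos (th + \sum_(i < k) r (tnth x i)) -
    y ^+ k * cos th| <= k%:R * eps.
Proof.
move=> mr /andP[y0 y1] H; elim=> [|k ih] th.
  by rewrite Rintegral_prob_pow0 big_ord0 addr0 expr0 mul1r subrr normr0 mul0r.
have mS j c : measurable_fun setT (fun x : j.-tuple T => cos (c + \sum_(i < j) r (tnth x i))).
  apply: measurable_cos.
  apply: measurable_funD => //.
  apply: (eq_measurable_fun (fun x : j.-tuple T => \sum_(i <- index_enum 'I_j) r (tnth x i))) => //.
  apply: measurable_sum => i; apply: measurableT_comp => //; exact: measurable_tnth.
rewrite (@Rintegral_prob_powS _ _ _ _ _ _ 1)//; last by move=> x; exact: cos_max.
pose h a := \int[prob_pow P k]_t cos ((th + r a) + \sum_(i < k) r (tnth t i)).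
have hE a : \int[prob_pow P k]_t cos (th + \sum_(i < k.+1) r (tnth (tcons (a, t)) i)) = h a.
  apply: eq_Rintegral => t _; rewrite big_ord_recl tnth0 addrA.
  by under eq_bigr do rewrite tnthS.
under eq_Rintegral do rewrite hE.
have h1 a : `|h a| <= 1.
  by apply: Rintegral_le_bound; [exact: mS|move=> x; exact: cos_max].
have mh : measurable_fun setT h.
  apply: (@measurable_Rintegral_section _ _ _ _ _ (prob_pow P k)
    (fun z => cos ((th + r z.1) + \sum_(i < k) r (tnth z.2 i))) 1) => //.
    apply: measurable_cos.
    apply: measurable_funD.
      by apply: measurable_funD => //; apply: measurableT_comp.
    apply: (eq_measurable_fun (fun z => \sum_(i <- index_enum 'I_k) r (tnth z.2 i))) => //.
    apply: measurable_sum => i; apply: measurableT_comp => //.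
    exact: (measurableT_comp (measurable_tnth i)).
  by move=> z; exact: cos_max.
have ih_ : P.-integrable setT (EFin \o h) by exact: (@bounded_integrable _ _ _ _ _ 1).
have mc : measurable_fun setT (fun a => th + r a) by exact: measurable_funD.
have icr := integrable_cos mc.
have iy := integrable_EFinZl (y ^+ k) icr.
have -> : \int[P]_a h a - y ^+ k.+1 * cos th =
   \int[P]_a (h a - y ^+ k * cos (th + r a)) +
   y ^+ k * (\int[P]_a cos (th + r a) - y * cos th).
  by rewrite RintegralB// RintegralZl//; rewrite exprSr; ring.
rewrite (le_trans (ler_normD _ _))// -natr1 mulrDl mul1r lerD//.
  apply: Rintegral_le_bound; last by move=> a; exact: ih.
  by apply: measurable_funB => //; apply: measurable_funM => //; exact: measurable_integrable_EFin icr.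
rewrite normrM ger0_norm ?exprn_ge0//.
by rewrite (le_trans _ (H th))// ler_piMl// exprn_ile1.
Qed.

(** Apply the previous bound to [r] scaled by t = 1 / sqrt n. The errors of order t^3 and t^4,
    multiplied by n, become t and t^2 <= t. *)
Lemma clt_cos r (th : R) n : measurable_fun setT r ->
  P.-integrable setT (EFin \o r) ->
  P.-integrable setT (EFin \o (fun x => r x ^+ 2)) ->
  P.-integrable setT (EFin \o (fun x => `|r x| ^+ 3)) ->
  \int[P]_x r x = 0 -> (0 < n)%N ->
  `|\int[prob_pow P n]_x cos (th + (\sum_(i < n) r (tnth x i)) / Num.sqrt n%:R) -
    expR (- (\int[P]_x (r x ^+ 2) / 2)) * cos th| <=
  (2 * \int[P]_x (`|r x| ^+ 3) + (\int[P]_x (r x ^+ 2)) ^+ 2) / Num.sqrt n%:R.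
Proof.
move=> mr ir ir2 ir3 r0 n0.
set v := \int[P]_x (r x ^+ 2); set m3 := \int[P]_x (`|r x| ^+ 3).
have v0 : 0 <= v by apply: Rintegral_ge0 => x _; exact: sqr_ge0.
have m30 : 0 <= m3 by apply: Rintegral_ge0 => x _; exact: exprn_ge0.
set t := (Num.sqrt n%:R)^-1 : R.
have sn0 : 0 < Num.sqrt n%:R :> R by rewrite sqrtr_gt0 ltr0n.
have t0 : 0 < t by rewrite invr_gt0.
have t2 : n%:R * t ^+ 2 = 1.
  by rewrite exprVn sqr_sqrtr// divff// pnatr_eq0 -lt0n.
have t1 : t <= 1.
  have : Num.sqrt 1 <= Num.sqrt n%:R :> R by apply: ler_wsqrtr; rewrite ler1n.
  by rewrite sqrtr1 invf_le1.
pose y := expR (- (t ^+ 2 * v / 2)).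
pose eps := 2 * `|t| ^+ 3 * m3 + t ^+ 4 * v ^+ 2 / 4.
have y01 : 0 <= y <= 1.
  rewrite expR_ge0/= -expR0 ler_expR oppr_le0 divr_ge0// mulr_ge0// sqr_ge0//.
have := @cos_sum_prob_pow (fun x => t * r x) y eps (measurable_funM (measurable_cst t) mr) y01
  (fun th => cos_expectation_exp t th mr ir ir2 ir3 r0) n th.
have -> : y ^+ n = expR (- (v / 2)).
  rewrite /y -expRM_natl; congr expR.
  rewrite (_ : n%:R * - _ = - ((n%:R * t ^+ 2) * v / 2)); last by field.
  by rewrite t2 mul1r.
under eq_Rintegral do rewrite -mulr_sumr mulrC.
move=> /le_trans; apply.
rewrite /eps (ger0_norm (ltW t0)) mulrDr.
have -> : n%:R * (2 * t ^+ 3 * m3) = (n%:R * t ^+ 2) * t * (2 * m3) by ring.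
have -> : n%:R * (t ^+ 4 * v ^+ 2 / 4) = (n%:R * t ^+ 2) * t ^+ 2 * (v ^+ 2 / 4) by field.
rewrite t2 !mul1r.
have v20 := sqr_ge0 v.
have t2t : t ^+ 2 <= t by rewrite expr2 ler_piMl// ltW.
have := ler_wpM2r v20 t2t; have := mulr_ge0 (ltW t0) v20.
by move: (t ^+ 2) (v ^+ 2) => a b; lra.
Qed.

End cos_expectation.

(** * Characteristic functions of normal laws *)

Section normal_characteristic.
Context (R : realType) (s : R).
Hypothesis s0 : s != 0.
Local Notation N := (normal_prob 0 s).

Lemma normal_integrable_pow4 : N.-integrable setT (EFin \o (fun x : R => x ^+ 4)).
Proof.
apply/integrableP; split.
  by apply/measurable_EFinP; exact: measurable_funX.
under eq_integral do rewrite /= ger0_norm ?exprn_even_ge0//.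
exact: normal_prob_moment4.
Qed.

Lemma normal_integrable_le_pow4 (f : R -> R) : measurable_fun setT f ->
  (forall x, `|f x| <= 1 + x ^+ 4) -> N.-integrable setT (EFin \o f).
Proof.
move=> mf f4.
have i4 := integrable_EFinD (integrable_EFin_cst N 1) normal_integrable_pow4.
apply: (le_integrable _ _ _ i4) => //; first exact/measurable_EFinP.
by move=> x _; rewrite /= lee_fin (le_trans (f4 x))// ler_norm.
Qed.

Lemma norm_pow_le_pow4 (k : nat) (x : R) : (k <= 4)%N -> `|x| ^+ k <= 1 + x ^+ 4.
Proof.
move=> k4; have x40 : 0 <= x ^+ 4 by rewrite exprn_even_ge0.
have [x1|x1] := leP `|x| 1.
  by rewrite (@le_trans _ _ 1)// ?exprn_ile1// lerDl.
have -> : x ^+ 4 = `|x| ^+ 4 by rewrite -normrX ger0_norm.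
by rewrite (@le_trans _ _ (`|x| ^+ 4))// ?lerDr// ler_eXn2l.
Qed.

Lemma normal_integrable_id : N.-integrable setT (EFin \o id).
Proof.
apply: normal_integrable_le_pow4 => // x.
by rewrite -[`|_|]expr1 norm_pow_le_pow4.
Qed.

Lemma normal_integrable_sqr : N.-integrable setT (EFin \o (fun x : R => x ^+ 2)).
Proof.
apply: normal_integrable_le_pow4 => [|x]; first exact: measurable_funX.
by rewrite normrX norm_pow_le_pow4.
Qed.

Lemma normal_integrable_cube : N.-integrable setT (EFin \o (fun x : R => `|x| ^+ 3)).
Proof.
apply: normal_integrable_le_pow4 => [|x].
  by apply: measurable_funX; exact: normr_measurable.
by rewrite normrX normr_id norm_pow_le_pow4.
Qed.

Lemma normal_RintegralN (f : R -> R) : N.-integrable setT (EFin \o f) ->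
  \int[N]_x f (- x) = \int[N]_x f x.
Proof.
move=> iff; have mf := measurable_integrable_EFin iff.
rewrite /Rintegral; congr fine; rewrite [LHS]integralE [RHS]integralE.
have mEf : measurable_fun setT (EFin \o f) by exact/measurable_EFinP.
congr (_ - _)%E.
  rewrite -(ge0_integral_normal_probN s0 (measurable_funepos mEf))//.
  by apply: eq_integral => x _; rewrite !funeposE.
rewrite -(ge0_integral_normal_probN s0 (measurable_funeneg mEf))//.
by apply: eq_integral => x _; rewrite !funenegE.
Qed.

Lemma normal_mean0 : \int[N]_x x = 0.
Proof.
have := normal_RintegralN normal_integrable_id; rewrite /=.
rewrite (_ : \int[N]_x (- x) = - \int[N]_x x); first by lra.
rewrite -mulN1r -(RintegralZl _ measurableT normal_integrable_id).
by apply: eq_Rintegral => x _; rewrite mulN1r.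
Qed.

Let a (t : R) := \int[N]_x cos (t * x).

Lemma normal_cos_shift t th : \int[N]_x cos (th + t * x) = a t * cos th.
Proof.
have mt : measurable_fun setT (fun x : R => t * x) by exact: measurable_funM.
have ic : N.-integrable setT (EFin \o (fun x : R => cos (t * x))).
  exact: integrable_cos.
have is_ : N.-integrable setT (EFin \o (fun x : R => sin (t * x))).
  apply: (@bounded_integrable _ _ _ _ _ 1); last by move=> x; exact: sin_max.
  apply: (measurableT_comp (f := @sin R)) => //.
  by apply: continuous_measurable_fun; exact: continuous_sin.
have E0 : \int[N]_x sin (t * x) = 0.
  have := normal_RintegralN is_.
  rewrite (_ : \int[N]_x sin (t * - x) = - \int[N]_x sin (t * x)); first by lra.
  rewrite -mulN1r -(RintegralZl _ measurableT is_).
  by apply: eq_Rintegral => x _; rewrite mulrN sinN mulN1r.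
transitivity (\int[N]_x (cos th * cos (t * x) - sin th * sin (t * x))).
  by apply: eq_Rintegral => x _; rewrite cosD.
rewrite (RintegralB measurableT (integrable_EFinZl _ ic) (integrable_EFinZl _ is_)).
by rewrite (RintegralZl _ measurableT ic) (RintegralZl _ measurableT is_) E0 mulr0 subr0 mulrC.
Qed.

Lemma normal_cos_sqrt2 t : a t = a (t / Num.sqrt 2) ^+ 2.
Proof.
have i1 (f : R -> R) : measurable_fun setT f -> (forall x, `|f x| <= 1) ->
    (\int[N]_x (1 + f x)%:E = (1 + \int[N]_x f x)%:E)%E.
  move=> mf f1; under eq_integral do rewrite EFinD.
  have if_ := bounded_integrable N mf f1.
  rewrite integralD//; last exact: integrable_EFin_cst.
  by rewrite integral_prob_cst -(EFin_Rintegral if_).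
have mcos (u c : R) : measurable_fun setT (fun x : R => cos (c + u * x)).
  by apply: measurable_cos; apply: measurable_funD => //; exact: measurable_funM.
have cos1 (u c x : R) : `|cos (c + u * x)| <= 1 by exact: cos_max.
(* Stability is stated for nonnegative functions, hence the cosine is raised by 1. *)
have cF : continuous (fun z : R => 1 + cos (t * z)).
  move=> z; apply: cvgD; first exact: cvg_cst.
  apply: continuous_comp; last exact: continuous_cos.
  by apply: cvgM; [exact: cvg_cst|exact: cvg_id].
have F0 z : 0 <= 1 + cos (t * z) by have := cos_geN1 (t * z); lra.
have := normal_prob_stable s0 cF F0.
set u := t / Num.sqrt 2.
have i0 (v : R) : (\int[N]_z (1 + cos (v * z))%:E = (1 + a v)%:E)%E.
  apply: (i1 (fun z => cos (v * z))); last by move=> x; exact: cos_max.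
  by apply: measurable_cos; exact: measurable_funM.
have E1 : (\int[N]_x \int[N]_y (1 + cos (t * ((x + y) / Num.sqrt 2)))%:E =
    \int[N]_x (1 + a u * cos (u * x))%:E)%E.
  apply: eq_integral => x _; rewrite -normal_cos_shift -(i1 _ (mcos u (u * x)))//.
  by apply: eq_integral => y _; rewrite /u; congr (1 + cos _)%:E; ring.
rewrite i0 E1.
have mau : measurable_fun setT (fun x : R => a u * cos (u * x)).
  by apply: measurable_funM => //; apply: measurable_cos; exact: measurable_funM.
have au1 : `|a u| <= 1.
  apply: Rintegral_le_bound; last by move=> x; exact: cos_max.
  by apply: measurable_cos; exact: measurable_funM.
rewrite (i1 _ mau); last by move=> x; rewrite normrM mulr_ile1// cos_max.
rewrite RintegralZl//; last by apply: integrable_cos; exact: measurable_funM.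
by move=> [] /addrI <-; rewrite expr2.
Qed.

Lemma normr_exprB_le (x y : R) n : `|x| <= 1 -> `|y| <= 1 ->
  `|x ^+ n - y ^+ n| <= n%:R * `|x - y|.
Proof.
move=> x1 y1; rewrite subrXX normrM mulrC ler_wpM2r//.
apply: (le_trans (ler_norm_sum _ _ _)).
rewrite -[n in leRHS]card_ord -sumr_const ler_sum// => i _.
by rewrite normrM !normrX mulr_ile1// exprn_ile1.
Qed.

(** Both sides, as functions of t, satisfy f(t) = f(t / sqrt 2)^2 and differ by O(|t|^3) near 0.
    After k halvings of the variance the difference is at most 2^k times O(2^(-3k/2)), which tends
    to 0. The variance remains an unevaluated integral throughout. *)
Lemma normal_cos t th : \int[N]_x cos (th + t * x) =
  expR (- (t ^+ 2 * \int[N]_x (x ^+ 2) / 2)) * cos th.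
Proof.
rewrite normal_cos_shift; congr (_ * _).
set v := \int[N]_x (x ^+ 2); set m := \int[N]_x (`|x| ^+ 3).
have v0 : 0 <= v by apply: Rintegral_ge0 => x _; exact: sqr_ge0.
have m0 : 0 <= m by apply: Rintegral_ge0 => x _; exact: exprn_ge0.
pose e (w : R) := expR (- (w ^+ 2 * v / 2)).
have bound w : `|a w - e w| <= 2 * `|w| ^+ 3 * m + w ^+ 4 * v ^+ 2 / 4.
  have := @cos_expectation_exp _ _ _ N id w 0 (@measurable_id _ _ setT)
    normal_integrable_id normal_integrable_sqr normal_integrable_cube normal_mean0.
  rewrite cos0 mulr1 -/v -/m /=.
  by under eq_Rintegral do rewrite add0r.
have a1 w : `|a w| <= 1.
  apply: Rintegral_le_bound; last by move=> x; exact: cos_max.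
  by apply: measurable_cos; exact: measurable_funM.
have e1 w : `|e w| <= 1.
  rewrite ger0_norm ?expR_ge0// -expR0 ler_expR oppr_le0 divr_ge0// mulr_ge0// sqr_ge0//.
pose q : R := (Num.sqrt 2)^-1.
have q0 : 0 < q by rewrite invr_gt0 sqrtr_gt0.
have q2 : 2 * q ^+ 2 = 1 by rewrite exprVn sqr_sqrtr// divff.
have q1 : q < 1 by nra.
have aq k : a t = a (t * q ^+ k) ^+ (2 ^ k).
  elim: k => [|k ->]; first by rewrite expr0 mulr1 expn0 expr1.
  by rewrite normal_cos_sqrt2 -exprM exprSr mulrA expnS.
have eq_ k : e t = e (t * q ^+ k) ^+ (2 ^ k).
  elim: k => [|k ->]; first by rewrite expr0 mulr1 expn0 expr1.
  rewrite expnS exprM; congr (_ ^+ _); rewrite expr2 -expRD; congr expR.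
  have -> : t * q ^+ k.+1 = (t * q ^+ k) * q by rewrite exprSr mulrA.
  move: (t * q ^+ k) => z; rewrite exprMn.
  have -> : q ^+ 2 = 2^-1 by lra.
  by field.
pose C := 2 * `|t| ^+ 3 * m + t ^+ 4 * v ^+ 2 / 4.
have H k : `|a t - e t| <= C * q ^+ k.
  rewrite (aq k) (eq_ k) (le_trans (normr_exprB_le _ (a1 _) (e1 _)))//.
  rewrite (le_trans (ler_wpM2l (ler0n _ _) (bound _)))//.
  rewrite natrX.
  have qk0 : 0 < q ^+ k by rewrite exprn_gt0.
  have qk1 : q ^+ k <= 1 by rewrite exprn_ile1// ltW.
  have E : 2 ^+ k * (q ^+ k) ^+ 2 = 1 by rewrite exprAC -exprMn q2 expr1n.
  rewrite normrM (ger0_norm (ltW qk0)) /C.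
  move: E qk0 qk1; move: (2 ^+ k) (q ^+ k) => K z E z0 z1.
  have -> : K * (2 * (`|t| * z) ^+ 3 * m + (t * z) ^+ 4 * v ^+ 2 / 4) =
    (K * z ^+ 2) * z * (2 * `|t| ^+ 3 * m) + (K * z ^+ 2) * z ^+ 2 * (t ^+ 4 * v ^+ 2 / 4).
    by field.
  rewrite E !mul1r.
  have X0 : 0 <= t ^+ 4 * v ^+ 2 / 4.
    by rewrite divr_ge0// mulr_ge0 ?sqr_ge0// exprn_even_ge0.
  have z2 : z ^+ 2 <= z by rewrite expr2 ler_piMl// ltW.
  have := ler_wpM2r X0 z2.
  by move: (t ^+ 4 * v ^+ 2 / 4) (2 * `|t| ^+ 3 * m) (z ^+ 2) => X Y Z; lra.
apply/eqP; rewrite -subr_eq0 -normr_le0.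
have cv : C * q ^+ k @[k --> \oo] --> C * 0.
  by apply: cvgM; [exact: cvg_cst|apply: cvg_expr; rewrite ger0_norm// ltW].
rewrite mulr0 in cv; have := cvg_lim (@Rhausdorff R) cv => <-.
apply: limr_ge; first by apply/cvg_ex; exists 0.
by near=> k; exact: H.
Unshelve. all: end_near. Qed.

End normal_characteristic.

Section gaussian_variable.
Context d (S : measurableType d) (R : realType) (P : probability S R).

(** The Dirac mass and the nondegenerate normal laws are put on the same footing: later arguments
    use only the cosine identity and the second moment. *)
Lemma centered_normal_law (X : S -> R) (s : R) : measurable_fun setT X ->
  (forall B : set R, measurable B -> P [set w | B (X w)] = centered_normal s B) ->
  exists2 Q : probability (measurableTypeR R) R, (forall th, \int[Q]_x cos (th + x) =
      expR (- (\int[Q]_x (x ^+ 2) / 2)) * cos th) /\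
    Q.-integrable setT (EFin \o (fun x : R => x ^+ 2)) &
    forall B : set R, measurable B -> P (X @^-1` B) = Q B.
Proof.
move=> mX; rewrite /centered_normal; have [_ H|s0 H] := eqVneq s 0.
  exists [the probability (measurableTypeR R) R of \d_(0 : measurableTypeR R)] => //; split.
    move=> th; rewrite /Rintegral !integral_dirac//; last 2 first.
    - by apply/measurable_EFinP; exact: measurable_funX.
    - by apply/measurable_EFinP; apply: measurable_cos; exact: measurable_funD.
    by rewrite !diracT !mul1e /= expr0n /= mul0r oppr0 expR0 mul1r addr0.
  apply/integrableP; split; first by apply/measurable_EFinP; exact: measurable_funX.
  rewrite integral_dirac//; last first.
    by apply: measurableT_comp => //; apply/measurable_EFinP; exact: measurable_funX.
  by rewrite diracT mul1e ltry.
exists [the probability (measurableTypeR R) R of normal_prob 0 s] => //; split; last exact: normal_integrable_sqr.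
move=> th; have := normal_cos s0 1 th; rewrite expr1n mul1r => <-.
by apply: eq_Rintegral => x _; rewrite mul1r.
Qed.

Lemma law_ge0_integral (X : S -> R) (Q : probability (measurableTypeR R) R) (f : R -> \bar R) :
  measurable_fun setT X -> measurable_fun setT f -> (forall x, 0 <= f x)%E ->
  (forall B : set R, measurable B -> P (X @^-1` B) = Q B) ->
  (\int[P]_w f (X w) = \int[Q]_x f x)%E.
Proof.
move=> mX mf f0 H.
have := @ge0_integral_pushforward _ _ _ (measurableTypeR R) R X mX P setT f measurableT mf (fun x _ => f0 x).
rewrite preimage_setT => <-.
by apply: eq_measure_integral => B mB _; exact: H.
Qed.

Lemma law_integrable (X : S -> R) (Q : probability (measurableTypeR R) R) (f : R -> R) :
  measurable_fun setT X -> Q.-integrable setT (EFin \o f) ->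
  (forall B : set R, measurable B -> P (X @^-1` B) = Q B) ->
  P.-integrable setT (EFin \o (fun w => f (X w))).
Proof.
move=> mX iff H; have mf := measurable_integrable_EFin iff.
apply/integrableP; split.
  by apply/measurable_EFinP; exact: measurableT_comp.
move/integrableP : iff => [_].
rewrite -(@law_ge0_integral X Q (fun x => `|(f x)%:E|%E))//.
by apply: measurableT_comp => //; exact/measurable_EFinP.
Qed.

Lemma law_Rintegral (X : S -> R) (Q : probability (measurableTypeR R) R) (f : R -> R) :
  measurable_fun setT X -> Q.-integrable setT (EFin \o f) ->
  (forall B : set R, measurable B -> P (X @^-1` B) = Q B) ->
  \int[P]_w f (X w) = \int[Q]_x f x.
Proof.
move=> mX iff H; have mf := measurable_integrable_EFin iff.
have mEf : measurable_fun setT (EFin \o f) by exact/measurable_EFinP.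
rewrite /Rintegral; congr fine; rewrite [LHS]integralE [RHS]integralE.
congr (_ - _)%E.
  rewrite -(law_ge0_integral mX (measurable_funepos mEf) _ H)//.
  by apply: eq_integral => x _; rewrite !funeposE.
rewrite -(law_ge0_integral mX (measurable_funeneg mEf) _ H)//.
by apply: eq_integral => x _; rewrite !funenegE.
Qed.

Lemma centered_normal_cos (X : S -> R) (s : R) : measurable_fun setT X ->
  (forall B : set R, measurable B -> P [set w | B (X w)] = centered_normal s B) ->
  P.-integrable setT (EFin \o (fun w => X w ^+ 2)) /\
  forall th, \int[P]_w cos (th + X w) = expR (- (\int[P]_w (X w ^+ 2) / 2)) * cos th.
Proof.
move=> mX /(centered_normal_law mX)[Q [Qc Q2] H]; split.
  exact: (law_integrable mX Q2 H).
move=> th; rewrite (law_Rintegral mX Q2 H) -Qc.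
apply: (law_Rintegral (f := fun x => cos (th + x)) mX _ H).
by apply: integrable_cos; exact: measurable_funD.
Qed.

End gaussian_variable.

(** * Trigonometric polynomials and convergence in law *)

Section trigonometric_polynomials.
Context (R : realType) (k : nat).
Implicit Types (f g : ('I_k -> R) -> R) (x u : 'I_k -> R).

(* A Gaussian vector [Y] enters only through the values of E cos (th + <u, Y>), so
   that all its tail probabilities are compared by means of such test functions. *)
Inductive trigpoly : (('I_k -> R) -> R) -> Prop :=
| trigpoly_cos c th u : trigpoly (fun x => c * cos (th + \sum_(i < k) u i * x i))
| trigpolyD f g : trigpoly f -> trigpoly g -> trigpoly (fun x => f x + g x).

Lemma trigpoly_cst c : trigpoly (fun=> c).
Proof.
rewrite (_ : (fun=> c) = fun x => c * cos (0 + \sum_(i < k) (fun=> 0) i * x i)).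
  exact: trigpoly_cos.
apply/funext => x; rewrite big1 ?addr0 ?cos0 ?mulr1// => i _.
by rewrite mul0r.
Qed.

Lemma trigpolyZ c f : trigpoly f -> trigpoly (fun x => c * f x).
Proof.
elim=> [c' th u|g h _ ig _ ih].
  under eq_fun do rewrite mulrA; exact: trigpoly_cos.
by under eq_fun do rewrite mulrDr; exact: trigpolyD.
Qed.

Lemma trigpolyM f g : trigpoly f -> trigpoly g -> trigpoly (fun x => f x * g x).
Proof.
move=> + tg; elim=> [c th u|f1 f2 _ if1 _ if2]; last first.
  by under eq_fun do rewrite mulrDl; exact: trigpolyD.
elim: tg => [c' th' u'|g1 g2 _ ig1 _ ig2]; last first.
  by under eq_fun do rewrite mulrDr; exact: trigpolyD.
rewrite (_ : (fun x => _) = fun x =>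
  c * c' / 2 * cos ((th + th') + \sum_(i < k) (u i + u' i) * x i) +
  c * c' / 2 * cos ((th - th') + \sum_(i < k) (u i - u' i) * x i)).
  apply: trigpolyD.
    exact: (trigpoly_cos _ _ (fun i => u i + u' i)).
  exact: (trigpoly_cos _ _ (fun i => u i - u' i)).
apply/funext => x.
under [in RHS]eq_bigr do rewrite mulrDl.
under [X in _ = _ + _ * cos (_ + X)]eq_bigr do rewrite mulrBl.
rewrite big_split sumrB /=.
set A := \sum_(i < k) u i * x i; set B := \sum_(i < k) u' i * x i.
have -> : th + th' + (A + B) = (th + A) + (th' + B) by ring.
have -> : th - th' + (A - B) = (th + A) - (th' + B) by ring.
by move: (th + A) (th' + B) => X Y; rewrite cosD cosB; field.
Qed.

Lemma trigpolyX f n : trigpoly f -> trigpoly (fun x => f x ^+ n).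
Proof.
move=> tf; elim: n => [|n ih]; first exact: trigpoly_cst.
by under eq_fun do rewrite exprS; exact: trigpolyM.
Qed.

Lemma trigpolyB f g : trigpoly f -> trigpoly g -> trigpoly (fun x => f x - g x).
Proof.
move=> tf tg; under eq_fun do rewrite -mulN1r.
by apply: trigpolyD => //; exact: trigpolyZ.
Qed.

Lemma trigpoly_prod (I : Type) (s : seq I) (F : I -> ('I_k -> R) -> R) :
  (forall i, trigpoly (F i)) -> trigpoly (fun x => \prod_(i <- s) F i x).
Proof.
move=> tF; elim: s => [|i s ih].
  by under eq_fun do rewrite big_nil; exact: trigpoly_cst.
by under eq_fun do rewrite big_cons; exact: trigpolyM.
Qed.

Lemma trigpoly_sin_coord (c : R) (i : 'I_k) : trigpoly (fun x => sin (c * x i)).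
Proof.
rewrite (_ : (fun x => _) = fun x =>
   1 * cos (- (pi / 2) + \sum_(j < k) (fun j => if j == i then c else 0) j * x j)).
  exact: trigpoly_cos.
apply/funext => x; rewrite (bigD1 i)//= eqxx big1 ?addr0; last first.
  by move=> j /negbTE ->; rewrite mul0r.
by rewrite addrC cosBpihalf mul1r.
Qed.

Lemma trigpoly_bounded f : trigpoly f -> exists M, forall x, `|f x| <= M.
Proof.
elim=> [c th u|g h _ [M gM] _ [M' hM']].
  by exists `|c| => x; rewrite normrM ler_piMr// cos_max.
by exists (M + M') => x; rewrite (le_trans (ler_normD _ _))// lerD.
Qed.

Lemma measurable_trigpoly f d (S : measurableType d) (Y : S -> 'I_k -> R) :
  trigpoly f -> (forall i, measurable_fun setT (Y ^~ i)) ->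
  measurable_fun setT (fun w => f (Y w)).
Proof.
move=> tf mY; elim: tf => [c th u|g h _ ig _ ih]; last exact: measurable_funD.
apply: measurable_funM => //; apply: measurable_cos.
apply: measurable_funD => //.
rewrite (_ : (fun _ => _) = fun w => \sum_(i <- index_enum 'I_k) u i * Y w i)//.
by apply: measurable_sum => i; apply: measurable_funM.
Qed.

Lemma trigpoly_integrable f d (S : measurableType d) (P : probability S R)
    (Y : S -> 'I_k -> R) :
  trigpoly f -> (forall i, measurable_fun setT (Y ^~ i)) ->
  P.-integrable setT (EFin \o (fun w => f (Y w))).
Proof.
move=> tf mY; have [M fM] := trigpoly_bounded tf.
by apply: (@bounded_integrable _ _ _ _ _ M) => //; exact: measurable_trigpoly.
Qed.

End trigonometric_polynomials.

Section trigonometric_approximation.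
Context (R : realType).

Lemma bernoulli_ineq (y : R) n : 0 <= y <= 1 -> 1 - n%:R * y <= (1 - y) ^+ n.
Proof.
move=> /andP[y0 y1]; elim: n => [|n ih]; first by rewrite mul0r subr0 expr0.
rewrite exprS -natr1.
have := ler_wpM2l (_ : 0 <= 1 - y) ih; rewrite subr_ge0 => /(_ y1).
apply: le_trans; have := mulr_ge0 (ler0n R n) (sqr_ge0 y); nra.
Qed.

(** Bernoulli's inequality for 1 + y, followed by (1 - y)(1 + y) <= 1. *)
Lemma expr_1B_le (y : R) n : 0 <= y <= 1 -> (1 - y) ^+ n * (1 + n%:R * y) <= 1.
Proof.
move=> /andP[y0 y1].
have y'0 : 0 <= 1 - y by rewrite subr_ge0.
have h : 1 + n%:R * y <= (1 + y) ^+ n.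
  elim: n => [|n ih]; first by rewrite mul0r addr0 expr0.
  rewrite exprS -natr1.
  have := ler_wpM2l (_ : 0 <= 1 + y) ih; rewrite addr_ge0// => /(_ isT).
  apply: le_trans; have := mulr_ge0 (ler0n R n) (sqr_ge0 y); nra.
apply: (le_trans (ler_wpM2l (exprn_ge0 _ y'0) h)).
rewrite -exprMn exprn_ile1//; nra.
Qed.

(** These are the step polynomials of elementary proofs of the Stone-Weierstrass theorem. For c
    strictly between a and b and N of order c^(-n), N a^n becomes small while N b^n becomes
    large. *)
Lemma polynomial_step (a b e : R) : 0 <= a -> a < b -> b <= 1 -> 0 < e ->
  exists n N : nat, forall z, 0 <= z <= 1 ->
   [/\ 0 <= (1 - z ^+ n) ^+ N <= 1,
    z <= a -> 1 - e <= (1 - z ^+ n) ^+ N &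
    b <= z -> (1 - z ^+ n) ^+ N <= e].
Proof.
move=> a0 ab b1 e0.
pose c := (a + b) / 2.
have c0 : 0 < c by rewrite /c; lra.
have ac : a < c by rewrite /c; lra.
have cb : c < b by rewrite /c; lra.
have b0 : 0 < b by lra.
have [n [n1 n2]] : exists n, (a / c) ^+ n <= e / 2 /\ (c / b) ^+ n <= e.
  have cv q : 0 <= q -> q < 1 -> q ^+ n @[n --> \oo] --> (0 : R).
    by move=> q0 q1; apply: cvg_expr; rewrite ger0_norm.
  have ac1 : a / c < 1 by rewrite ltr_pdivrMr ?mul1r.
  have cb1 : c / b < 1 by rewrite ltr_pdivrMr ?mul1r.
  have ac0 : 0 <= a / c by rewrite divr_ge0// ltW.
  have cb0 : 0 <= c / b by rewrite divr_ge0// ltW.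
  have e20 : 0 < e / 2 by rewrite divr_gt0.
  have /cvgr0Pnorm_le /(_ _ e20) [n1 _ H1] := cv _ ac0 ac1.
  have /cvgr0Pnorm_le /(_ _ e0) [n2 _ H2] := cv _ cb0 cb1.
  exists (maxn n1 n2).
  have := H1 (maxn n1 n2) (leq_maxl _ _); have := H2 (maxn n1 n2) (leq_maxr _ _).
  by rewrite /= !ger0_norm// exprn_ge0.
have cn0 : 0 < c ^+ n by rewrite exprn_gt0.
pose N := (Num.truncn (c ^+ n)^-1).+1.
have N1 : (c ^+ n)^-1 <= N%:R by rewrite ltW// truncnS_gt.
have N2 : N%:R <= 2 * (c ^+ n)^-1.
  have h1 : 1 <= (c ^+ n)^-1.
    by rewrite invf_ge1// exprn_ile1 ?ltW//; lra.
  have h2 : (Num.truncn (c ^+ n)^-1)%:R <= (c ^+ n)^-1.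
    by rewrite truncn_le (le_trans ler01).
  have h3 : N%:R = (Num.truncn (c ^+ n)^-1)%:R + 1 :> R by rewrite -natr1.
  by move: h1 h2 h3; move: (c ^+ n)^-1 => B; lra.
exists n, N => z /andP[z0 z1].
have zn : 0 <= z ^+ n <= 1 by rewrite exprn_ge0// exprn_ile1.
have [zn0 zn1] := andP zn.
split.
- by rewrite exprn_ge0 ?subr_ge0// exprn_ile1 ?subr_ge0// lerBlDr lerDl.
- move=> za; apply: le_trans (bernoulli_ineq N zn).
  rewrite lerD2l lerN2.
  have h : z ^+ n <= a ^+ n by rewrite lerXn2r ?nnegrE.
  apply: (le_trans (ler_wpM2l (ler0n _ _) h)).
  have an0 : 0 <= a ^+ n by rewrite exprn_ge0.
  apply: (le_trans (ler_wpM2r an0 N2)).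
  by move: n1; rewrite expr_div_n -mulrA (mulrC _ (a ^+ n)); lra.
- move=> bz; have bn0 : 0 < b ^+ n by rewrite exprn_gt0.
  have h : b ^+ n <= z ^+ n by rewrite lerXn2r ?nnegrE// ltW.
  have H := expr_1B_le N zn.
  have p0 : 0 <= (1 - z ^+ n) ^+ N by rewrite exprn_ge0// subr_ge0.
  have K : e^-1 <= N%:R * z ^+ n.
    apply: le_trans (ler_wpM2l (ler0n _ _) h).
    apply: le_trans (ler_wpM2r (ltW bn0) N1).
    move: n2; rewrite expr_div_n ler_pdivrMr// => n2.
    by rewrite mulrC ler_pdivlMr// mulrC ler_pdivrMr// mulrC.
  have K' := ler_wpM2l p0 K.
  have : (1 - z ^+ n) ^+ N * e^-1 <= 1.
    by apply: (le_trans K'); move: H; rewrite mulrDr mulr1; lra.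
  by rewrite ler_pdivrMr// mul1r.
Qed.

End trigonometric_approximation.

Section trigonometric_step.
Context (R : realType).

Lemma prod_ge_1B_sum (I : Type) (s : seq I) (y : I -> R) :
  (forall i, 0 <= y i <= 1) -> 1 - \sum_(i <- s) (1 - y i) <= \prod_(i <- s) y i.
Proof.
move=> y01; elim: s => [|i s ih]; first by rewrite !big_nil subr0.
rewrite !big_cons; have /andP[y0 y1] := y01 i.
have p1 : \prod_(j <- s) y j <= 1.
  apply: prodr_ile1 => j _; exact: y01.
have := ler_wpM2l y0 ih.
have S0 : 0 <= \sum_(j <- s) (1 - y j).
  by apply: sumr_ge0 => j _; rewrite subr_ge0; have /andP[] := y01 j.
nra.
Qed.

(** On [-L, L] a rescaled sine is increasing, so a step polynomial in it separates values below [s]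
    from values above [t]; the product over the coordinates then tests whether all of them are
    small. Outside the cube nothing is claimed except 0 <= f <= 1. *)
Lemma trigpoly_step k (s t L e : R) : - L <= s -> s < t -> t <= L -> 0 < e ->
  exists f : ('I_k -> R) -> R, [/\ trigpoly f, forall x, 0 <= f x <= 1,
    forall x, (forall i, - L <= x i <= s) -> 1 - e <= f x &
    forall x, (exists2 i, t <= x i & x i <= L) -> f x <= e].
Proof.
move=> Ls st tL e0.
have L0 : 0 < L by lra.
pose c := pi / 2 / L.
have c0 : 0 < c by rewrite !divr_gt0// pi_gt0.
have cL x : - L <= x <= L -> c * x \in `[- (pi / 2), pi / 2].
  move=> /andP[x1 x2]; have -> : c * x = pi / 2 * (x / L) by rewrite /c; ring.
  have y1 : x / L <= 1 by rewrite ler_pdivrMr// mul1r.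
  have y2 : - 1 <= x / L by rewrite ler_pdivlMr// mulN1r.
  by rewrite in_itv /=; have := pi_gt0 R; nra.
pose z x := (1 + sin (c * x)) / 2.
have z01 x : 0 <= z x <= 1.
  by have := sin_geN1 (c * x); have := sin_le1 (c * x); rewrite /z; lra.
have zle x y : - L <= x <= L -> - L <= y <= L -> (z x <= z y) = (x <= y).
  move=> xL yL; rewrite /z ler_pM2r// lerD2l.
  by rewrite !leNgt ltr_sin ?cL// ltr_pM2l.
(* The errors of the k factors add up, so each is allowed e / (k + 1); the shift by 1 covers k =
   0. *)
have [n [N H]] : exists n N : nat, forall w, 0 <= w <= 1 ->
   [/\ 0 <= (1 - w ^+ n) ^+ N <= 1,
    w <= z s -> 1 - e / k.+1%:R <= (1 - w ^+ n) ^+ N &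
    z t <= w -> (1 - w ^+ n) ^+ N <= e / k.+1%:R].
  apply: polynomial_step; [|  | |by rewrite divr_gt0].
  - by have /andP[] := z01 s.
  - by rewrite ltNge zle ?ltNge//; lra.
  - by have /andP[] := z01 t.
pose p x := (1 - z x ^+ n) ^+ N.
have p01 x : 0 <= p x <= 1 by have [] := H _ (z01 x).
exists (fun x => \prod_(i < k) p (x i)); split.
- apply: (@trigpoly_prod _ _ _ _ (fun (i : 'I_k) x => p (x i))) => i.
  rewrite /p; apply: trigpolyX; apply: trigpolyB; first exact: trigpoly_cst.
  apply: trigpolyX; rewrite /z; under eq_fun do rewrite mulrC.
  apply: trigpolyZ; apply: trigpolyD; first exact: trigpoly_cst.
  exact: trigpoly_sin_coord.
- move=> x; apply/andP; split.
    by apply: prodr_ge0 => i _; have /andP[] := p01 (x i).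
  by apply: prodr_ile1 => i _; exact: p01.
- move=> x xs; apply: le_trans (prod_ge_1B_sum _ (fun i => p01 (x i))).
  rewrite lerD2l lerN2.
  have h (i : 'I_k) : 1 - p (x i) <= e / k.+1%:R.
    have /andP[x1 x2] := xs i.
    have xL : - L <= x i <= L by rewrite x1 (le_trans x2)// (le_trans (ltW st)).
    have sL : - L <= s <= L by rewrite Ls (le_trans (ltW st)).
    have [_ + _] := H _ (z01 (x i)); rewrite zle//.
    by move=> /(_ x2); rewrite -/(p _) !lerBlDr addrC.
  apply: (le_trans (ler_sum _ (fun i _ => h i))).
  rewrite sumr_const card_ord -(mulr_natl (e / _)) mulrA ler_pdivrMr// mulrC.
  by rewrite ler_wpM2l ?ler_nat// ltW.
- move=> x [i tx xL]; rewrite (bigD1 i)//=.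
  have tL' : - L <= t <= L by rewrite tL (le_trans Ls)// ltW.
  have xL' : - L <= x i <= L by rewrite xL andbT (le_trans _ tx)//; have /andP[] := tL'.
  have [_ _ +] := H _ (z01 (x i)); rewrite zle//.
  move=> /(_ tx); rewrite -/(p _) => pe.
  apply: (@le_trans _ _ (p (x i))).
    have /andP[p0 p1] := p01 (x i).
    by rewrite ler_piMr//; apply: prodr_ile1 => j _; exact: p01.
  apply: (le_trans pe); rewrite ler_pdivrMr//.
  by apply: ler_peMr; [exact: ltW|rewrite ler1n].
Qed.

End trigonometric_step.

Section tail_bounds.
Context d (S : measurableType d) (R : realType) (P : probability S R) (k : nat).
Variables (Z : S -> 'I_k -> R) (V L e s t : R) (f : ('I_k -> R) -> R).
Hypotheses (mZ : forall i, measurable_fun setT (Z ^~ i))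
  (iZ : forall i, P.-integrable setT (EFin \o (fun w => Z w i ^+ 2)))
  (ZV : forall i, \int[P]_w (Z w i ^+ 2) <= V)
  (L0 : 0 < L) (e0 : 0 < e) (st : s < t) (tf : trigpoly f) (f01 : forall x, 0 <= f x <= 1)
  (fs : forall x, (forall i, - L <= x i <= s) -> 1 - e <= f x)
  (ft : forall x, (exists2 i, t <= x i & x i <= L) -> f x <= e).

(** A Chebyshev majorant: it is at least 1 as soon as some coordinate leaves [-L, L], where the test
    function is not controlled. *)
Definition sqsum w := \sum_(i < k) Z w i ^+ 2 / L ^+ 2.

Lemma sqsum_integral : P.-integrable setT (EFin \o sqsum) /\
  \int[P]_w sqsum w <= k%:R * V / L ^+ 2.
Proof.
have H (I : Type) (q : seq I) (F : I -> S -> R) (c : R) :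
   (forall i, P.-integrable setT (EFin \o F i)) ->
   (forall i, \int[P]_w F i w <= c) ->
   P.-integrable setT (EFin \o (fun w => \sum_(i <- q) F i w)) /\
   \int[P]_w (\sum_(i <- q) F i w) <= (size q)%:R * c.
  move=> iF Fc; elim: q => [|i q [ih1 ih2]].
    rewrite (_ : (fun w => _) = fun=> 0); last first.
      by apply/funext => w; rewrite big_nil.
    by rewrite Rintegral_prob_cst mul0r; split => //; exact: integrable_EFin_cst.
  rewrite (_ : (fun w => _) = fun w => F i w + \sum_(j <- q) F j w); last first.
    by apply/funext => w; rewrite big_cons.
  split; first exact: integrable_EFinD.
  by rewrite RintegralD//= -natr1 mulrDl mul1r addrC lerD.
have iZL (i : 'I_k) : P.-integrable setT (EFin \o (fun w => Z w i ^+ 2 / L ^+ 2)).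
  by under eq_fun do rewrite mulrC; exact: integrable_EFinZl.
have := H _ (index_enum 'I_k) (fun i w => Z w i ^+ 2 / L ^+ 2) (V / L ^+ 2) iZL.
have Hc (i : 'I_k) : \int[P]_w (Z w i ^+ 2 / L ^+ 2) <= V / L ^+ 2.
  under eq_Rintegral do rewrite mulrC.
  by rewrite RintegralZl// mulrC ler_wpM2r// invr_ge0 sqr_ge0.
move=> /(_ Hc); rewrite -mulrA.
suff -> : size (index_enum 'I_k) = k by [].
by rewrite -sum1_size big_const_ord iter_addn_0 mul1n.
Qed.

Lemma sqsum_ge0 w : 0 <= sqsum w.
Proof. by apply: sumr_ge0 => i _; rewrite divr_ge0 ?sqr_ge0. Qed.

Lemma sqsum_ge1 w i : L < `|Z w i| -> 1 <= sqsum w.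
Proof.
move=> LZ; rewrite /sqsum (bigD1 i)//=.
have h : 1 <= Z w i ^+ 2 / L ^+ 2.
  rewrite ler_pdivlMr ?exprn_gt0// mul1r -(real_normK (num_real (Z w i))).
  by rewrite lerXn2r ?nnegrE// ltW.
by rewrite (le_trans h)// lerDl sumr_ge0// => j _; rewrite divr_ge0 ?sqr_ge0.
Qed.

Let measurable_exists (Q : R -> Prop) : measurable [set x | Q x] ->
  measurable [set w | exists i, Q (Z w i)].
Proof.
move=> mQ; rewrite (_ : [set w | _] = \bigcup_(i in [set: 'I_k]) ((Z ^~ i) @^-1` [set x | Q x])).
  apply: fin_bigcup_measurable => // i _.
  by rewrite -[X in measurable X]setTI; exact: mZ.
by apply/seteqP; split => [w [i Qi]|w [i _ Qi]]; exists i.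
Qed.

Lemma measurable_exists_gt : measurable [set w | exists i, s < Z w i].
Proof.
apply: (@measurable_exists (fun x => s < x)); rewrite (_ : [set x | _] = `]s, +oo[%classic)//.
by apply/seteqP; split => x /=; rewrite in_itv /= andbT.
Qed.

Lemma measurable_exists_ge : measurable [set w | exists i, t <= Z w i].
Proof.
apply: (@measurable_exists (fun x => t <= x)); rewrite (_ : [set x | _] = `[t, +oo[%classic)//.
by apply/seteqP; split => x /=; rewrite in_itv /= andbT.
Qed.

Lemma fineP_indic (A : set S) : measurable A -> fine (P A) = \int[P]_w \1_A w.
Proof. by move=> mA; rewrite /Rintegral integral_indic// setIT. Qed.

Lemma indic_integrable (A : set S) : measurable A ->
  P.-integrable setT (EFin \o (\1_A : S -> R)).
Proof.
move=> mA; apply: (@bounded_integrable _ _ _ _ _ 1) => // x.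
by rewrite indicE; case: (_ \in _); rewrite ?normr1 ?normr0.
Qed.

(** Together with the next lemma this encloses exceedance probabilities by the mean of 1 - f: inside
    the cube the error is [e], and outside it [sqsum] pays for the whole difference. *)
Lemma compl_trigpoly_le_prob_gt : 1 - \int[P]_w f (Z w) <=
  fine (P [set w | exists i, s < Z w i]) + (e + k%:R * V / L ^+ 2).
Proof.
have mA := measurable_exists_gt; set A := [set w | _] in mA *.
have [irem remV] := sqsum_integral.
have if_ := trigpoly_integrable P tf mZ.
have iA := indic_integrable mA.
have ie := integrable_EFin_cst P e.
rewrite fineP_indic// -[X in X - _](Rintegral_prob_cst P 1) -RintegralB//; last exact: integrable_EFin_cst.
apply: (@le_trans _ _ (\int[P]_w (\1_A w + (e + sqsum w)))).
  apply: le_Rintegral => //.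
  - by apply: integrable_EFinB => //; exact: integrable_EFin_cst.
  - by apply: integrable_EFinD => //; exact: integrable_EFinD.
  move=> w _; have /andP[f0 f1] := f01 (Z w).
  have r0 := sqsum_ge0 w.
  move: e0 => e0'; rewrite indicE /=; have [wA|wA] := boolP (w \in A); first by rewrite mulr1n; lra.
  rewrite mulr0n add0r; have [/existsP[i /sqsum_ge1]|] := boolP [exists i, L < `|Z w i|].
    by move=> ?; lra.
  rewrite negb_exists => /forallP h.
  suff : 1 - e <= f (Z w) by lra.
  apply: fs => i; have := h i; rewrite -leNgt ler_norml => /andP[-> _] /=.
  rewrite leNgt; apply/negP => sZ; move/negP : wA; apply.
  by rewrite inE; exists i.
rewrite RintegralD//; last exact: integrable_EFinD.
rewrite lerD2l RintegralD// Rintegral_prob_cst lerD2l//.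
Qed.

Lemma prob_ge_le_compl_trigpoly : fine (P [set w | exists i, t <= Z w i]) <=
  1 - \int[P]_w f (Z w) + (e + k%:R * V / L ^+ 2).
Proof.
have mA := measurable_exists_ge; set A := [set w | _] in mA *.
have [irem remV] := sqsum_integral.
have if_ := trigpoly_integrable P tf mZ.
have iA := indic_integrable mA.
have ie := integrable_EFin_cst P e.
have i1f := integrable_EFinB (integrable_EFin_cst P 1) if_.
rewrite fineP_indic// -[X in X - _](Rintegral_prob_cst P 1) -RintegralB//; last exact: integrable_EFin_cst.
apply: (@le_trans _ _ (\int[P]_w ((1 - f (Z w)) + (e + sqsum w)))).
  apply: le_Rintegral => //.
  - by apply: integrable_EFinD => //; exact: integrable_EFinD.
  move=> w _; have /andP[f0 f1] := f01 (Z w).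
  have r0 := sqsum_ge0 w.
  move: e0 => e0'; rewrite indicE /=; have [wA|wA] := boolP (w \in A); last by rewrite mulr0n; lra.
  rewrite mulr1n.
  have [/existsP[i /sqsum_ge1]|] := boolP [exists i, L < `|Z w i|].
    by move=> ?; lra.
  rewrite negb_exists => /forallP h.
  suff : f (Z w) <= e by lra.
  apply: ft; move: wA; rewrite inE => -[i tZ]; exists i => //.
  by have := h i; rewrite -leNgt ler_norml => /andP[].
rewrite (RintegralD measurableT i1f (integrable_EFinD ie irem)).
rewrite lerD2l RintegralD// Rintegral_prob_cst lerD2l//.
Qed.

End tail_bounds.

Section portmanteau.
Context d (S : measurableType d) (R : realType) (P : probability S R) (k : nat).
Context d' (Omega : measurableType d') (mu : probability Omega R).
Variables (Y : S -> 'I_k -> R) (X : forall n, n.-tuple Omega -> 'I_k -> R) (V : R).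
Hypotheses (mY : forall i, measurable_fun setT (Y ^~ i))
  (mX : forall n i, measurable_fun setT (fun w => X (n := n) w i))
  (iY : forall i, P.-integrable setT (EFin \o (fun w => Y w i ^+ 2)))
  (YV : forall i, \int[P]_w (Y w i ^+ 2) <= V)
  (iX : forall n i, (prob_pow mu n).-integrable setT
     (EFin \o (fun w => X (n := n) w i ^+ 2)))
  (XV : forall n i, (0 < n)%N -> \int[prob_pow mu n]_w (X w i ^+ 2) <= V)
  (cvg_cos : forall th u,
     \int[prob_pow mu n]_w cos (th + \sum_(i < k) u i * X w i) @[n --> \oo] -->
     \int[P]_w cos (th + \sum_(i < k) u i * Y w i)).

Lemma cvg_trigpoly f : trigpoly f ->
  \int[prob_pow mu n]_w f (X w) @[n --> \oo] --> \int[P]_w f (Y w).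
Proof.
elim=> [c th u|f1 f2 tf1 ih1 tf2 ih2].
  have E (n : nat) : \int[prob_pow mu n]_w (c * cos (th + \sum_(i < k) u i * X w i)) =
     c * \int[prob_pow mu n]_w cos (th + \sum_(i < k) u i * X w i).
    rewrite RintegralZl//.
    have := @trigpoly_integrable R k _ _ _ (prob_pow mu n) (@X n) (trigpoly_cos 1 th u) (@mX n).
    by under eq_fun do rewrite mul1r.
  rewrite (_ : (fun n => _) = fun n => c * \int[prob_pow mu n]_w cos (th + \sum_(i < k) u i * X w i)); last first.
    by apply/funext => n; rewrite E.
  rewrite RintegralZl//; first by apply: cvgM; [exact: cvg_cst|exact: cvg_cos].
  have := @trigpoly_integrable R k _ _ _ P Y (trigpoly_cos 1 th u) mY.
  by under eq_fun do rewrite mul1r.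
rewrite (_ : (fun n => _) = fun n => \int[prob_pow mu n]_w f1 (X w) +
   \int[prob_pow mu n]_w f2 (X w)); last first.
  apply/funext => n; rewrite RintegralD//.
    exact: (trigpoly_integrable (prob_pow mu n) tf1 (@mX n)).
  exact: (trigpoly_integrable (prob_pow mu n) tf2 (@mX n)).
rewrite RintegralD//; first exact: cvgD.
  exact: (trigpoly_integrable P tf1 mY).
exact: (trigpoly_integrable P tf2 mY).
Qed.

(** One half of the portmanteau theorem, with trigonometric polynomials as test functions. Bounded
    second moments replace tightness, and the gap between [s] and [t] leaves room for the step. *)
Lemma portmanteau_exists_gt (s t eta : R) : s < t -> 0 < eta ->
  \forall n \near \oo, fine (P [set w | exists i, t <= Y w i]) - eta <=
    fine (prob_pow mu n [set w | exists i, s < X w i]).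
Proof.
move=> st eta0.
have e0 : 0 < eta / 8 by rewrite divr_gt0.
(* [L] puts both levels in the cube and makes the Chebyshev remainder at most eta / 8. The two
   enclosures then cost 4 (eta / 8) and the convergence eta / 4, less than [eta] in all. *)
pose L := `|s| + `|t| + 1 + 8 * (k%:R * `|V|) / eta.
have kV0 : 0 <= k%:R * `|V| by rewrite mulr_ge0.
have L1 : `|s| + `|t| + 1 <= L by rewrite lerDl divr_ge0// ?mulr_ge0// ltW.
have L2 : 8 * (k%:R * `|V|) / eta <= L by rewrite lerDr !addr_ge0.
have L0 : 0 < L.
  by apply: lt_le_trans L1; rewrite ltr_wpDl// addr_ge0.
have L3 : 1 <= L by apply: le_trans L1; rewrite lerDr addr_ge0.
have Ls : - L <= s.
  by rewrite lerNl (le_trans _ L1)//; have := ler_norm (- s); rewrite normrN; have := normr_ge0 t; lra.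
have tL : t <= L.
  by rewrite (le_trans _ L1)//; have := ler_norm t; have := normr_ge0 s; lra.
have remL : k%:R * V / L ^+ 2 <= eta / 8.
  rewrite ler_pdivrMr ?exprn_gt0//.
  apply: (@le_trans _ _ (k%:R * `|V|)); first by rewrite ler_wpM2l// ler_norm.
  move: L2; rewrite ler_pdivrMr// => L2.
  have : L <= L ^+ 2 by rewrite expr2 ler_peMl// ltW.
  move=> /(ler_wpM2l (ltW e0)).
  lra.
have [f [tf f01 fs ft]] := trigpoly_step k Ls st tL e0.
have cf := cvg_trigpoly tf.
have e40 : 0 < eta / 4 by rewrite divr_gt0.
have HY := prob_ge_le_compl_trigpoly mY iY YV L0 e0 tf f01 ft.
near=> n.
have n0 : (0 < n)%N by near: n; exact: nbhs_infty_gt.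
have := compl_trigpoly_le_prob_gt (@mX n) (@iX n)
  (fun i => @XV n i n0) L0 e0 tf f01 fs.
have : `|\int[P]_w f (Y w) - \int[prob_pow mu n]_w f (X w)| <= eta / 4.
  by near: n; move/cvgrPdist_le : cf; exact.
rewrite ler_norml => /andP[h1 h2].
move: HY h1 h2 remL.
set A := fine _; set B := fine _; set I1 := \int[P]_w _; set I2 := Rintegral _ _ _.
lra.
Unshelve. all: end_near. Qed.

End portmanteau.

(** * Maxima of Gaussian vectors *)

Section gaussian_vectors.
Context d (S : measurableType d) (R : realType) (P : probability S R) (k : nat).
Variable Y : S -> 'I_k -> R.
Let lin (u : 'I_k -> R) w := \sum_(i < k) u i * Y w i.
Hypotheses (mY : forall i, measurable_fun setT (Y ^~ i))
  (iY : forall u, P.-integrable setT (EFin \o (fun w => lin u w ^+ 2)))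
  (cosY : forall th u, \int[P]_w cos (th + lin u w) =
     expR (- (\int[P]_w (lin u w ^+ 2) / 2)) * cos th).

Let mlin u : measurable_fun setT (lin u).
Proof.
rewrite (_ : lin u = fun w => \sum_(i <- index_enum 'I_k) u i * Y w i)//.
by apply: measurable_sum => i; apply: measurable_funM.
Qed.

Let U (z : S * S) (i : 'I_k) := (Y z.1 i - Y z.2 i) / Num.sqrt 2.
Let W (z : S * S) (i : 'I_k) := (Y z.1 i + Y z.2 i) / Num.sqrt 2.

Let mY1 i : measurable_fun setT (fun z : S * S => Y z.1 i).
Proof. exact: (measurableT_comp (mY i)). Qed.

Let mY2 i : measurable_fun setT (fun z : S * S => Y z.2 i).
Proof. exact: (measurableT_comp (mY i)). Qed.

Let mU i : measurable_fun setT (U ^~ i).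
Proof. by apply: measurable_funM => //; exact: measurable_funB. Qed.

Let mW i : measurable_fun setT (W ^~ i).
Proof. by apply: measurable_funM => //; exact: measurable_funD. Qed.

Let lin2_cos th a b : \int[(P \x P)%E]_z cos (th + lin a z.1 + lin b z.2) =
  expR (- (\int[P]_w (lin a w ^+ 2) / 2)) *
  expR (- (\int[P]_w (lin b w ^+ 2) / 2)) * cos th.
Proof.
rewrite (@Rintegral_prod _ _ _ _ _ _ _ _ 1); last 2 first.
- apply: measurable_cos; apply: measurable_funD.
    by apply: measurable_funD => //; exact: (measurableT_comp (mlin a)).
  exact: (measurableT_comp (mlin b)).
- by move=> z; exact: cos_max.
under eq_Rintegral do rewrite /= cosY.
rewrite RintegralZl//; first by rewrite cosY mulrCA mulrA.
by apply: integrable_cos; exact: measurable_funD.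
Qed.

Let lin_parallelogram u v :
  \int[P]_w (lin (fun i => (u i + v i) / Num.sqrt 2) w ^+ 2) +
  \int[P]_w (lin (fun i => (v i - u i) / Num.sqrt 2) w ^+ 2) =
  \int[P]_w (lin u w ^+ 2) + \int[P]_w (lin v w ^+ 2).
Proof.
rewrite -(RintegralD measurableT (iY _) (iY _)) -(RintegralD measurableT (iY _) (iY _)).
apply: eq_Rintegral => w _.
have -> : lin (fun i => (u i + v i) / Num.sqrt 2) w = (lin u w + lin v w) / Num.sqrt 2.
  rewrite /lin -big_split/= mulr_suml; apply: eq_bigr => i _; ring.
have -> : lin (fun i => (v i - u i) / Num.sqrt 2) w = (lin v w - lin u w) / Num.sqrt 2.
  rewrite /lin -sumrB/= mulr_suml; apply: eq_bigr => i _; ring.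
by rewrite !exprMn exprVn sqr_sqrtr//; field.
Qed.

(** Product-to-sum formulas reduce the claim to single cosines of linear forms in two independent
    copies. The parallelogram identity shows that the rotation preserves the total variance. *)
Let cos_UW th u th' v :
  \int[(P \x P)%E]_z (cos (th + \sum_(i < k) u i * U z i) *
                      cos (th' + \sum_(i < k) v i * W z i)) =
  \int[P]_w cos (th + lin u w) * \int[P]_w cos (th' + lin v w).
Proof.
pose a i := (u i + v i) / Num.sqrt 2.
pose b i := (v i - u i) / Num.sqrt 2.
pose a' i := (u i - v i) / Num.sqrt 2.
pose b' i := (- v i - u i) / Num.sqrt 2.
have E z : cos (th + \sum_(i < k) u i * U z i) * cos (th' + \sum_(i < k) v i * W z i) =
  1 / 2 * cos ((th + th') + lin a z.1 + lin b z.2) +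
  1 / 2 * cos ((th - th') + lin a' z.1 + lin b' z.2).
  have -> : (th + th') + lin a z.1 + lin b z.2 =
     (th + \sum_(i < k) u i * U z i) + (th' + \sum_(i < k) v i * W z i).
    have H : lin a z.1 + lin b z.2 = \sum_(i < k) u i * U z i + \sum_(i < k) v i * W z i.
      rewrite /lin -!big_split/=.
      by apply: eq_bigr => i _; rewrite /a /b /U /W; ring.
    by rewrite -addrA H; ring.
  have -> : (th - th') + lin a' z.1 + lin b' z.2 =
     (th + \sum_(i < k) u i * U z i) - (th' + \sum_(i < k) v i * W z i).
    have H : lin a' z.1 + lin b' z.2 = \sum_(i < k) u i * U z i - \sum_(i < k) v i * W z i.
      rewrite /lin -sumrB -!big_split/=.
      by apply: eq_bigr => i _; rewrite /a' /b' /U /W; ring.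
    by rewrite -addrA H; ring.
  by move: (th + _) (th' + _) => A B; rewrite cosD cosB; field.
under eq_Rintegral do rewrite E.
have ilc c a0 b0 : (P \x P)%E.-integrable setT
    (EFin \o (fun z => cos (c + lin a0 z.1 + lin b0 z.2))).
  apply: (@integrable_cos _ _ _ (P \x P)%E); apply: measurable_funD.
    by apply: measurable_funD => //; exact: (measurableT_comp (mlin a0)).
  exact: (measurableT_comp (mlin b0)).
rewrite (@RintegralD _ _ _ (P \x P)%E _ _ _ measurableT); last 2 first.
- exact: (@integrable_EFinZl _ _ _ (P \x P)%E).
- exact: (@integrable_EFinZl _ _ _ (P \x P)%E).
rewrite !(@RintegralZl _ _ _ (P \x P)%E)// !lin2_cos !cosY -!expRD.
have E1 : - (\int[P]_w (lin a w ^+ 2) / 2) + - (\int[P]_w (lin b w ^+ 2) / 2) =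
   - ((\int[P]_w (lin u w ^+ 2) + \int[P]_w (lin v w ^+ 2)) / 2).
  by rewrite -lin_parallelogram; field.
have E2 : - (\int[P]_w (lin a' w ^+ 2) / 2) + - (\int[P]_w (lin b' w ^+ 2) / 2) =
   - ((\int[P]_w (lin u w ^+ 2) + \int[P]_w (lin v w ^+ 2)) / 2).
  have := lin_parallelogram u (fun i => - v i).
  rewrite -/a' -/b' (_ : \int[P]_w (lin (fun i => - v i) w ^+ 2) = \int[P]_w (lin v w ^+ 2)).
    by move=> <-; field.
  apply: eq_Rintegral => w _; rewrite (_ : lin _ w = - lin v w) ?sqrrN//.
  by rewrite /lin -sumrN; apply: eq_bigr => i _; rewrite mulNr.
rewrite E1 E2.
have -> : - ((\int[P]_w (lin u w ^+ 2) + \int[P]_w (lin v w ^+ 2)) / 2) =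
   - (\int[P]_w (lin u w ^+ 2) / 2) + - (\int[P]_w (lin v w ^+ 2) / 2) by field.
rewrite expRD; move: (expR _) (expR _) => A B.
by rewrite cosD cosB; field.
Qed.

(** Rotation invariance of a pair of independent copies of [Y], in the only form that is used:
    against products of test functions, [U] and [W] behave as independent copies of [Y]. *)
Lemma trigpoly_UW f g : trigpoly f -> trigpoly g ->
  \int[(P \x P)%E]_z (f (U z) * g (W z)) = \int[P]_w f (Y w) * \int[P]_w g (Y w).
Proof.
have iM f' g' : trigpoly f' -> trigpoly g' ->
    (P \x P)%E.-integrable setT (EFin \o (fun z => f' (U z) * g' (W z))).
  move=> tf' tg'; have [Mf Hf] := trigpoly_bounded tf'; have [Mg Hg] := trigpoly_bounded tg'.
  apply: (@bounded_integrable _ _ _ (P \x P)%E _ (Mf * Mg)).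
    apply: measurable_funM; first exact: measurable_trigpoly tf' mU.
    exact: measurable_trigpoly tg' mW.
  by move=> z; rewrite normrM ler_pM.
have iT f' : trigpoly f' -> P.-integrable setT (EFin \o (fun w => f' (Y w))).
  by move=> tf'; exact: trigpoly_integrable.
have icos th u : P.-integrable setT (EFin \o (fun w => cos (th + lin u w))).
  by apply: integrable_cos; exact: measurable_funD.
move=> tf; elim: tf g => [c th u|f1 f2 tf1 ih1 tf2 ih2] g tg; last first.
  under eq_Rintegral do rewrite mulrDl.
  rewrite (@RintegralD _ _ _ (P \x P)%E _ _ _ measurableT) ?ih1 ?ih2; last 4 first.
  - exact: tg.
  - exact: tg.
  - exact: iM.
  - exact: iM.
  by rewrite (RintegralD measurableT (iT _ tf1) (iT _ tf2)) mulrDl.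
elim: tg => [c' th' v|g1 g2 tg1 ih1 tg2 ih2]; last first.
  under eq_Rintegral do rewrite mulrDr.
  rewrite (@RintegralD _ _ _ (P \x P)%E _ _ _ measurableT) ?ih1 ?ih2; last 2 first.
  - exact: (iM (fun x => c * cos (th + \sum_(i < k) u i * x i)) _ (trigpoly_cos _ _ _) tg1).
  - exact: (iM (fun x => c * cos (th + \sum_(i < k) u i * x i)) _ (trigpoly_cos _ _ _) tg2).
  by rewrite (RintegralD measurableT (iT _ tg1) (iT _ tg2)) mulrDr.
have iUW : (P \x P)%E.-integrable setT (EFin \o (fun z =>
    cos (th + \sum_(i < k) u i * U z i) * cos (th' + \sum_(i < k) v i * W z i))).
  have := iM _ _ (trigpoly_cos 1 th u) (trigpoly_cos 1 th' v).
  by under eq_fun do rewrite !mul1r.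
under eq_Rintegral do rewrite mulrACA.
rewrite (@RintegralZl _ _ _ (P \x P)%E _ _ _ measurableT iUW).
rewrite (RintegralZl _ measurableT (icos th u)) (RintegralZl _ measurableT (icos th' v)).
by rewrite cos_UW mulrACA.
Qed.

End gaussian_vectors.

Section fernique.
Context d (S : measurableType d) (R : realType) (P : probability S R) (k : nat).
Variables (Y : S -> 'I_k -> R) (V : R).
Let lin (u : 'I_k -> R) w := \sum_(i < k) u i * Y w i.
Hypotheses (mY : forall i, measurable_fun setT (Y ^~ i))
  (iY : forall u, P.-integrable setT (EFin \o (fun w => lin u w ^+ 2)))
  (cosY : forall th u, \int[P]_w cos (th + lin u w) =
     expR (- (\int[P]_w (lin u w ^+ 2) / 2)) * cos th)
  (iY2 : forall i, P.-integrable setT (EFin \o (fun w => Y w i ^+ 2)))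
  (YV : forall i, \int[P]_w (Y w i ^+ 2) <= V)
  (Yneg : forall i, exists j, forall w, Y w j = - Y w i).

Let U (z : S * S) (i : 'I_k) := (Y z.1 i - Y z.2 i) / Num.sqrt 2.
Let W (z : S * S) (i : 'I_k) := (Y z.1 i + Y z.2 i) / Num.sqrt 2.

(* Fernique's rotation argument: [(Y' - Y) / sqrt 2] and [(Y' + Y) / sqrt 2] are
   independent with the law of [Y], and both exceed (t - s) / sqrt 2 somewhere
   when all the |Y_i| are at most [s] and some Y'_i is at least [t]. *)
Lemma fernique_ineq (s t r : R) : r * Num.sqrt 2 < t - s ->
  fine (P [set w | exists i, t <= Y w i]) *
    (1 - fine (P [set w | exists i, s < Y w i])) <=
  fine (P [set w | exists i, r < Y w i]) ^+ 2.
Proof.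
move=> rts.
have r2 : 0 < Num.sqrt 2 :> R by rewrite sqrtr_gt0.
pose p := (t - s) / Num.sqrt 2.
have rp : r < p by rewrite /p ltr_pdivlMr.
have mAt := @measurable_exists_ge _ _ R k Y t mY.
have mBs := @measurable_exists_gt _ _ R k Y s mY.
have mBr := @measurable_exists_gt _ _ R k Y r mY.
set At := [set w | _] in mAt *; set Bs := [set w | exists i, s < _] in mBs *.
set Br := [set w | _] in mBr *.
have br01 : 0 <= fine (P Br) <= 1.
  rewrite fine_ge0//= -lee_fin fineK ?fin_num_measure//.
  exact: probability_le1.
suff H eta : 0 < eta -> eta <= 1 -> fine (P At) * (1 - fine (P Bs)) <=
    (fine (P Br) + 2 * eta) ^+ 2 + 4 * eta.
  apply/ler_addgt0Pr => x x0.
  (* For b, eta <= 1, (b + 2 eta)^2 + 4 eta <= b^2 + 12 eta. *)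
  pose eta := Num.min 1 (x / 12).
  have eta0 : 0 < eta by rewrite lt_min ltr01 divr_gt0.
  have eta1 : eta <= 1 by rewrite ge_min lexx.
  have etax : eta <= x / 12 by rewrite ge_min lexx orbT.
  apply: (le_trans (H _ eta0 eta1)).
  have := br01; move: (fine _) => b /andP[b0 b1]; nra.
move=> eta0 eta1.
pose L := `|r| + `|p| + 1 + k%:R * `|V| / eta.
have kV0 : 0 <= k%:R * `|V| by rewrite mulr_ge0.
have L1 : `|r| + `|p| + 1 <= L by rewrite lerDl divr_ge0// ltW.
have L2 : k%:R * `|V| / eta <= L by rewrite lerDr !addr_ge0.
have L0 : 0 < L.
  by apply: lt_le_trans L1; rewrite ltr_wpDl// addr_ge0.
have L3 : 1 <= L by apply: le_trans L1; rewrite lerDr addr_ge0.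
have Lr : - L <= r.
  by rewrite lerNl (le_trans _ L1)//; have := ler_norm (- r); rewrite normrN; have := normr_ge0 p; lra.
have pL : p <= L.
  by rewrite (le_trans _ L1)//; have := ler_norm p; have := normr_ge0 r; lra.
have remL : k%:R * V / L ^+ 2 <= eta.
  rewrite ler_pdivrMr ?exprn_gt0//.
  apply: (@le_trans _ _ (k%:R * `|V|)); first by rewrite ler_wpM2l// ler_norm.
  move: L2; rewrite ler_pdivrMr// => L2.
  have : L <= L ^+ 2 by rewrite expr2 ler_peMl// ltW.
  by move=> /(ler_wpM2l (ltW eta0)); lra.
have [f [tf f01 fr fp]] := trigpoly_step k Lr rp pL eta0.
pose g x := 1 - f x.
have tg : trigpoly g by apply: trigpolyB => //; exact: trigpoly_cst.
have g01 x : 0 <= g x <= 1 by have := f01 x; rewrite /g; lra.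
have gint : \int[P]_w g (Y w) <= fine (P Br) + 2 * eta.
  have := compl_trigpoly_le_prob_gt mY iY2 YV L0 eta0 tf f01 fr.
  rewrite /g RintegralB//; last 2 first.
  - exact: integrable_EFin_cst.
  - exact: trigpoly_integrable.
  rewrite Rintegral_prob_cst -/Br; move: (fine _) (\int[P]_w _) => A B; lra.
have gint0 : 0 <= \int[P]_w g (Y w).
  by apply: Rintegral_ge0 => w _; have /andP[] := g01 (Y w).
have [irem remV] := sqsum_integral L iY2 YV.
pose rem := sqsum Y L; rewrite -/rem in irem remV.
(* On the event, if [Y z i] is at least [t], then W_i and U_j are at least [p], where Y_j = - Y_i.
   Inside the cube both factors [g] are then at least 1 - eta. Outside it, U_i^2 + W_i^2 = Y_i^2 +
   Y'_i^2 makes the sum of the remainders at least 1. *)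
have pt y z : \1_(~` Bs) y * \1_At z <= g (U (y, z)) * g (W (y, z)) +
    (2 * eta + rem y + rem z).
  have ry := sqsum_ge0 Y L y; have rz := sqsum_ge0 Y L z; rewrite -/rem in ry rz.
  have /andP[u0 u1] := g01 (U (y, z)); have /andP[w0 w1] := g01 (W (y, z)).
  have gg0 := mulr_ge0 u0 w0.
  rewrite !indicE.
  have [yB|yB] := boolP (y \in ~` Bs); last by rewrite mulr0n mul0r; lra.
  have [zA|zA] := boolP (z \in At); last by rewrite mulr0n mulr0; lra.
  rewrite !mulr1n mulr1.
  have sq i : U (y, z) i ^+ 2 + W (y, z) i ^+ 2 = Y y i ^+ 2 + Y z i ^+ 2.
    by rewrite /U /W /= !exprMn exprVn sqr_sqrtr//; field.
  have big i x : x ^+ 2 <= Y y i ^+ 2 + Y z i ^+ 2 -> L < x -> 1 <= rem y + rem z.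
    move=> xx Lx.
    have : L ^+ 2 <= x ^+ 2 by rewrite lerXn2r ?nnegrE ?ltW// (lt_trans L0).
    move=> /le_trans/(_ xx) h.
    rewrite /rem /sqsum (bigD1 i)//= [X in _ + X](bigD1 i)//=.
    have q (v : S) : 0 <= \sum_(j < k | j != i) Y v j ^+ 2 / L ^+ 2.
      by apply: sumr_ge0 => j _; rewrite divr_ge0 ?sqr_ge0.
    have : 1 <= Y y i ^+ 2 / L ^+ 2 + Y z i ^+ 2 / L ^+ 2.
      by rewrite -mulrDl ler_pdivlMr ?exprn_gt0// mul1r.
    by have := q y; have := q z; lra.
  have Ys i : `|Y y i| <= s.
    rewrite ler_norml; apply/andP; split.
      have [j Yj] := Yneg i; rewrite lerNl -Yj leNgt; apply/negP => sY.
      by move: yB; rewrite inE => /(_ (ex_intro _ j sY)).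
    rewrite leNgt; apply/negP => sY.
    by move: yB; rewrite inE => /(_ (ex_intro _ i sY)).
  move: zA; rewrite inE => -[i tz].
  have [j Yj] := Yneg i.
  have pW : p <= W (y, z) i.
    rewrite /p /W /= ler_pM2r ?invr_gt0//.
    by have := Ys i; rewrite ler_norml => /andP[]; lra.
  have pU : p <= U (y, z) j.
    rewrite /p /U /= ler_pM2r ?invr_gt0// !Yj.
    by have := Ys i; rewrite ler_norml => /andP[]; lra.
  have [UL|UL] := leP (U (y, z) j) L; last first.
    have : 1 <= rem y + rem z by apply: (big j _ _ UL); rewrite -sq lerDl sqr_ge0.
    by lra.
  have [WL|WL] := leP (W (y, z) i) L; last first.
    have : 1 <= rem y + rem z by apply: (big i _ _ WL); rewrite -sq lerDr sqr_ge0.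
    by lra.
  have fU : f (U (y, z)) <= eta by apply: fp; exists j.
  have fW : f (W (y, z)) <= eta by apply: fp; exists i.
  have : (1 - eta) * (1 - eta) <= g (U (y, z)) * g (W (y, z)).
    by rewrite ler_pM ?subr_ge0// /g lerD2l lerN2.
  nra.
have mgg : measurable_fun setT (fun z : S * S => g (U z) * g (W z)).
  apply: measurable_funM; apply: measurable_trigpoly => // i; apply: measurable_funM => //.
    by apply: measurable_funB; exact: (measurableT_comp (mY i)).
  by apply: measurable_funD; exact: (measurableT_comp (mY i)).
have bgg z : `|g (U z) * g (W z)| <= 1.
  have /andP[u0 u1] := g01 (U z); have /andP[w0 w1] := g01 (W z).
  by rewrite ger0_norm ?mulr_ge0// mulr_ile1.
have := trigpoly_UW mY iY cosY tg tg.
rewrite -/U -/W (Rintegral_prod P P mgg bgg) => E.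
pose h y := \int[P]_z (g (U (y, z)) * g (W (y, z))).
have mh : measurable_fun setT h := measurable_Rintegral_section P mgg bgg.
have ih : P.-integrable setT (EFin \o h).
  apply: (@bounded_integrable _ _ _ _ _ 1) => // y.
  apply: Rintegral_le_bound => // z.
  exact: (@measurable_fun_pair2 _ _ _ _ _ _ _ y mgg).
have iAt := indic_integrable P mAt.
have mBsC : measurable (~` Bs) by exact: measurableC.
have iBs := indic_integrable P mBsC.
have hy y : \1_(~` Bs) y * fine (P At) <= h y + ((2 * eta + eta) + rem y).
  rewrite (fineP_indic P mAt) -RintegralZl//.
  have ig : P.-integrable setT (EFin \o (fun z => g (U (y, z)) * g (W (y, z)))).
    apply: (@bounded_integrable _ _ _ _ _ 1) => //.
    exact: (@measurable_fun_pair2 _ _ _ _ _ _ _ y mgg).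
  have ir : P.-integrable setT (EFin \o (fun z => 2 * eta + rem y + rem z)).
    by apply: integrable_EFinD => //; exact: integrable_EFin_cst.
  apply: (@le_trans _ _ (\int[P]_z (g (U (y, z)) * g (W (y, z)) + (2 * eta + rem y + rem z)))).
    apply: le_Rintegral => //.
    - exact: integrable_EFinZl.
    - exact: integrable_EFinD.
  rewrite (RintegralD measurableT ig ir) (RintegralD measurableT (integrable_EFin_cst P _) irem).
  rewrite Rintegral_prob_cst -/(h y) lerD2l.
  by move: remV; set q := \int[P]_w _; lra.
have ibound := integrable_EFinD ih (integrable_EFinD (integrable_EFin_cst P (2 * eta + eta)) irem).
have -> : fine (P At) * (1 - fine (P Bs)) = \int[P]_y (\1_(~` Bs) y * fine (P At)).
  rewrite RintegralZr// -fineP_indic// mulrC; congr (_ * _).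
  rewrite probability_setC// fineB ?fin_num_measure//.
apply: (@le_trans _ _ (\int[P]_y (h y + ((2 * eta + eta) + rem y)))).
  apply: le_Rintegral => //.
  by under eq_fun do rewrite mulrC; exact: integrable_EFinZl.
rewrite (RintegralD measurableT ih (integrable_EFinD (integrable_EFin_cst P _) irem)).
rewrite (RintegralD measurableT (integrable_EFin_cst P _) irem) Rintegral_prob_cst.
rewrite [\int[P]_w h w]E -expr2.
have : (\int[P]_w g (Y w)) ^+ 2 <= (fine (P Br) + 2 * eta) ^+ 2.
  by rewrite lerXn2r ?nnegrE// (le_trans gint0).
by move: remV; set q := \int[P]_w rem w; lra.
Qed.

End fernique.

Section gaussian_maximum.
Context d (S : measurableType d) (R : realType) (P : probability S R) (k : nat).
Variables (Y : S -> 'I_k -> R) (V : R).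
Let lin (u : 'I_k -> R) w := \sum_(i < k) u i * Y w i.
Hypotheses (mY : forall i, measurable_fun setT (Y ^~ i))
  (iY : forall u, P.-integrable setT (EFin \o (fun w => lin u w ^+ 2)))
  (cosY : forall th u, \int[P]_w cos (th + lin u w) =
     expR (- (\int[P]_w (lin u w ^+ 2) / 2)) * cos th)
  (iY2 : forall i, P.-integrable setT (EFin \o (fun w => Y w i ^+ 2)))
  (YV : forall i, \int[P]_w (Y w i ^+ 2) <= V)
  (Yneg : forall i, exists j, forall w, Y w j = - Y w i).

Let A t := fine (P [set w | exists i, t <= Y w i]).

(** Fernique's inequality at level 2r, divided by 1 - 1/10, reads A(2r) <= (10/9) A(r)^2: doubling
    the level squares (10/9) A, which starts below 1/9. Only a geometric rate is kept, enough
    against levels that grow like 2^j. *)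
Lemma gaussian_tail_decay s : 0 < s ->
  fine (P [set w | exists i, s < Y w i]) <= 10^-1 ->
  forall j, A (2 ^+ j.+1 * s) <= 9^-1 ^+ j.+1.
Proof.
move=> s0; set b := fine _ => b10.
have A0 t : 0 <= A t by exact: fine_ge0.
have gtA t : fine (P [set w | exists i, t < Y w i]) <= A t.
  apply: fine_le; rewrite ?fin_num_measure//.
  - exact: measurable_exists_gt.
  - exact: measurable_exists_ge.
  apply: le_measure; rewrite ?inE.
  - exact: measurable_exists_gt.
  - exact: measurable_exists_ge.
  by move=> w [i /ltW ti]; exists i.
have step r : 2 * s <= r -> A (2 * r) <= 10 / 9 * A r ^+ 2.
  move=> sr; have r0 : 0 < r by lra.
  (* For s <= r / 2 it suffices that sqrt 2 < 3/2. *)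
  have hr : r * Num.sqrt 2 < 2 * r - s.
    apply: (@lt_le_trans _ _ (r * (3 / 2))); last by lra.
    rewrite ltr_pM2l// -(@ltr_pXn2r _ 2) ?nnegrE ?sqrtr_ge0//; first by rewrite sqr_sqrtr//; lra.
  have := fernique_ineq mY iY cosY iY2 YV Yneg hr.
  rewrite -/(A _) -/b.
  have h : fine (P [set w | exists i, r < Y w i]) ^+ 2 <= A r ^+ 2.
    by rewrite lerXn2r ?nnegrE ?fine_ge0.
  move=> /le_trans/(_ h); have := A0 (2 * r); nra.
have base : A (2 * s) <= 10^-1.
  apply: le_trans b10; rewrite /b.
  apply: fine_le; rewrite ?fin_num_measure//.
  - exact: measurable_exists_ge.
  - exact: measurable_exists_gt.
  apply: le_measure; rewrite ?inE.
  - exact: measurable_exists_ge.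
  - exact: measurable_exists_gt.
  by move=> w [i ti]; exists i; apply: lt_le_trans ti; lra.
suff H j : 10 / 9 * A (2 ^+ j.+1 * s) <= 9^-1 ^+ j.+1.
  by move=> j; have := H j; have := A0 (2 ^+ j.+1 * s); lra.
elim: j => [|j ih]; first by rewrite !expr1; lra.
have hj : 2 * s <= 2 ^+ j.+1 * s.
  by rewrite ler_pM2r// exprS ler_peMr// exprn_ege1// ler1n.
have := step _ hj; rewrite mulrA -exprS => h.
have q1 : 9^-1 ^+ j.+1 <= 9^-1 :> R by rewrite exprS ler_piMr// exprn_ile1//; lra.
have q0 : 0 <= 9^-1 ^+ j.+1 :> R by rewrite exprn_ge0.
rewrite (exprS 9^-1).
have := A0 (2 ^+ j.+1 * s); move: ih h q1 q0.
move: (A (2 ^+ j.+1 * s)) (A (2 ^+ j.+2 * s)) (9^-1 ^+ j.+1) => a a' q.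
rewrite expr2 => ih h q1 q0 a0.
have h1 : (10 / 9 * a) * (10 / 9 * a) <= q * q by apply: ler_pM => //; lra.
have h2 : q * q <= 9^-1 * q by rewrite ler_wpM2r.
lra.
Qed.

(** A finite layer-cake decomposition: the dyadic levels below [x] sum up telescopically to the next
    one. Values beyond the last level are left to a second moment bound. *)
Lemma dyadic_layer (s x : R) (J : nat) : 0 < s ->
  x <= 2 * s + \sum_(j < J) 2 ^+ j.+1 * s * (2 ^+ j.+1 * s <= x)%R%:R \/
  2 ^+ J.+1 * s <= x.
Proof.
move=> s0.
have E j : 2 * s + \sum_(i < j) 2 ^+ i.+1 * s = 2 ^+ j.+1 * s.
  elim: j => [|j ih]; first by rewrite big_ord0 addr0 expr1.
  by rewrite big_ord_recr/= addrA ih [in RHS]exprS; ring.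
elim: J => [|J ih].
  have [|/ltW] := leP (2 ^+ 1 * s) x; first by right.
  by rewrite expr1 => ?; left; rewrite big_ord0 addr0.
have [h|h] := leP (2 ^+ J.+2 * s) x; first by right.
left; rewrite big_ord_recr/=; case: ih => [ih|ih].
  by rewrite (le_trans ih)// addrA lerDl mulr_ge0// mulr_ge0 ?exprn_ge0// ltW.
rewrite ih mulr1 (eq_bigr (fun i : 'I_J => 2 ^+ i.+1 * s)); last first.
  move=> i _; rewrite (le_trans _ ih) ?mulr1// ler_pM2r// ler_weXn2l ?ler1n//.
  by rewrite !ltnS ltnW.
rewrite addrA E (le_trans (ltW h))// (exprS _ J.+1) -mulrA.
by move: (2 ^+ J.+1 * s) => y; lra.
Qed.

(** Integrating the layers gives 2 s + s (2/9 + (2/9)^2 + ...) = 2 s + (2/7) s, rounded up to 3 s.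
    Read backwards, a maximum of mean more than 3 s exceeds [s] with probability more than 1/10. *)
Lemma gaussian_max_expectation (M : S -> R) s : 0 < s ->
  fine (P [set w | exists i, s < Y w i]) <= 10^-1 ->
  P.-integrable setT (EFin \o M) -> (forall w, exists i, M w = Y w i) ->
  \int[P]_w M w <= 3 * s.
Proof.
move=> s0 Ps iM MY.
have decay := gaussian_tail_decay s0 Ps.
have [iQ QV] := sqsum_integral 1 iY2 YV.
pose Q := sqsum Y 1; rewrite -/Q in iQ QV.
have MQ w : M w ^+ 2 <= Q w.
  have [i ->] := MY w; rewrite /Q /sqsum expr1n (bigD1 i)//= divr1 lerDl.
  by apply: sumr_ge0 => j _; rewrite divr1 sqr_ge0.
pose At j := [set w | exists i, 2 ^+ j.+1 * s <= Y w i].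
have mA j : measurable (At j) by exact: measurable_exists_ge.
have bound J : \int[P]_w M w <= 2 * s + 2 / 7 * s + (k%:R * V) / s * 2^-1 ^+ J.+1.
  (* Beyond the last level M <= c M^2 <= c Q, and the integral of this term vanishes as [J]
     grows. *)
  pose c : R := (2 ^+ J.+1 * s)^-1.
  have c0 : 0 < c by rewrite invr_gt0 mulr_gt0// exprn_gt0.
  have pw w : M w <= (2 * s + c * Q w) + \sum_(j < J) 2 ^+ j.+1 * s * \1_(At j) w.
    have S0 : 0 <= \sum_(j < J) 2 ^+ j.+1 * s * \1_(At j) w.
      apply: sumr_ge0 => j _; rewrite mulr_ge0//.
      by rewrite mulr_ge0 ?exprn_ge0// ltW.
    have cQ : c * M w ^+ 2 <= c * Q w by rewrite ler_pM2l.
    have [h|h] := dyadic_layer (M w) J s0.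
      apply: (le_trans h); rewrite -addrA lerD2l -[leLHS]add0r lerD//.
        by apply: le_trans cQ; rewrite mulr_ge0 ?sqr_ge0// ltW.
      apply: ler_sum => j _; rewrite ler_wpM2l//.
        by rewrite mulr_ge0 ?exprn_ge0// ltW.
      rewrite indicE ler_nat; case: (boolP (_ <= M w)) => // hM.
      by rewrite mem_set//; have [i Mi] := MY w; exists i; rewrite -Mi.
    have : M w <= c * M w ^+ 2.
      have M0 : 0 < M w by apply: lt_le_trans h; rewrite mulr_gt0// exprn_gt0.
      have z0 : 0 < 2 ^+ J.+1 * s by rewrite mulr_gt0// exprn_gt0.
      have cM1 : 1 <= c * M w by rewrite /c ler_pdivlMl ?mulr1.
      by rewrite expr2 mulrA ler_peMl// ltW.
    by move: cQ S0; set Z := \sum_(j < J) _; lra.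
  have iS (q : nat) : P.-integrable setT (EFin \o (fun w =>
      \sum_(j < q) 2 ^+ j.+1 * s * \1_(At j) w)) /\
      \int[P]_w (\sum_(j < q) 2 ^+ j.+1 * s * \1_(At j) w) <=
      \sum_(j < q) s * (2 / 9) ^+ j.+1.
    elim: q => [|q [ih1 ih2]].
      rewrite (_ : (fun w => _) = fun=> 0); last first.
        by apply/funext => w; rewrite big_ord0.
      by rewrite Rintegral_prob_cst big_ord0; split => //; exact: integrable_EFin_cst.
    rewrite (_ : (fun w => _) = fun w => \sum_(j < q) 2 ^+ j.+1 * s * \1_(At j) w +
        2 ^+ q.+1 * s * \1_(At q) w); last first.
      by apply/funext => w; rewrite big_ord_recr.
    have iA := integrable_EFinZl (2 ^+ q.+1 * s) (indic_integrable P (mA q)).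
    split; first exact: integrable_EFinD.
    rewrite (RintegralD measurableT ih1 iA) big_ord_recr/= lerD//.
    rewrite (RintegralZl _ measurableT (indic_integrable P (mA q))) -fineP_indic//.
    have := decay q; rewrite -/(At q) => h.
    apply: (@le_trans _ _ (2 ^+ q.+1 * s * 9^-1 ^+ q.+1)).
      by rewrite ler_pM2l// mulr_gt0// exprn_gt0.
    by rewrite mulrAC -exprMn mulrC.
  have [iS1 iS2] := iS J.
  have geo : \sum_(j < J) s * (2 / 9) ^+ j.+1 <= 2 / 7 * s.
    have E q : \sum_(j < q) s * (2 / 9) ^+ j.+1 = 2 / 7 * s - 2 / 7 * s * (2 / 9) ^+ q.
      elim: q => [|q ih]; first by rewrite big_ord0 expr0 mulr1 subrr.
      by rewrite big_ord_recr/= ih exprS; field.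
    rewrite E lerBlDr lerDl mulr_ge0 ?exprn_ge0//; first by rewrite mulr_ge0// ?ltW.
  have iB := integrable_EFinD (integrable_EFin_cst P (2 * s)) (integrable_EFinZl c iQ).
  apply: (@le_trans _ _ (\int[P]_w ((2 * s + c * Q w) +
      \sum_(j < J) 2 ^+ j.+1 * s * \1_(At j) w))).
    by apply: le_Rintegral => //; exact: integrable_EFinD.
  rewrite (RintegralD measurableT iB iS1).
  rewrite (RintegralD measurableT (integrable_EFin_cst P _) (integrable_EFinZl c iQ)).
  rewrite Rintegral_prob_cst (RintegralZl _ measurableT iQ).
  have : c * \int[P]_w Q w <= c * (k%:R * V).
    by rewrite ler_pM2l//; move: QV; rewrite expr1n divr1.
  have -> : c * (k%:R * V) = k%:R * V / s * 2^-1 ^+ J.+1.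
    by rewrite /c invfM exprVn; ring.
  move: iS2 geo; set I1 := \int[P]_w _; set I2 := \int[P]_w _.
  set S1 := \sum_(j < J) _; lra.
have cv : (2 * s + 2 / 7 * s + (k%:R * V) / s * 2^-1 ^+ J.+1) @[J --> \oo] -->
    2 * s + 2 / 7 * s + (k%:R * V) / s * 0.
  apply: cvgD; first exact: cvg_cst.
  apply: cvgM; first exact: cvg_cst.
  rewrite (@cvg_shiftS R (fun J => 2^-1 ^+ J)).
  by apply: cvg_expr; rewrite ger0_norm//; lra.
rewrite mulr0 addr0 in cv.
have h : \int[P]_w M w <= 2 * s + 2 / 7 * s.
  rewrite -(cvg_lim (@Rhausdorff R) cv).
  apply: limr_ge; first by apply/cvg_ex; eexists; exact: cv.
  by near=> J; exact: bound.
lra.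
Unshelve. all: end_near. Qed.

End gaussian_maximum.

Lemma big_tuple_bool_cons (R : realType) n (F : n.+1.-tuple bool -> \bar R) :
  (\sum_e F e = \sum_(e : n.-tuple bool)
     (F [tuple of true :: e] + F [tuple of false :: e]))%E.
Proof.
rewrite (reindex (fun p : bool * n.-tuple bool => [tuple of p.1 :: p.2])) /=; last first.
  exists (fun t : n.+1.-tuple bool => (thead t, [tuple of behead t])) => [[b t] _|t _] /=.
    by congr (_, _); apply/val_inj.
  by rewrite -tuple_eta.
rewrite -(pair_bigA _ (fun (b : bool) (t : n.-tuple bool) => F [tuple of b :: t])) /=.
by rewrite big_bool big_split.
Qed.

(** * Symmetrization and contraction *)

Section contraction.
Context (R : realType) (I : Type) (V : set I).
Implicit Types (a : I -> R) (u l : nat -> I -> R).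

Definition sgb (b : bool) : R := if b then 1 else -1.

Let supV (a : I -> R) := ereal_sup [set (a t)%:E | t in V].

(** For points t and s of [V], bound u t - u s by |l t - l s| and assign + l to the point with the
    larger value of [l], - l to the other; either way the sum is below the right-hand side. No
    supremum has to be attained, and infinite ones are trivial. *)
Lemma two_point_contraction a (u l : I -> R) : V !=set0 ->
  (forall s t, `|u s - u t| <= `|l s - l t|) ->
  (supV (fun t => a t + u t)%R + supV (fun t => a t - u t)%R <=
   supV (fun t => a t + l t)%R + supV (fun t => a t - l t)%R)%E.
Proof.
move=> [t0 Vt0] ul.
have ub (b : I -> R) t : V t -> ((b t)%:E <= supV b)%E.
  by move=> Vt; apply: ereal_sup_ubound; exists t.
have gtNy (b : I -> R) : (-oo < supV b)%E.
  by apply: lt_le_trans (ub b t0 Vt0); rewrite ltNyr.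
set P := supV (fun t => a t + l t); set M := supV (fun t => a t - l t).
have [->|Py] := eqVneq P +oo%E.
  by rewrite addye ?leey// gt_eqF// gtNy.
have [->|My] := eqVneq M +oo%E.
  by rewrite addey ?leey// gt_eqF// gtNy.
have [p Pp] : exists p, P = p%:E.
  by exists (fine P); rewrite fineK// fin_numE Py gt_eqF// gtNy.
have [m Mm] : exists m, M = m%:E.
  by exists (fine M); rewrite fineK// fin_numE My gt_eqF// gtNy.
have lp t : V t -> a t + l t <= p.
  by move=> Vt; rewrite -lee_fin -Pp; exact: (ub (fun t => a t + l t)).
have lm t : V t -> a t - l t <= m.
  by move=> Vt; rewrite -lee_fin -Mm; exact: (ub (fun t => a t - l t)).
have key s t : V s -> V t -> (a t + u t) + (a s - u s) <= p + m.
  move=> Vs Vt; have := ul t s; have := lp s Vs; have := lp t Vt.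
  have := lm s Vs; have := lm t Vt; have := ler_norm (u t - u s).
  by have [?|?] := leP 0 (l t - l s); [rewrite (@ger0_norm _ (l t - l s))//|
     rewrite (@ltr0_norm _ (l t - l s))//]; lra.
have h t : V t -> (supV (fun s => a s - u s)%R <= (p + m - (a t + u t))%:E)%E.
  move=> Vt; apply: ge_ereal_sup => _ [s Vs <-]; rewrite lee_fin.
  by have := key s t Vs Vt; lra.
rewrite Pp Mm -EFinD.
have [q Qq] : exists q, supV (fun s => a s - u s)%R = q%:E.
  exists (fine (supV (fun s => a s - u s))); rewrite fineK// fin_numE gt_eqF ?gtNy//=.
  by rewrite lt_eqF// (le_lt_trans (h t0 Vt0)) ?ltry.
rewrite Qq -leeBrDr// -EFinB; apply: ge_ereal_sup => _ [t Vt <-].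
by rewrite lee_fin; have := h t Vt; rewrite Qq lee_fin; lra.
Qed.

(** The functions [u i] are replaced by [l i] one at a time: the other signed terms are absorbed in
    [a], and summing over the two values of the remaining sign is the two-point case. *)
Lemma contraction n a u l : V !=set0 ->
  (forall i s t, `|u i s - u i t| <= `|l i s - l i t|) ->
  (\sum_(e : n.-tuple bool) supV (fun t => a t + \sum_(i < n) sgb (tnth e i) * u i t)%R <=
   \sum_(e : n.-tuple bool) supV (fun t => a t + \sum_(i < n) sgb (tnth e i) * l i t)%R)%E.
Proof.
move=> V0; elim: n a u l => [|n ih] a u l ul.
  by apply: lee_sum => e _; under eq_fun do rewrite big_ord0;
     under [X in (_ <= supV X)%E]eq_fun do rewrite big_ord0.
rewrite !big_tuple_bool_cons.
have E b (e : n.-tuple bool) (w : nat -> I -> R) :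
    supV (fun t => a t + \sum_(i < n.+1) sgb (tnth [tuple of b :: e] i) * w i t)%R =
    supV (fun t => (a t + sgb b * w 0%N t) + \sum_(i < n) sgb (tnth e i) * w i.+1 t)%R.
  congr supV; apply/funext => t; rewrite big_ord_recl tnth0 addrA.
  by under eq_bigr do rewrite tnthS.
under eq_bigr do rewrite !E.
under [X in (_ <= X)%E]eq_bigr do rewrite !E.
rewrite big_split/=.
apply: (@le_trans _ _ (\sum_(e : n.-tuple bool)
    supV (fun t => (a t + 1 * u 0%N t) + \sum_(i < n) sgb (tnth e i) * l i.+1 t)%R +
    \sum_(e : n.-tuple bool)
    supV (fun t => (a t + -1 * u 0%N t) + \sum_(i < n) sgb (tnth e i) * l i.+1 t)%R)%E).
  by apply: leeD; apply: (ih _ (fun i => u i.+1) (fun i => l i.+1)).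
rewrite -big_split/=; apply: lee_sum => e _.
have := @two_point_contraction (fun t => a t + \sum_(i < n) sgb (tnth e i) * l i.+1 t)
  (u 0%N) (l 0%N) V0 (ul 0%N).
have F (w : I -> R) : (fun t => a t + \sum_(i < n) sgb (tnth e i) * l i.+1 t + w t) =
  (fun t => a t + 1 * w t + \sum_(i < n) sgb (tnth e i) * l i.+1 t).
  by apply/funext => t; rewrite mul1r addrAC.
have G (w : I -> R) : (fun t => a t + \sum_(i < n) sgb (tnth e i) * l i.+1 t - w t) =
  (fun t => a t + -1 * w t + \sum_(i < n) sgb (tnth e i) * l i.+1 t).
  by apply/funext => t; rewrite mulN1r addrAC.
by rewrite (F (u 0%N)) (F (l 0%N)) (G (u 0%N)) (G (l 0%N)).
Qed.

End contraction.

(** * Measurable majorants of signed sums *)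

Section grid_majorant.
Context d (Omega : measurableType d) (R : realType) (n : nat).
Variables (m : n.-tuple bool -> n.-tuple Omega -> \bar R) (kap K : R)
  (U : Omega -> R -> R).
Hypotheses (mm : forall e, measurable_fun setT (m e))
  (m0 : forall e x, (0 <= m e x)%E) (kap0 : 0 < kap) (K0 : 0 <= K)
  (U0 : forall x, U x 0 = 0) (UK : forall x a b, `|U x a - U x b| <= K * `|a - b|)
  (mU : forall a, measurable_fun setT (U ^~ a)).

(* A supremum over an uncountable class need not be measurable. The class enters
   only through the constraint that the sums of its values with signs are at most
   [m]; rounding these values to multiples of [kap] leaves a countable supremum. *)
Definition grid_set (x : n.-tuple Omega) : set (n.-tuple int) :=
  [set z | forall e : n.-tuple bool,
    ((\sum_(i < n) sgb R (tnth e i) * (kap * (tnth z i)%:~R))%:E <=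
       m e x + (n%:R * kap)%:E)%E].

Definition grid_sup (e : n.-tuple bool) (x : n.-tuple Omega) : \bar R :=
  ereal_sup [set (\sum_(i < n) sgb R (tnth e i) * U (tnth x i) (kap * (tnth z i)%:~R))%:E
    | z in grid_set x].

Let z0 : n.-tuple int := [tuple 0 | _ < n].

Let grid_set0 x : grid_set x z0.
Proof.
move=> e; rewrite big1; last by move=> i _; rewrite tnth_mktuple mulr0 mulr0.
by rewrite adde_ge0// lee_fin mulr_ge0// ltW.
Qed.

Let sum0 e (x : n.-tuple Omega) :
  \sum_(i < n) sgb R (tnth e i) * U (tnth x i) (kap * (tnth z0 i)%:~R) = 0.
Proof. by apply: big1 => i _; rewrite tnth_mktuple mulr0 U0 mulr0. Qed.

Lemma grid_sup_ge0 e x : (0 <= grid_sup e x)%E.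
Proof. by apply: ereal_sup_ubound; exists z0 => //; rewrite sum0. Qed.

(** Integer tuples are countable, so this is a supremum of a sequence of measurable functions. *)
Lemma measurable_grid_sup e : measurable_fun setT (grid_sup e).
Proof.
pose zz (j : nat) : n.-tuple int := odflt z0 (unpickle j).
have mgrid z : measurable [set x | grid_set x z].
  rewrite (_ : [set x | _] = \bigcap_(e' in [set: n.-tuple bool])
    [set x | ((\sum_(i < n) sgb R (tnth e' i) * (kap * (tnth z i)%:~R))%:E <=
       m e' x + (n%:R * kap)%:E)%E]).
    apply: fin_bigcap_measurable => // e' _.
    rewrite -[X in measurable X]setTI; apply: emeasurable_fun_c_infty => //.
    exact: emeasurable_funD.
  by apply/seteqP; split => [x h e' _|x h e']; exact: h.
(* Off the grid set the term is replaced by 0, and codes that decode to no tuple stand for [z0].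
   Both are harmless, since [z0] always belongs to the grid set and contributes 0. *)
pose F (j : nat) x := ((\1_[set x | grid_set x (zz j)] x : R) *
  \sum_(i < n) sgb R (tnth e i) * U (tnth x i) (kap * (tnth (zz j) i)%:~R))%:E.
have mF j : measurable_fun setT (F j).
  apply/measurable_EFinP; apply: measurable_funM; first exact: measurable_indic.
  rewrite (_ : (fun x => _) = fun x : n.-tuple Omega => \sum_(i <- index_enum 'I_n)
    sgb R (tnth e i) * U (tnth x i) (kap * (tnth (zz j) i)%:~R))//.
  apply: measurable_sum => i; apply: measurable_funM => //.
  by apply: (measurableT_comp (mU _)); exact: measurable_tnth.
rewrite (_ : grid_sup e = fun x => esups (F ^~ x) 0%N); first exact: measurable_fun_esups.
apply/funext => x; rewrite /esups /sdrop /grid_sup.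
apply/eqP; rewrite eq_le; apply/andP; split; apply: ge_ereal_sup.
  move=> _ [z xz <-]; apply: ereal_sup_ubound; exists (pickle z) => //.
  rewrite /F /zz pickleK /= indicE mem_set// mul1r//.
move=> _ [j _ <-]; rewrite /F indicE; have [h|h] := boolP (x \in _).
  by rewrite mul1r; apply: ereal_sup_ubound; exists (zz j) => //; rewrite inE in h.
by rewrite mul0r; exact: grid_sup_ge0.
Qed.

(** Rounding moves each value by at most [kap]: the slack n kap in [grid_set] admits the rounded
    vector, and the Lipschitz bound on [U] gives the error n K kap. *)
Lemma grid_sup_major x (v : 'I_n -> R) :
  (forall e : n.-tuple bool, ((\sum_(i < n) sgb R (tnth e i) * v i)%:E <= m e x)%E) ->
  forall e, ((\sum_(i < n) sgb R (tnth e i) * U (tnth x i) (v i))%:E <=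
    grid_sup e x + (n%:R * (K * kap))%:E)%E.
Proof.
move=> vm e.
pose z : n.-tuple int := [tuple Num.floor (v i / kap) | i < n].
have zv i : `|v i - kap * (tnth z i)%:~R| <= kap.
  rewrite tnth_mktuple; set q := Num.floor _.
  have q1 : q%:~R <= v i / kap by exact: floor_le_tmp.
  have q2 : v i / kap < (q + 1)%:~R by exact: floorD1_gt.
  move: q1 q2; rewrite ler_pdivlMr// ltr_pdivrMr// intrD mulrDl mul1r.
  by rewrite ler_norml mulrC => q1 q2; apply/andP; split; lra.
have sg1 b : `|sgb R b| = 1 by case: b; rewrite /sgb ?normrN normr1.
have gz : grid_set x z.
  move=> e'; apply: (@le_trans _ _ ((\sum_(i < n) sgb R (tnth e' i) * v i)%:E + (n%:R * kap)%:E)%E).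
    rewrite -EFinD lee_fin -lerBlDl -sumrB.
    rewrite (@le_trans _ _ (\sum_(i < n) kap))//; last first.
      by rewrite sumr_const card_ord mulr_natl.
    apply: ler_sum => i _; rewrite -mulrBr; apply: le_trans (ler_norm _) _.
    by rewrite normrM sg1 mul1r distrC.
  by apply: leeD.
apply: (@le_trans _ _ ((\sum_(i < n) sgb R (tnth e i) * U (tnth x i) (kap * (tnth z i)%:~R))%:E +
   (n%:R * (K * kap))%:E)%E); last first.
  by apply: leeD => //; apply: ereal_sup_ubound; exists z.
rewrite -EFinD lee_fin -lerBlDl -sumrB.
rewrite (@le_trans _ _ (\sum_(i < n) (K * kap)))//; last first.
  by rewrite sumr_const card_ord mulr_natl.
apply: ler_sum => i _; rewrite -mulrBr; apply: le_trans (ler_norm _) _.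
rewrite normrM sg1 mul1r (le_trans (UK _ _ _))// ler_wpM2l//.
Qed.

(** Contraction, with the grid set as index set, removes [U]; the remaining linear sums are bounded
    by the very definition of the grid set. *)
Lemma sum_grid_sup x :
  (\sum_(e : n.-tuple bool) grid_sup e x <=
   \sum_(e : n.-tuple bool) K%:E * (m e x + (n%:R * kap)%:E))%E.
Proof.
pose u (i : nat) (z : n.-tuple int) := U (nth point x i) (kap * (nth 0 z i)%:~R).
pose l (i : nat) (z : n.-tuple int) := K * (kap * (nth 0 z i)%:~R).
have ul i s t : `|u i s - u i t| <= `|l i s - l i t|.
  rewrite /u /l -mulrBr normrM (ger0_norm K0); exact: UK.
have := @contraction R _ (grid_set x) n (fun=> 0) u l (ex_intro _ z0 (grid_set0 x)) ul.
rewrite (eq_bigr (fun e => grid_sup e x)); last first.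
  move=> e _; congr ereal_sup; apply/seteqP.
  split=> [_ [z xz <-]|_ [z xz <-]]; exists z => //; congr EFin; rewrite add0r;
    by apply: eq_bigr => i _; rewrite /u (tnth_nth point x) (tnth_nth 0 z).
move/le_trans; apply; apply: lee_sum => e _.
apply: ge_ereal_sup => _ [z xz <-].
rewrite add0r (_ : \sum_(i < n) _ = K * \sum_(i < n) sgb R (tnth e i) * (kap * (tnth z i)%:~R)).
  by rewrite EFinM lee_wpmul2l ?lee_fin//; exact: xz.
by rewrite mulr_sumr; apply: eq_bigr => i _; rewrite /l (tnth_nth 0 z) mulrCA.
Qed.

End grid_majorant.

(** * Signs and half-lines of a standard normal variable *)

Section gaussian_signs.
Context (R : realType).
Local Notation N := (normal_prob (0 : R) 1).

Definition half_line (b : bool) (g : R) : R :=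
  if b then (0 <= g)%R%:R else (g < 0)%R%:R.

(** The mean of the positive part of a standard normal variable, that is 1 / sqrt (2 pi). Its
    positivity is all that the constants require. *)
Definition half_mean : R := \int[N]_g (half_line true g * g).

Let one_neq0 : (1 : R) != 0. Proof. exact: oner_neq0. Qed.

Lemma half_line_indic b :
  half_line b = \1_(if b then `[0, +oo[%classic else `]-oo, 0[%classic).
Proof.
apply/funext => g; case: b; rewrite /half_line indicE.
  by congr (nat_of_bool _)%:R; apply/idP/idP; rewrite inE /= in_itv/= andbT.
by congr (nat_of_bool _)%:R; apply/idP/idP; rewrite inE /= in_itv/=.
Qed.

Lemma measurable_half_line b : measurable_fun setT (half_line b).
Proof. by rewrite half_line_indic; apply: measurable_indic; case: b. Qed.

Lemma half_line_ge0 b g : 0 <= half_line b g.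
Proof. by case: b; rewrite /half_line ler0n. Qed.

Lemma half_line_sum g : half_line true g + half_line false g = 1.
Proof. by rewrite /half_line ltNge; case: (0 <= g); rewrite ?addr0 ?add0r. Qed.

Lemma half_line_norm_le1 b g : `|half_line b g| <= 1.
Proof. by rewrite ger0_norm ?half_line_ge0//; case: b; rewrite /half_line lern1 leq_b1. Qed.

Lemma integrable_half_line b : N.-integrable setT (EFin \o half_line b).
Proof.
apply: (@bounded_integrable _ _ _ _ _ 1); first exact: measurable_half_line.
exact: half_line_norm_le1.
Qed.

Lemma integrable_half_lineM b : N.-integrable setT (EFin \o (fun g => half_line b g * g)).
Proof.
have i1 := normal_integrable_id one_neq0.
apply: (le_integrable _ _ _ i1) => //.
  by apply/measurable_EFinP; apply: measurable_funM => //; exact: measurable_half_line.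
by move=> g _; rewrite /= lee_fin normrM ler_piMl// half_line_norm_le1.
Qed.

Let normal_set1 : N [set 0] = 0%E.
Proof.
have := @normal_prob_dominates R 0 1.
by move=> /null_content_dominatesP; apply => //; exact: lebesgue_measure_set1.
Qed.

Lemma Rintegral_half_line b : \int[N]_g half_line b g = 2^-1.
Proof.
have E : \int[N]_g half_line false g = \int[N]_g half_line true g.
  rewrite -(normal_RintegralN one_neq0 (integrable_half_line false)).
  rewrite /Rintegral; congr fine; apply: ae_eq_integral => //.
  - apply/measurable_EFinP; apply: (measurableT_comp (measurable_half_line false)).
    exact: oppr_measurable.
  - by apply/measurable_EFinP; exact: measurable_half_line.
  exists [set 0]; split => //.
  move=> g /=; apply: contra_notP => /eqP g0 _; congr EFin.
  by rewrite /half_line oppr_lt0 lt_def g0.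
have S : \int[N]_g half_line true g + \int[N]_g half_line false g = 1.
  rewrite -RintegralD//; [|exact: integrable_half_line..].
  by under eq_Rintegral do rewrite half_line_sum; rewrite Rintegral_prob_cst.
by move: S; rewrite E; case: b; rewrite ?E; lra.
Qed.

Lemma Rintegral_half_lineM b :
  \int[N]_g (half_line b g * g) = sgb R b * half_mean.
Proof.
case: b; rewrite /sgb ?mul1r// mulN1r.
have S : half_mean + \int[N]_g (half_line false g * g) = 0.
  rewrite /half_mean -RintegralD//; [|exact: integrable_half_lineM..].
  under eq_Rintegral do rewrite -mulrDl half_line_sum mul1r.
  exact: (normal_mean0 one_neq0).
by lra.
Qed.

(** A nonnegative function with zero integral vanishes almost everywhere; the positive half-line
    would then be null, although it has probability 1/2. *)
Lemma half_mean_gt0 : 0 < half_mean.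
Proof.
rewrite lt_neqAle; apply/andP; split; last first.
  apply: Rintegral_ge0 => g _; rewrite /half_line.
  by have [g0|g0] := leP 0 g; rewrite ?mul1r ?mul0r.
apply/eqP => h0.
have i1 := integrable_half_lineM true.
have := EFin_Rintegral i1; rewrite -/half_mean -h0 => /esym H.
have : ae_eq N setT (fun g => (half_line true g * g)%:E) (cst 0%E).
  apply/(ae_eq_integral_abs N measurableT); first exact: measurable_int i1.
  rewrite -[RHS]H; apply: eq_integral => g _; rewrite /= ger0_norm//.
  by rewrite /half_line; have [g0|g0] := leP 0 g; rewrite ?mul1r ?mul0r.
move=> [A [mA A0 hA]].
have B0 : N `]0, +oo[%classic = 0%E.
  apply/eqP; rewrite eq_le measure_ge0 andbT -A0.
  apply: le_measure; rewrite ?inE//.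
  move=> g /=; rewrite in_itv/= andbT => g0; apply: hA => /= /(_ I) [].
  by rewrite /half_line ltW//= mul1r => ge; move: g0; rewrite ge ltxx.
have := Rintegral_half_line true.
rewrite half_line_indic -fineP_indic//.
have -> : (`[0, +oo[ = [set 0] `|` `]0, +oo[ :> set R)%classic.
  apply/seteqP; split => g /=; rewrite !in_itv/= !andbT.
    by rewrite le_eqVlt => /predU1P[<-|]; [left|right].
  by move=> [->//|/ltW].
rewrite measureU//.
  rewrite [X in fine (X + _)%E](_ : _ = 0%E); last exact: normal_set1.
  rewrite [X in fine (_ + X)%E](_ : _ = 0%E); last exact: B0.
  have : (0 : R) < 2^-1 by rewrite invr_gt0.
  by rewrite adde0 => + h; rewrite -h ltxx.
by apply/seteqP; split => // g [-> /=]; rewrite in_itv/= ltxx.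
Qed.

End gaussian_signs.

Section symmetrization.
Context d (Omega : measurableType d) (R : realType) (mu : probability Omega R) (n : nat).
Local Notation N := (normal_prob (0 : R) 1).
Variables (phi : n.-tuple Omega * n.-tuple R -> \bar R)
  (Vc : set (Omega -> R)) (kap K : R) (U : Omega -> R -> R).
Hypotheses (mphi : measurable_fun setT phi) (phi0 : forall p, (0 <= phi p)%E)
  (Vphi : forall v, Vc v -> forall x g,
     ((\sum_(i < n) tnth g i * v (tnth x i))%:E <= phi (x, g))%E)
  (kap0 : 0 < kap) (K0 : 0 <= K)
  (U0 : forall x, U x 0 = 0) (UK : forall x a b, `|U x a - U x b| <= K * `|a - b|)
  (mU : forall a, measurable_fun setT (U ^~ a))
  (iU : forall v, Vc v -> mu.-integrable setT (EFin \o (fun x => U x (v x)))).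

Lemma sum_prod_half_line j (g : 'I_j -> R) :
  \sum_(e : j.-tuple bool) \prod_(i < j) half_line (tnth e i) (g i) = 1.
Proof.
elim: j g => [|j ih] g.
  rewrite (eq_bigr (fun=> 1)); last by move=> e _; rewrite big_ord0.
  by rewrite sumr_const card_tuple expn0.
apply: EFin_inj; rewrite -sumEFin big_tuple_bool_cons.
rewrite (eq_bigr (fun e : j.-tuple bool =>
   (\prod_(i < j) half_line (tnth e i) (g (lift ord0 i)))%:E)); last first.
  move=> e _; rewrite !big_ord_recl !tnth0 -EFinD.
  under eq_bigr do rewrite tnthS.
  under [X in (_ + _ * X)%:E]eq_bigr do rewrite tnthS.
  by rewrite -mulrDl half_line_sum mul1r.
by rewrite sumEFin ih.
Qed.

(* On an orthant the Gaussian factors average to signs times a constant: this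
   replaces a Gaussian majorant by majorants of the sums with fixed signs. *)
Lemma sign_section_lower_bound (h : n.-tuple R -> \bar R) (v : 'I_n -> R)
    (e : n.-tuple bool) :
  measurable_fun setT h -> (forall g, 0 <= h g)%E ->
  (forall g, ((\sum_(i < n) tnth g i * v i)%:E <= h g)%E) ->
  (((2^-1) ^+ n * (2 * half_mean R * \sum_(i < n) sgb R (tnth e i) * v i))%:E <=
   \int[prob_pow N n]_g ((\prod_(i < n) half_line (tnth e i) (tnth g i))%:E * h g))%E.
Proof.
move=> mh h0 vh.
pose v' (i : nat) := if insub i is Some j then v j else 0.
have v'E (i : 'I_n) : v' i = v i by rewrite /v' valK.
pose w (i : nat) := half_line (R := R) (nth true e i).
pose k (i : nat) (g : R) := g * v' i.
pose mm (i : nat) := 2 * half_mean R * sgb R (nth true e i) * v' i.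
have := @ge_weighted_integral_prob_pow _ (measurableTypeR R) R N n 2^-1 w k mm 0 h.
rewrite !add0r.
have -> : \sum_(i < n) mm i = 2 * half_mean R * \sum_(i < n) sgb R (tnth e i) * v i.
  rewrite mulr_sumr; apply: eq_bigr => i _.
  by rewrite /mm v'E (tnth_nth true) mulrA.
have E : (\int[prob_pow N n]_g ((\prod_(i < n) w i (tnth g i))%:E * h g) =
    \int[prob_pow N n]_g ((\prod_(i < n) half_line (tnth e i) (tnth g i))%:E * h g))%E.
  apply: eq_integral => g _; congr (_%:E * _)%E; apply: eq_bigr => i _.
  by rewrite /w -tnth_nth.
rewrite E; apply => //.
- by move=> i; exact: measurable_half_line.
- by move=> i g; exact: half_line_ge0.
- by move=> i; exact: integrable_half_line.
- move=> i; rewrite /k; under eq_fun do rewrite mulrA mulrC.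
  by apply: integrable_EFinZl; exact: integrable_half_lineM.
- move=> i; rewrite -(EFin_Rintegral (integrable_half_line R _)).
  by rewrite Rintegral_half_line.
- move=> i; rewrite /k.
  have iw := integrable_half_lineM R (nth true e i).
  have iw' := integrable_EFinZl (v' i) iw.
  under eq_integral do rewrite mulrA mulrC.
  rewrite -(EFin_Rintegral iw') RintegralZl// Rintegral_half_lineM /mm; congr EFin.
  by field.
- move=> g; rewrite add0r; apply: le_trans (vh g).
  by rewrite lee_fin; apply: ler_sum => i _; rewrite /k v'E.
Qed.

(** Normalization of an orthant average: an orthant has probability 2^(-n), and given its sign a
    coordinate has mean absolute value 2 [half_mean]. *)
Let c : R := 2 ^+ n / (2 * half_mean R).

Let c0 : 0 <= c.
Proof. by rewrite divr_ge0 ?exprn_ge0// mulr_ge0// ltW// half_mean_gt0. Qed.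

Let wt (e : n.-tuple bool) (g : n.-tuple R) : \bar R :=
  (\prod_(i < n) half_line (tnth e i) (tnth g i))%:E.

Let wt0 e g : (0 <= wt e g)%E.
Proof. by rewrite lee_fin prodr_ge0// => i _; exact: half_line_ge0. Qed.

Let mwt e : measurable_fun setT (wt e).
Proof.
apply/measurable_EFinP.
apply: (eq_measurable_fun (fun g : n.-tuple R =>
  \prod_(i <- index_enum 'I_n) half_line (tnth e i) (tnth g i))) => //.
apply: measurable_prod => i _.
by apply: (measurableT_comp (measurable_half_line _)); exact: measurable_tnth.
Qed.

Let psi e x := (\int[prob_pow N n]_g (wt e g * phi (x, g)))%E.

Let mwphi e : measurable_fun setT (fun p : n.-tuple Omega * n.-tuple R => (wt e p.2 * phi p)%E).
Proof. by apply: emeasurable_funM => //; exact: (measurableT_comp (mwt e)). Qed.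

Let psi0 e x : (0 <= psi e x)%E.
Proof. by apply: integral_ge0 => g _; rewrite mule_ge0. Qed.

Let mpsi e : measurable_fun setT (psi e).
Proof.
apply: (@measurable_fun_fubini_tonelli_F _ _ _ _ _ (prob_pow N n)
  (fun p => (wt e p.2 * phi p)%E) (mwphi e)).
by move=> p; rewrite mule_ge0.
Qed.

(** A measurable majorant of the sums with the fixed signs [e]. Since the orthants partition the
    space, summing over [e] gives back the full Gaussian average of [phi]. *)
Let m e x := (c%:E * psi e x)%E.

Let m0 e x : (0 <= m e x)%E. Proof. by rewrite mule_ge0. Qed.

Let mm e : measurable_fun setT (m e).
Proof. exact: emeasurable_funM. Qed.

Let sum_m :
  (\sum_(e : n.-tuple bool) \int[prob_pow mu n]_x m e x =
    c%:E * \int[prob_pow mu n \x prob_pow N n]_p phi p)%E.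
Proof.
rewrite (eq_bigr (fun e => (c%:E * \int[prob_pow mu n]_x psi e x)%E)); last first.
  by move=> e _; rewrite ge0_integralZl.
rewrite -ge0_sume_distrr; last by move=> e _; exact: integral_ge0.
congr (_ * _)%E; rewrite fubini_tonelli1// -ge0_integral_sum//.
apply: eq_integral => x _; rewrite /psi -ge0_integral_sum//; last 2 first.
- by move=> e; exact: (@measurable_fun_pair2 _ _ _ _ _ _ _ x (mwphi e)).
- by move=> e g _; rewrite mule_ge0.
apply: eq_integral => g _.
rewrite -ge0_sume_distrl; last by move=> e _; exact: wt0.
by rewrite /wt sumEFin sum_prod_half_line mul1e.
Qed.

Let mV v : Vc v -> forall x e,
  ((\sum_(i < n) sgb R (tnth e i) * v (tnth x i))%:E <= m e x)%E.
Proof.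
move=> Vv x e.
have := @sign_section_lower_bound (fun g => phi (x, g)) (fun i => v (tnth x i)) e
  (measurable_fun_pair2 x mphi) (fun g => phi0 _) (Vphi Vv x).
move=> /(lee_wpmul2l (_ : 0 <= c%:E)%E); rewrite lee_fin => /(_ c0).
apply: le_trans; rewrite -EFinM lee_fin le_eqVlt; apply/orP; left; apply/eqP.
rewrite exprVn /c; field.
by rewrite expf_neq0//= gt_eqF ?half_mean_gt0.
Qed.

Let G := grid_sup m kap U.

Let neg (e : n.-tuple bool) : n.-tuple bool := [tuple ~~ tnth e i | i < n].

Let kK : R := n%:R * (K * kap).

Let qn : R := 2^-1 ^+ n.

Let qn2 : qn * 2 ^+ n = 1.
Proof. by rewrite /qn -exprMn mulVf// expr1n. Qed.

Let qn0 : 0 <= qn. Proof. by rewrite exprn_ge0// invr_ge0. Qed.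

(** For each [e] the difference of the sums over the two samples is a sum with signs [e] over one
    mixture plus a sum with signs [neg e] over the complementary mixture. Each involves one sample
    of law mu^n, so that the majorants [G] apply; the result is averaged over [e], and 2 kK pays for
    two roundings. *)
Let D (p : n.-tuple Omega * n.-tuple Omega) : \bar R :=
  (qn%:E * \sum_(e : n.-tuple bool)
     (G e (mixt (neg e) p) + G (neg e) (mixt e p)) + (2 * kK)%:E)%E.

Let mG e : measurable_fun setT (G e).
Proof. by apply: measurable_grid_sup. Qed.

Let G0 e x : (0 <= G e x)%E.
Proof. by apply: grid_sup_ge0. Qed.

Let kK0 : 0 <= kK.
Proof. by rewrite mulr_ge0// mulr_ge0// ltW. Qed.

Let mD : measurable_fun setT D.
Proof.
apply: emeasurable_funD => //; apply: emeasurable_funM => //.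
apply: emeasurable_sum => e; apply: emeasurable_funD.
  by apply: (measurableT_comp (mG e)); exact: measurable_mixt.
by apply: (measurableT_comp (mG (neg e))); exact: measurable_mixt.
Qed.

Let D0 p : (0 <= D p)%E.
Proof.
apply: adde_ge0; last by rewrite lee_fin mulr_ge0.
apply: mule_ge0; first by rewrite lee_fin.
by apply: sume_ge0 => e _; rewrite adde_ge0.
Qed.

Let D_major v : Vc v -> forall x x',
  ((\sum_(i < n) U (tnth x' i) (v (tnth x' i)) - \sum_(i < n) U (tnth x i) (v (tnth x i)))%:E
   <= D (x, x'))%E.
Proof.
move=> Vv x x'; set L := \sum_(i < n) _ - _.
have H e : (L%:E <= (G e (mixt (neg e) (x, x')) + G (neg e) (mixt e (x, x'))) + (2 * kK)%:E)%E.
  have GM y e' := grid_sup_major (m := m) kap0 K0 UK (x := y) (v := fun i => v (tnth y i))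
    (mV Vv y) e'.
  have h1 := GM (mixt (neg e) (x, x')) e; have h2 := GM (mixt e (x, x')) (neg e).
  have := leeD h1 h2; rewrite addeACA -!EFinD.
  rewrite -/kK -/G (_ : kK + kK = 2 * kK); last by rewrite mulr2n mulrDl mul1r.
  apply: le_trans; rewrite lee_fin le_eqVlt; apply/orP; left; apply/eqP.
  rewrite /L -sumrB -big_split/=; apply: eq_bigr => i _.
  rewrite !tnth_mktuple /=.
  by case: (tnth e i); rewrite /sgb /=; ring.
rewrite /D.
have avg q : q%:E = (qn%:E * \sum_(e : n.-tuple bool) q%:E)%E.
  rewrite sumEFin sumr_const card_tuple card_bool -EFinM -(mulr_natl q) natrX.
  by rewrite (mulrA _ _ q) qn2 mul1r.
rewrite (avg L) (avg (2 * kK)).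
rewrite -ge0_muleDr; last 2 first.
- by apply: sume_ge0 => e _; rewrite adde_ge0.
- by apply: sume_ge0 => e _; rewrite lee_fin mulr_ge0.
rewrite lee_wpmul2l ?lee_fin// -big_split/=.
by apply: lee_sum => e _.
Qed.

(** [B] integrates [D] over the second sample. Averaging over 2^n signs two terms with factor K c
    gives K / half_mean; the additive error is 2 n K kap from [D] and as much from the slack of the
    grid sets. *)
Lemma symmetrization : exists B : n.-tuple Omega -> \bar R,
  [/\ measurable_fun setT B, forall x, (0 <= B x)%E,
    (\int[prob_pow mu n]_x B x <=
       (K / half_mean R)%:E * \int[prob_pow mu n \x prob_pow N n]_p phi p +
       (4 * (n%:R * (K * kap)))%:E)%E &
    forall v, Vc v -> forall x,
      ((n%:R * \int[mu]_y U y (v y) - \sum_(i < n) U (tnth x i) (v (tnth x i)))%:E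
        <= B x)%E].
Proof.
exists (fun x => \int[prob_pow mu n]_x' D (x, x'))%E; split.
- exact: (@measurable_fun_fubini_tonelli_F _ _ _ _ _ (prob_pow mu n) D mD D0).
- by move=> x; exact: integral_ge0.
- have -> : (\int[prob_pow mu n]_x \int[prob_pow mu n]_x' D (x, x') =
      \int[prob_pow mu n \x prob_pow mu n]_p D p)%E by rewrite fubini_tonelli1.
  rewrite /D.
  pose S p := (\sum_(e : n.-tuple bool)
     (G e (mixt (neg e) p) + G (neg e) (mixt e p)))%E.
  have mGm e e' : measurable_fun setT (fun p => G e (mixt e' p)).
    by apply: (measurableT_comp (mG e)); exact: measurable_mixt.
  have mS : measurable_fun setT S.
    by apply: emeasurable_sum => e; exact: emeasurable_funD.
  have S0 p : (0 <= S p)%E by apply: sume_ge0 => e _; rewrite adde_ge0.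
  rewrite ge0_integralD//; last 3 first.
  - by move=> p _; apply: mule_ge0; [rewrite lee_fin|exact: S0].
  - exact: emeasurable_funM.
  - by move=> p _; rewrite lee_fin mulr_ge0.
  rewrite (integral_prob_cst (prob_pow mu n \x prob_pow mu n)%E) ge0_integralZl//;
    last by move=> p _; exact: S0.
  have -> : (\int[prob_pow mu n \x prob_pow mu n]_p S p =
      2%:E * \sum_(e : n.-tuple bool) \int[prob_pow mu n]_x G e x)%E.
    rewrite ge0_integral_sum//; last 2 first.
    - by move=> e; exact: emeasurable_funD.
    - by move=> e p _; rewrite adde_ge0.
    rewrite (eq_bigr (fun e => \int[prob_pow mu n]_x G e x + \int[prob_pow mu n]_x G (neg e) x)%E); last first.
      move=> e _; rewrite ge0_integralD//.
      by rewrite !ge0_integral_mixt.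
    rewrite big_split/= [X in (_ + X)%E](_ : _ = \sum_(e : n.-tuple bool) \int[prob_pow mu n]_x G e x)%E.
      by rewrite (_ : 2 = 1 + 1 :> R)%R; [rewrite EFinD ge0_muleDl ?lee_fin// !mul1e|ring].
    rewrite [RHS](reindex_inj (h := neg))//.
    move=> e1 e2 /(congr1 (fun t => tnth t)) E; apply: eq_from_tnth => i.
    by have := congr1 (fun f => f i) E; rewrite !tnth_mktuple => /negb_inj.
  have SG : (\sum_(e : n.-tuple bool) \int[prob_pow mu n]_x G e x <=
     K%:E * (c%:E * \int[prob_pow mu n \x prob_pow N n]_p phi p) +
     (2 ^+ n * kK)%:E)%E.
    rewrite -ge0_integral_sum//.
    apply: (@le_trans _ _ (\int[prob_pow mu n]_x \sum_(e : n.-tuple bool)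
        K%:E * (m e x + (n%:R * kap)%:E))%E).
      apply: ge0_le_integral => //.
      - by move=> x _; apply: sume_ge0.
      - exact: emeasurable_sum.
      - apply: emeasurable_sum => e; apply: emeasurable_funM => //.
        exact: emeasurable_funD.
      by move=> x _; apply: sum_grid_sup.
    have nk0 : 0 <= n%:R * kap by rewrite mulr_ge0// ltW.
    rewrite ge0_integral_sum//; last 2 first.
    - by move=> e; apply: emeasurable_funM => //; exact: emeasurable_funD.
    - by move=> e x _; rewrite mule_ge0// adde_ge0.
    rewrite -sum_m ge0_sume_distrr; last by move=> e _; exact: integral_ge0.
    have -> : (2 ^+ n * kK)%:E = (\sum_(e : n.-tuple bool) kK%:E)%E.
      by rewrite sumEFin sumr_const card_tuple card_bool -(mulr_natl kK) natrX.
    rewrite -big_split/=; apply: lee_sum => e _.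
    rewrite ge0_integralZl//; last 2 first.
    - exact: emeasurable_funD.
    - by move=> x _; rewrite adde_ge0.
    rewrite ge0_integralD// integral_prob_cst ge0_muleDr//; last exact: integral_ge0.
    by rewrite leeD// -EFinM lee_fin /kK mulrCA.
  have q2 : 2 * qn * 2 ^+ n = 2 by rewrite -mulrA qn2 mulr1.
  apply: (@le_trans _ _ ((2 * qn)%:E * (K%:E * (c%:E * \int[prob_pow mu n \x prob_pow N n]_p phi p) +
     (2 ^+ n * kK)%:E) + (2 * kK)%:E)%E).
    apply: leeD => //; rewrite muleA -EFinM (mulrC _ 2) lee_wpmul2l// lee_fin mulr_ge0// .
  have I0 : (0 <= \int[prob_pow mu n \x prob_pow N n]_p phi p)%E by exact: integral_ge0.
  rewrite ge0_muleDr; last 2 first.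
  - by rewrite !mule_ge0.
  - by rewrite lee_fin mulr_ge0// exprn_ge0.
  rewrite -addeA -EFinM -EFinD !muleA -!EFinM leeD//.
    have -> : 2 * qn * K * c = K / half_mean R; last by [].
    rewrite /qn /c exprVn; field.
    by rewrite expf_neq0//= gt_eqF ?half_mean_gt0.
  rewrite lee_fin (mulrA _ _ kK) q2 -/kK le_eqVlt; apply/orP; left; apply/eqP; ring.
move=> v Vv x.
have iV := iU Vv.
(* With weights 1, the lower bound for product integrals replaces each sum over the second sample by
   n times the mean, without integrability of [D]. *)
have E : (\int[prob_pow mu n]_x' ((\prod_(i < n) 1)%:E * D (x, x')) =
   \int[prob_pow mu n]_x' D (x, x'))%E.
  by apply: eq_integral => x' _; rewrite big1// mul1e.
rewrite -E (_ : _ - _ = 1 ^+ n *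
  (- \sum_(i < n) U (tnth x i) (v (tnth x i)) + \sum_(i < n) \int[mu]_y U y (v y))); last first.
  by rewrite expr1n mul1r sumr_const card_ord -(mulr_natl (Rintegral _ _ _)) addrC.
apply: (@ge_weighted_integral_prob_pow _ Omega R mu n 1 (fun _ _ => 1)
  (fun _ y => U y (v y)) (fun _ => \int[mu]_y U y (v y))
  (- \sum_(i < n) U (tnth x i) (v (tnth x i))) (fun x' => D (x, x'))) => //.
- by move=> i; exact: integrable_EFin_cst.
- by move=> i; under eq_fun do rewrite mul1r.
- by move=> i; rewrite integral_prob_cst.
- move=> i; rewrite mul1r (EFin_Rintegral iV).
  by under eq_integral do rewrite mul1r.
- exact: (measurable_fun_pair2 x mD).
- by move=> x'; rewrite addrC; exact: D_major.
Qed.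

End symmetrization.

(** * Second moments and almost sure bounds *)

Section finite_sums.
Context d (S : measurableType d) (R : realType) (P : probability S R).

Lemma integrable_EFin_sum (I : Type) (s : seq I) (F : I -> S -> R) :
  (forall i, P.-integrable setT (EFin \o F i)) ->
  P.-integrable setT (EFin \o (fun w => \sum_(i <- s) F i w)).
Proof.
move=> iF; elim: s => [|i s ih].
  by under eq_fun do rewrite big_nil; exact: integrable_EFin_cst.
rewrite (_ : (fun w => _) = fun w => F i w + \sum_(j <- s) F j w); last first.
  by apply/funext => w; rewrite big_cons.
exact: integrable_EFinD.
Qed.

Lemma Rintegral_sum (I : Type) (s : seq I) (F : I -> S -> R) :
  (forall i, P.-integrable setT (EFin \o F i)) ->
  \int[P]_w (\sum_(i <- s) F i w) = \sum_(i <- s) \int[P]_w F i w.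
Proof.
move=> iF; elim: s => [|i s ih].
  rewrite big_nil; under eq_Rintegral do rewrite big_nil.
  exact: Rintegral_prob_cst.
rewrite big_cons -ih -RintegralD//; last exact: integrable_EFin_sum.
by apply: eq_Rintegral => w _; rewrite big_cons.
Qed.

Lemma ae_bounded_integrable (h : S -> R) (M : R) : measurable_fun setT h ->
  {ae P, forall x, `|h x| <= M} -> P.-integrable setT (EFin \o h).
Proof.
move=> mh hM; apply/integrableP; split; first exact/measurable_EFinP.
apply: (@le_lt_trans _ _ (\int[P]_x `|M|%:E)%E); last first.
  by rewrite integral_prob_cst ltry.
apply: ae_ge0_le_integral => //.
- by apply: measurableT_comp => //; exact/measurable_EFinP.
- by apply: filterS hM => x hx _; rewrite lee_fin (le_trans hx)// ler_norm.
Qed.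

Lemma ae_eq_Rintegral (f g : S -> R) : measurable_fun setT f -> measurable_fun setT g ->
  {ae P, forall x, f x = g x} -> \int[P]_x f x = \int[P]_x g x.
Proof.
move=> mf mg fg; rewrite /Rintegral; congr fine; apply: ae_eq_integral => //.
- exact/measurable_EFinP.
- exact/measurable_EFinP.
- by apply: filterS fg => x fgx _; rewrite fgx.
Qed.

Lemma Rintegral_square_sum k (Y : S -> 'I_k -> R) (u : 'I_k -> R) :
  (forall i, measurable_fun setT (Y ^~ i)) ->
  (forall i, P.-integrable setT (EFin \o (fun w => Y w i ^+ 2))) ->
  \int[P]_w ((\sum_(i < k) u i * Y w i) ^+ 2) =
  \sum_(i < k) \sum_(j < k) u i * u j * \int[P]_w (Y w i * Y w j).
Proof.
move=> mY iY.
have iYY i j : P.-integrable setT (EFin \o (fun w => Y w i * Y w j)).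
  have i2 := integrable_EFinD (iY i) (iY j).
  apply: (le_integrable _ _ _ i2) => //.
    by apply/measurable_EFinP; exact: measurable_funM.
  move=> w _; rewrite /= lee_fin [leRHS]ger0_norm ?addr_ge0 ?sqr_ge0//.
  by rewrite ler_norml; apply/andP; split; nra.
transitivity (\int[P]_w (\sum_(i < k) \sum_(j < k) u i * u j * (Y w i * Y w j))).
  apply: eq_Rintegral => w _; rewrite expr2 mulr_suml; apply: eq_bigr => i _.
  by rewrite mulr_sumr; apply: eq_bigr => j _; ring.
rewrite Rintegral_sum; last first.
  by move=> i; apply: integrable_EFin_sum => j; exact: integrable_EFinZl.
apply: eq_bigr => i _; rewrite Rintegral_sum; last by move=> j; exact: integrable_EFinZl.
by apply: eq_bigr => j _; rewrite RintegralZl.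
Qed.

End finite_sums.

Section product_power_facts.
Context d (T : measurableType d) (R : realType) (mu : probability T R).

(** The shift [c] carries the coordinates already fixed; the cross term vanishes because [q] has
    mean zero. *)
Lemma integral_square_prob_pow (q : T -> R) : measurable_fun setT q ->
  mu.-integrable setT (EFin \o q) ->
  mu.-integrable setT (EFin \o (fun x => q x ^+ 2)) ->
  \int[mu]_x q x = 0 -> forall n c,
  (\int[prob_pow mu n]_x ((c + \sum_(i < n) q (tnth x i)) ^+ 2)%:E =
   (c ^+ 2 + n%:R * \int[mu]_x (q x ^+ 2))%:E)%E.
Proof.
move=> mq iq iq2 q0; set v := \int[mu]_x (q x ^+ 2).
elim=> [|n ih] c.
  rewrite ge0_integral_pow0; last by move=> x; rewrite lee_fin sqr_ge0.
  by rewrite big_ord0 addr0 mul0r addr0.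
rewrite ge0_integral_prob_powS; last 2 first.
- apply/measurable_EFinP; apply: measurable_funX; apply: measurable_funD => //.
  apply: (eq_measurable_fun (fun x : n.+1.-tuple T =>
    \sum_(i <- index_enum 'I_n.+1) q (tnth x i))) => //.
  by apply: measurable_sum => i; apply: (measurableT_comp mq); exact: measurable_tnth.
- by move=> x; rewrite lee_fin sqr_ge0.
rewrite (eq_integral (fun a => (c ^+ 2 + n%:R * v + 2 * c * q a + q a ^+ 2)%:E)); last first.
  move=> a _; rewrite (eq_integral (fun t : n.-tuple T =>
     (((c + q a) + \sum_(i < n) q (tnth t i)) ^+ 2)%:E)); last first.
    move=> t _; rewrite big_ord_recl tnth0 addrA; congr ((_ + _) ^+ 2)%:E.
    by apply: eq_bigr => i _; rewrite tnthS.
  by rewrite ih; congr EFin; ring.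
have i1 := integrable_EFin_cst mu (c ^+ 2 + n%:R * v).
have i2 := integrable_EFinZl (2 * c) iq.
have i3 := integrable_EFinD (integrable_EFinD i1 i2) iq2.
rewrite -(EFin_Rintegral i3) (RintegralD measurableT (integrable_EFinD i1 i2) iq2).
rewrite (RintegralD measurableT i1 i2) Rintegral_prob_cst RintegralZl// q0 -/v.
by congr EFin; rewrite -natr1; ring.
Qed.

Lemma ae_prob_pow (A : T -> Prop) n : {ae mu, forall x, A x} ->
  {ae prob_pow mu n, forall x, forall i, A (tnth x i)}.
Proof.
move=> [B [mB B0 AB]]; apply: filter_forall => i.
pose D (j : 'I_n) := if j == i then B else setT.
have mD j : measurable (D j) by rewrite /D; case: ifP.
exists [set x : n.-tuple T | B (tnth x i)]; split.
- by rewrite -[X in measurable X]setTI; exact: (measurable_tnth i).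
- rewrite (_ : [set x | _] = [set x | forall j, D j (tnth x j)]).
    by rewrite prob_pow_rect// (bigD1 i)//= {1}/D eqxx B0 mul0e.
  apply/seteqP; split => x /=.
    by move=> Bx j; rewrite /D; case: eqP => // ->.
  by move=> /(_ i); rewrite /D eqxx.
by move=> x /= Ax; exact: AB.
Qed.

End product_power_facts.

(** * The lower tail of the empirical process *)

Section gaussian_lower_tail.
Context d (Omega : measurableType d) (R : realType) (mu : probability Omega R).
Context d' (S : measurableType d') (P : probability S R).
Variables (A : set (Omega -> R)) (G : (Omega -> R) -> {RV P >-> R}) (m : nat)
  (q : 'I_m.+1 -> Omega -> R) (M : R) (H : R).
Hypotheses (GA : gaussian_process (l2inner mu) A G) (qA : forall i, A (q i))
  (mq : forall i, measurable_fun setT (q i))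
  (qM : forall i, {ae mu, forall x, `|q i x| <= M})
  (q0 : forall i, \int[mu]_x q i x = 0) (H0 : 0 < H).
Let k := m.+1.
Let Y w i : R := G (q i) w.
Let Gmax w := \big[Num.max/G (q ord0) w]_(i < m.+1) G (q i) w.
Hypothesis HG : (H%:E < 'E_P[Gmax])%E.

Let mY i : measurable_fun setT (Y ^~ i).
Proof. exact: measurable_funP. Qed.

Let mlin (u : 'I_k -> R) : measurable_fun setT (fun w => \sum_(i < k) u i * Y w i).
Proof.
rewrite (_ : (fun w => _) = fun w => \sum_(i <- index_enum 'I_k) u i * Y w i)//.
by apply: measurable_sum => i; apply: measurable_funM.
Qed.

Let gauss_lin (u : 'I_k -> R) :
  P.-integrable setT (EFin \o (fun w => (\sum_(i < k) u i * Y w i) ^+ 2)) /\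
  forall th, \int[P]_w cos (th + \sum_(i < k) u i * Y w i) =
    expR (- (\int[P]_w ((\sum_(i < k) u i * Y w i) ^+ 2) / 2)) * cos th.
Proof.
have [s s0 law] := GA.1 k q u qA.
exact: (centered_normal_cos (mlin u) law).
Qed.

Let coordE i w : \sum_(j < k) (j == i)%:R * Y w j = Y w i.
Proof.
rewrite (bigD1 i)//= eqxx mul1r big1 ?addr0// => j /negbTE ->.
by rewrite mul0r.
Qed.

Let iY2 i : P.-integrable setT (EFin \o (fun w => Y w i ^+ 2)).
Proof.
have [+ _] := gauss_lin (fun j => (j == i)%:R).
by under eq_fun do rewrite coordE.
Qed.

Let V : R := \sum_(i < k) \int[P]_w (Y w i ^+ 2).

Let YV i : \int[P]_w (Y w i ^+ 2) <= V.
Proof.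
rewrite /V (bigD1 i)//= lerDl sumr_ge0// => j _.
by apply: Rintegral_ge0 => w _; exact: sqr_ge0.
Qed.

(* Fernique's argument needs a family that is closed under negation. *)
Let Z w (i : 'I_(k + k)) : R :=
  match fintype.split i with inl j => Y w j | inr j => - Y w j end.

Let Zl w j : Z w (lshift k j) = Y w j.
Proof. by rewrite /Z (unsplitK (inl j)). Qed.

Let Zr w j : Z w (rshift k j) = - Y w j.
Proof. by rewrite /Z (unsplitK (inr j)). Qed.

Let Zcase (i : 'I_(k + k)) : (exists j, i = lshift k j) \/ (exists j, i = rshift k j).
Proof.
rewrite -(splitK i); case: (fintype.split i) => j; [left|right]; by exists j.
Qed.

Let mZ i : measurable_fun setT (Z ^~ i).
Proof.
have [[j ->]|[j ->]] := Zcase i.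
  by under eq_fun do rewrite Zl; exact: mY.
by under eq_fun do rewrite Zr; exact: measurable_funN.
Qed.

Let Zlin (u : 'I_(k + k) -> R) w : \sum_(i < k + k) u i * Z w i =
  \sum_(i < k) (u (lshift k i) - u (rshift k i)) * Y w i.
Proof.
rewrite big_split_ord/= -big_split/=; apply: eq_bigr => i _.
by rewrite Zl Zr; ring.
Qed.

Let iZ2 i : P.-integrable setT (EFin \o (fun w => Z w i ^+ 2)).
Proof.
have [[j ->]|[j ->]] := Zcase i.
  by under eq_fun do rewrite Zl.
by under eq_fun do rewrite Zr sqrrN.
Qed.

Let ZV i : \int[P]_w (Z w i ^+ 2) <= V.
Proof.
have [[j ->]|[j ->]] := Zcase i.
  by under eq_Rintegral do rewrite Zl.
by under eq_Rintegral do rewrite Zr sqrrN.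
Qed.

Let Zneg i : exists j, forall w, Z w j = - Z w i.
Proof.
have [[j ->]|[j ->]] := Zcase i.
  by exists (rshift k j) => w; rewrite Zl Zr.
by exists (lshift k j) => w; rewrite Zl Zr opprK.
Qed.

Let Gmax_attained w : exists i, Gmax w = Y w i.
Proof.
rewrite /Gmax; elim/big_ind: _ => [|x y [i ->] [j ->]|i _]; first by exists ord0.
  by have [?|?] := leP (Y w i) (Y w j); [exists j|exists i].
by exists i.
Qed.

Let mGmax : measurable_fun setT Gmax.
Proof.
rewrite /Gmax; elim: (index_enum _) => [|i s ih].
  by under eq_fun do rewrite big_nil; exact: measurable_funP.
under eq_fun do rewrite big_cons.
by apply: measurable_maxr => //; exact: measurable_funP.
Qed.

Let iGmax : P.-integrable setT (EFin \o Gmax).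
Proof.
have iS := integrable_EFin_sum (index_enum 'I_k) iY2.
have i1 := integrable_EFinD (integrable_EFin_cst P 1) iS.
apply: (le_integrable _ _ _ i1) => //; first exact/measurable_EFinP.
move=> w _; have [i Ei] := Gmax_attained w; rewrite /= lee_fin Ei.
rewrite (le_trans _ (ler_norm _))// (bigD1 i)//=.
have : 0 <= \sum_(j < k | j != i) Y w j ^+ 2 by apply: sumr_ge0 => j _; exact: sqr_ge0.
have : `|Y w i| <= 1 + Y w i ^+ 2.
  by rewrite ler_norml; apply/andP; split; nra.
by move=> *; lra.
Qed.

(** Otherwise the mean of the maximum would be at most 3 (H / 3) = H, against the choice of the
    family. *)
Let prob_Z : 10^-1 < fine (P [set w | exists i, H / 3 < Z w i]).
Proof.
rewrite ltNge; apply/negP => h.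
have H3 : 0 < H / 3 by rewrite divr_gt0.
have iZ u : P.-integrable setT (EFin \o (fun w => (\sum_(i < k + k) u i * Z w i) ^+ 2)).
  under eq_fun do rewrite Zlin.
  by have [] := gauss_lin (fun i => u (lshift k i) - u (rshift k i)).
have cosZ th u : \int[P]_w cos (th + \sum_(i < k + k) u i * Z w i) =
    expR (- (\int[P]_w ((\sum_(i < k + k) u i * Z w i) ^+ 2) / 2)) * cos th.
  under eq_Rintegral do rewrite Zlin.
  under [X in _ = expR (- (X / 2)) * _]eq_Rintegral do rewrite Zlin.
  by have [_ ->] := gauss_lin (fun i => u (lshift k i) - u (rshift k i)).
have GZ w : exists i, Gmax w = Z w i.
  by have [j ->] := Gmax_attained w; exists (lshift k j); rewrite Zl.
have := gaussian_max_expectation mZ iZ cosZ iZ2 ZV Zneg H3 h iGmax GZ.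
move: HG; rewrite unlock /= -(EFin_Rintegral iGmax) lte_fin => h1 h2.
have : 3 * (H / 3) = H by field.
by move: h1 h2; set I := Rintegral _ _ _; lra.
Qed.

(** Fernique's argument controls the family enlarged by its opposites, while one-sided sums are
    wanted: one of the two signs carries at least half of the probability. *)
Let prob_sign : exists2 sg : R, sg ^+ 2 = 1 &
  20^-1 <= fine (P [set w | exists i, H / 3 <= sg * Y w i]).
Proof.
pose B (sg : R) := [set w | exists i, H / 3 <= sg * Y w i].
have mB sg : measurable (B sg).
  apply: (@measurable_exists_ge _ _ R k (fun w i => sg * Y w i)) => i.
  exact: measurable_funM.
have sub : [set w | exists i, H / 3 < Z w i] `<=` B 1 `|` B (-1).
  move=> w [i]; have [[j ->]|[j ->]] := Zcase i; rewrite ?Zl ?Zr => /ltW h.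
    by left; exists j; rewrite mul1r.
  by right; exists j; rewrite mulN1r.
pose AZ := [set w | exists i, H / 3 < Z w i].
pose B1 := B 1; pose B2 := B (-1).
have : (P AZ <= P B1 + P B2)%E.
  apply: (@le_trans _ _ (P (B1 `|` B2))).
    apply: le_measure => //; rewrite ?inE.
    - exact: measurable_exists_gt.
    - by apply: measurableU; exact: mB.
  by apply: measureU2; exact: mB.
have mAZ : measurable AZ by exact: measurable_exists_gt.
rewrite -[leLHS]fineK ?fin_num_measure// -[P B1]fineK ?fin_num_measure//; last exact: mB.
rewrite -[P B2]fineK ?fin_num_measure//; last exact: mB.
rewrite -EFinD lee_fin => h.
have := prob_Z; move: h; set a := fine _; set b := fine _; set c := fine _ => h1 h2.
have [hb|hb] := leP 20^-1 b; first by exists 1; rewrite ?expr1n.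
by exists (-1); [rewrite sqrrN expr1n|rewrite -/(B (-1)) -/B2 -/c; lra].
Qed.

Let iq i : mu.-integrable setT (EFin \o q i).
Proof. exact: ae_bounded_integrable (mq i) (qM i). Qed.

Let iqq i j : mu.-integrable setT (EFin \o (fun x => q i x * q j x)).
Proof.
apply: (@ae_bounded_integrable _ _ _ _ _ (M * M)); first exact: measurable_funM.
by apply: filterS2 (qM i) (qM j) => x h1 h2; rewrite normrM ler_pM.
Qed.

Let iq2 i : mu.-integrable setT (EFin \o (fun x => q i x ^+ 2)).
Proof. by under eq_fun do rewrite expr2; exact: iqq. Qed.

Let EYY i j : \int[P]_w (Y w i * Y w j) = \int[mu]_x (q i x * q j x).
Proof.
have := GA.2 (q i) (q j) (qA i) (qA j); rewrite unlock /= /Rintegral => ->.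
by [].
Qed.

Let X n (x : n.-tuple Omega) (i : 'I_k) : R :=
  (\sum_(j < n) - q i (tnth x j)) / Num.sqrt n%:R.

Let mS n i : measurable_fun setT (fun x : n.-tuple Omega => \sum_(j < n) - q i (tnth x j)).
Proof.
rewrite (_ : (fun x => _) = fun x : n.-tuple Omega => \sum_(j <- index_enum 'I_n) - q i (tnth x j))//.
apply: measurable_sum => j; apply: measurable_funN.
by apply: (measurableT_comp (mq i)); exact: measurable_tnth.
Qed.

Let mX n i : measurable_fun setT (fun x => X (n := n) x i).
Proof. by apply: measurable_funM => //; exact: mS. Qed.

Let X2 n i : (\int[prob_pow mu n]_x (X x i ^+ 2)%:E =
  ((Num.sqrt n%:R)^-1 ^+ 2 * (n%:R * \int[mu]_x (q i x ^+ 2)))%:E)%E.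
Proof.
have iN : mu.-integrable setT (EFin \o (fun x => - q i x)).
  by under eq_fun do rewrite -mulN1r; exact: integrable_EFinZl.
have iN2 : mu.-integrable setT (EFin \o (fun x => (- q i x) ^+ 2)).
  by under eq_fun do rewrite sqrrN.
have EN : \int[mu]_x - q i x = 0.
  under eq_Rintegral do rewrite -mulN1r.
  by rewrite RintegralZl// q0 mulr0.
have := integral_square_prob_pow (measurable_funN (mq i)) iN iN2 EN n 0.
under [in X in _ = X -> _]eq_Rintegral do rewrite sqrrN.
rewrite expr0n add0r /= => E.
rewrite EFinM -E -ge0_integralZl//; last 2 first.
- by apply/measurable_EFinP; apply: measurable_funX; apply: measurable_funD => //; exact: mS.
- by move=> x _; rewrite lee_fin sqr_ge0.
by apply: eq_integral => x _; rewrite -EFinM add0r /X exprMn mulrC.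
Qed.

(** Covariances do not see the sign: [sg] Y, the functions q_i and their opposites all share one
    covariance matrix, so the normalized sums of the opposites converge to [sg] Y for either value
    of [sg]. Passing to the limit costs the gap from H / 3 to H / 4 and half of the probability
    1/20. *)
Lemma gaussian_lower_tail : \forall n \near \oo,
  40^-1 <= fine (prob_pow mu n [set x | exists i,
     H / 4 < (\sum_(j < n) - q i (tnth x j)) / Num.sqrt n%:R]).
Proof.
have [sg sg2 hsg] := prob_sign.
pose Ys w i := sg * Y w i.
have E2 i w : Ys w i ^+ 2 = Y w i ^+ 2 by rewrite /Ys exprMn sg2 mul1r.
have mYs i : measurable_fun setT (Ys ^~ i) by exact: measurable_funM.
have iYs i : P.-integrable setT (EFin \o (fun w => Ys w i ^+ 2)).
  by under eq_fun do rewrite E2.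
have YsE i : \int[P]_w (Ys w i ^+ 2) = \int[mu]_x (q i x ^+ 2).
  under eq_Rintegral do rewrite E2 expr2; rewrite EYY.
  by apply: eq_Rintegral => x _; rewrite expr2.
have YsV i : \int[P]_w (Ys w i ^+ 2) <= V.
  by under eq_Rintegral do rewrite E2.
have XV n i : (0 < n)%N -> (\int[prob_pow mu n]_x (X x i ^+ 2)%:E = (\int[P]_w (Ys w i ^+ 2))%:E)%E.
  move=> n0; rewrite X2 YsE; congr EFin.
  by rewrite exprVn sqr_sqrtr// mulKf// pnatr_eq0 -lt0n.
have iX n i : (prob_pow mu n).-integrable setT (EFin \o (fun x => X (n := n) x i ^+ 2)).
  apply/integrableP; split; first by apply/measurable_EFinP; apply: measurable_funX; exact: (@mX n i).
  under eq_integral do rewrite /= ger0_norm ?sqr_ge0//.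
  by rewrite X2 ltry.
have XV' n i : (0 < n)%N -> \int[prob_pow mu n]_x (X x i ^+ 2) <= V.
  by move=> n0; rewrite {1}/Rintegral (XV n i n0) /=; exact: YsV.
have cosX th u : \int[prob_pow mu n]_x cos (th + \sum_(i < k) u i * X x i) @[n --> \oo] -->
    \int[P]_w cos (th + \sum_(i < k) u i * Ys w i).
  pose r x := - \sum_(i < k) u i * q i x.
  have mr : measurable_fun setT r.
    apply: measurable_funN; rewrite (_ : (fun x => _) = fun x => \sum_(i <- index_enum 'I_k) u i * q i x)//.
    by apply: measurable_sum => i; exact: measurable_funM.
  pose Mr := \sum_(i < k) `|u i| * M.
  have rM : {ae mu, forall x, `|r x| <= Mr}.
    have : {ae mu, forall x, forall i, `|q i x| <= M}.
      apply: (@filter_forall _ 'I_m.+1 (fun i x => `|q i x| <= M)).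
      exact: qM.
    apply: filterS => x h; rewrite normrN (le_trans (ler_norm_sum _ _ _))//.
    by apply: ler_sum => i _; rewrite normrM ler_wpM2l.
  have ir := ae_bounded_integrable mr rM.
  have ir2 : mu.-integrable setT (EFin \o (fun x => r x ^+ 2)).
    apply: (@ae_bounded_integrable _ _ _ _ _ (Mr ^+ 2)); first exact: measurable_funX.
    by apply: filterS rM => x h; rewrite normrX lerXn2r ?nnegrE// (le_trans _ h).
  have ir3 : mu.-integrable setT (EFin \o (fun x => `|r x| ^+ 3)).
    apply: (@ae_bounded_integrable _ _ _ _ _ (Mr ^+ 3)).
      by apply: measurable_funX; exact: measurableT_comp.
    by apply: filterS rM => x h; rewrite normrX normr_id lerXn2r ?nnegrE// (le_trans _ h).
  have r0 : \int[mu]_x r x = 0.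
    rewrite /r; under eq_Rintegral do rewrite -sumrN.
    rewrite Rintegral_sum; last first.
      by move=> i; under eq_fun do rewrite -mulNr; exact: integrable_EFinZl.
    apply: big1 => i _; under eq_Rintegral do rewrite -mulNr.
    by rewrite RintegralZl// q0 mulr0.
  have vE : \int[mu]_x (r x ^+ 2) = \int[P]_w ((\sum_(i < k) u i * Ys w i) ^+ 2).
    under eq_Rintegral do rewrite sqrrN.
    rewrite (@Rintegral_square_sum _ _ _ mu k (fun x i => q i x))//.
    rewrite Rintegral_square_sum//; apply: eq_bigr => i _; apply: eq_bigr => j _.
    congr (_ * _); rewrite -EYY; apply: eq_Rintegral => w _.
    by rewrite /Ys mulrACA -expr2 sg2 mul1r.
  have lhs : \int[P]_w cos (th + \sum_(i < k) u i * Ys w i) =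
      expR (- (\int[mu]_x (r x ^+ 2) / 2)) * cos th.
    have [_ /(_ th)] := gauss_lin (fun i => u i * sg).
    have E w : \sum_(i < k) u i * sg * Y w i = \sum_(i < k) u i * Ys w i.
      by apply: eq_bigr => i _; rewrite mulrA.
    under eq_Rintegral do rewrite E.
    under [X in _ = expR (- (X / 2)) * _]eq_Rintegral do rewrite E.
    by move=> ->; rewrite vE.
  rewrite lhs.
  have XE n (x : n.-tuple Omega) : th + \sum_(i < k) u i * X x i =
      th + (\sum_(j < n) r (tnth x j)) / Num.sqrt n%:R.
    congr (_ + _); rewrite /X; under eq_bigr do rewrite mulrA.
    rewrite -mulr_suml; congr (_ / _).
    under eq_bigr do rewrite mulr_sumr.
    rewrite exchange_big/=; apply: eq_bigr => j _.
    by rewrite /r -sumrN; apply: eq_bigr => i _; rewrite mulrN.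
  pose C := 2 * \int[mu]_x (`|r x| ^+ 3) + (\int[mu]_x (r x ^+ 2)) ^+ 2.
  apply/cvgrPdist_le => e e0.
  near=> n.
  have n0 : (0 < n)%N by near: n; exact: nbhs_infty_gt.
  have -> : \int[prob_pow mu n]_x cos (th + \sum_(i < k) u i * X x i) =
      \int[prob_pow mu n]_x cos (th + (\sum_(j < n) r (tnth x j)) / Num.sqrt n%:R).
    by apply: eq_Rintegral => x _; rewrite XE.
  rewrite distrC (le_trans (clt_cos th mr ir ir2 ir3 r0 n0))// -/C.
  have C0 : 0 <= C.
    by rewrite addr_ge0 ?sqr_ge0// mulr_ge0//; apply: Rintegral_ge0 => x _; exact: exprn_ge0.
  rewrite ler_pdivrMr ?sqrtr_gt0 ?ltr0n// mulrC -ler_pdivrMr//.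
  have Ce0 : 0 <= C / e by rewrite divr_ge0// ltW.
  rewrite -(ger0_norm Ce0) -sqrtr_sqr; apply: ler_wsqrtr.
  by near: n; exact: nbhs_infty_ger.
have H34 : H / 4 < H / 3 by move: H0; lra.
have eta0 : 0 < 40^-1 :> R by rewrite invr_gt0.
have := portmanteau_exists_gt mYs mX iYs YsV iX XV' cosX H34 eta0.
apply: filterS => n; apply: le_trans.
by move: hsg; set a := fine _; lra.
Unshelve. all: end_near. Qed.

End gaussian_lower_tail.

(** * The localized excess losses *)

Section clip.
Context (R : realType).
Implicit Types a b M : R.

Definition clip M a : R := Num.max (- M) (Num.min M a).

Lemma clip_id M a : `|a| <= M -> clip M a = a.
Proof.
rewrite ler_norml => /andP[a1 a2].
by rewrite /clip (min_idPr a2) (max_idPr a1).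
Qed.

Lemma clip_norm_le M a : 0 <= M -> `|clip M a| <= M.
Proof.
move=> M0; rewrite /clip ler_norml le_max lexx/= ge_max ge_min lexx/=.
by rewrite andbT; lra.
Qed.

Lemma clip_lipschitz M a b : `|clip M a - clip M b| <= `|a - b|.
Proof.
have mx (c x y : R) : `|Num.max c x - Num.max c y| <= `|x - y|.
  have [h1|h1] := leP c x; have [h2|h2] := leP c y => //.
  - by rewrite !ger0_norm ?subr_ge0//; lra.
  - by rewrite !ler0_norm ?subr_le0//; lra.
  - by rewrite subrr normr0.
have mn (c x y : R) : `|Num.min c x - Num.min c y| <= `|x - y|.
  have [h1|h1] := leP c x; have [h2|h2] := leP c y => //.
  - by rewrite subrr normr0.
  - by rewrite !ger0_norm ?subr_ge0//; lra.
  - by rewrite !ler0_norm ?subr_le0//; lra.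
by rewrite /clip (le_trans (mx _ _ _)).
Qed.

Lemma clip_sqr_le M a : 0 <= M -> clip M a ^+ 2 <= a ^+ 2.
Proof.
move=> M0; have := clip_lipschitz M a 0.
rewrite subr0 (@clip_id M 0) ?normr0// subr0 => h.
by rewrite -(real_normK (num_real a)) -(real_normK (num_real (clip M a))) lerXn2r ?nnegrE.
Qed.

Lemma measurable_clip M : measurable_fun setT (clip M).
Proof.
apply: measurable_maxr => //; apply: measurable_minr => //.
Qed.

End clip.

Section bounded_functions.
Context d (Omega : measurableType d) (R : realType) (mu : probability Omega R).

Lemma Linfty_ballP (f : Omega -> R) : Linfty_ball mu f ->
  measurable_fun setT f /\ {ae mu, forall x, `|f x| <= 1}.
Proof.
move=> [fL]; rewrite unlock /=; case: ifPn => [_|]; last first.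
  by rewrite (_ : (mu setT = 1)%E) ?lte01//; exact: probability_setT.
move=> /ess_supP f1; split; first by have := sub_Lfun_mfun fL; rewrite inE.
by apply: filterS f1 => x; rewrite /= lee_fin.
Qed.

Lemma l2norm_sqr (h : Omega -> R) : measurable_fun setT h ->
  mu.-integrable setT (EFin \o (fun x => h x ^+ 2)) ->
  l2norm mu h ^+ 2 = \int[mu]_x (h x ^+ 2).
Proof.
move=> mh ih.
have := @powR_Lnorm _ _ _ mu (EFin \o h) 2; rewrite pnatr_eq0 => /(_ isT).
move: (Lnorm_ge0 mu 2%:E (EFin \o h)); rewrite /l2norm.
have -> : (\int[mu]_x `|(EFin \o h) x| `^ 2 = (\int[mu]_x (h x ^+ 2))%:E)%E.
  rewrite EFin_Rintegral//; apply: eq_integral => x _ /=.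
  by rewrite powR_mulrn// real_normK// num_real.
case: Lnorm => [r r0|_|//].
  by rewrite poweR_EFin powR_mulrn// => -[].
by rewrite poweRyr// pnatr_eq0.
Qed.

Lemma l2norm_ge0 (h : Omega -> R) : 0 <= l2norm mu h.
Proof. by rewrite fine_ge0// Lnorm_ge0. Qed.

End bounded_functions.

Section excess_losses.
Context d (Omega : measurableType d) (R : realType) (mu : probability Omega R).
Variables (F : set (Omega -> R)) (T fstar : Omega -> R).
Hypotheses (FL : forall f, F f -> f \in Lfun mu 2%:E /\ Linfty_ball mu f)
  (TL : Linfty_ball mu T) (Fmin : risk_minimizer mu F T fstar).

Let Fs : F fstar. Proof. by case: Fmin. Qed.

Lemma class_measurable f : F f -> measurable_fun setT f.
Proof. by move=> /FL[_ /Linfty_ballP[]]. Qed.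

Let mT : measurable_fun setT T. Proof. by case: (Linfty_ballP TL). Qed.

Let ae_sub f h : Linfty_ball mu f -> Linfty_ball mu h ->
  {ae mu, forall x, `|f x - h x| <= 2}.
Proof.
move=> /Linfty_ballP[_ f1] /Linfty_ballP[_ h1].
by apply: filterS2 f1 h1 => x f1 h1; rewrite (le_trans (ler_normB _ _))//; lra.
Qed.

Lemma class_diff_bound f : F f -> {ae mu, forall x, `|f x - fstar x| <= 2}.
Proof. by move=> Ff; apply: ae_sub; [have [] := FL Ff|have [] := FL Fs]. Qed.

Lemma target_diff_bound : {ae mu, forall x, `|fstar x - T x| <= 2}.
Proof. by apply: ae_sub => //; have [] := FL Fs. Qed.

Let sqr_le4 (a : R) : `|a| <= 2 -> `|a ^+ 2| <= 4.
Proof. by rewrite ler_norml => /andP[? ?]; rewrite ger0_norm ?sqr_ge0//; nra. Qed.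

Lemma integrable_class_diff_sqr f : F f ->
  mu.-integrable setT (EFin \o (fun x => (f x - fstar x) ^+ 2)).
Proof.
move=> Ff; apply: (@ae_bounded_integrable _ _ _ _ _ 4).
  by apply: measurable_funX; apply: measurable_funB; exact: class_measurable.
by apply: filterS (class_diff_bound Ff) => x; exact: sqr_le4.
Qed.

Lemma excess_lossE f x : excess_loss T fstar f x =
  (f x - fstar x) ^+ 2 + 2 * (fstar x - T x) * (f x - fstar x).
Proof. by rewrite /excess_loss /loss /sq_loss; ring. Qed.

Lemma excess_loss_moved lam f x : excess_loss (moved_target lam T fstar) fstar f x =
  (1 - lam) * excess_loss T fstar f x + lam * (f x - fstar x) ^+ 2.
Proof. by rewrite /excess_loss /moved_target /loss /sq_loss; ring. Qed.

Lemma measurable_excess_loss f : F f -> measurable_fun setT (excess_loss T fstar f).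
Proof.
move=> Ff; have mf := class_measurable Ff; have ms := class_measurable Fs.
by apply: measurable_funB; apply: measurable_funX; exact: measurable_funB.
Qed.

Lemma excess_loss_bound f : F f -> {ae mu, forall x, `|excess_loss T fstar f x| <= 12}.
Proof.
move=> Ff; apply: filterS2 (class_diff_bound Ff) target_diff_bound => x.
rewrite excess_lossE; move: (f x - _) (fstar x - _) => a b.
rewrite !ler_norml => /andP[? ?] /andP[? ?]; apply/andP; split; nra.
Qed.

Lemma integrable_excess_loss f : F f ->
  mu.-integrable setT (EFin \o excess_loss T fstar f).
Proof.
move=> Ff; apply: (@ae_bounded_integrable _ _ _ _ _ 12).
  exact: measurable_excess_loss.
exact: excess_loss_bound.
Qed.

Let integrable_loss f : F f -> mu.-integrable setT (EFin \o loss f T).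
Proof.
move=> Ff; have [_ fL] := FL Ff; apply: (@ae_bounded_integrable _ _ _ _ _ 4).
  by apply: measurable_funX; apply: measurable_funB => //; exact: class_measurable.
by apply: filterS (ae_sub fL TL) => x; exact: sqr_le4.
Qed.

Lemma excess_risk_ge0 f : F f -> 0 <= \int[mu]_x excess_loss T fstar f x.
Proof.
move=> Ff; rewrite /excess_loss RintegralB//; [|exact: integrable_loss..].
by rewrite subr_ge0; case: Fmin => _; exact.
Qed.

Lemma excess_risk_moved lam f : F f ->
  \int[mu]_x excess_loss (moved_target lam T fstar) fstar f x =
  (1 - lam) * \int[mu]_x excess_loss T fstar f x + lam * l2norm mu (fstar \- f) ^+ 2.
Proof.
move=> Ff; have i1 := integrable_excess_loss Ff; have i2 := integrable_class_diff_sqr Ff.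
have E x : (fstar \- f) x ^+ 2 = (f x - fstar x) ^+ 2 by rewrite /=; ring.
rewrite l2norm_sqr; last 2 first.
- by apply: measurable_funB; exact: class_measurable.
- by under eq_fun do rewrite E.
under [X in _ + _ * X]eq_Rintegral do rewrite E.
rewrite -!RintegralZl//.
rewrite -RintegralD//; [|exact: integrable_EFinZl..].
by apply: eq_Rintegral => x _; exact: excess_loss_moved.
Qed.

Lemma excess_risk_moved_ge lam f : F f -> 0 <= lam <= 1 ->
  lam * l2norm mu (fstar \- f) ^+ 2 <=
  \int[mu]_x excess_loss (moved_target lam T fstar) fstar f x.
Proof.
move=> Ff /andP[l0 l1]; rewrite excess_risk_moved// lerDr mulr_ge0 ?subr_ge0//.
exact: excess_risk_ge0.
Qed.

Lemma l2norm_target_le2 : l2norm mu (T \- fstar) <= 2.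
Proof.
have E x : (T \- fstar) x ^+ 2 = (fstar x - T x) ^+ 2 by rewrite /=; ring.
have m1 : measurable_fun setT (T \- fstar).
  by apply: measurable_funB => //; exact: class_measurable.
have b1 : {ae mu, forall x, `|(T \- fstar) x ^+ 2| <= 4}.
  by apply: filterS target_diff_bound => x; rewrite E; exact: sqr_le4.
have i1 := ae_bounded_integrable (measurable_funX 2 m1) b1.
rewrite -(@ler_pXn2r _ 2) ?nnegrE ?l2norm_ge0// l2norm_sqr//.
rewrite -lee_fin EFin_Rintegral//.
have -> : ((2 ^+ 2)%:E = \int[mu]_x (4 : R)%:E :> \bar R)%E.
  by rewrite integral_prob_cst; congr EFin; ring.
apply: ae_ge0_le_integral => //=.
- by move=> x _; rewrite lee_fin sqr_ge0.
- exact/measurable_EFinP/measurable_funX.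
by apply: filterS b1 => x h _; rewrite lee_fin (le_trans (ler_norm _) h).
Qed.

End excess_losses.

Section oscillation.
Context d (Omega : measurableType d) (R : realType) (mu : probability Omega R).
Variables (F : set (Omega -> R)) (fstar : Omega -> R) (n : nat) (delta : R).
Hypotheses (Fs : F fstar) (delta0 : 0 < delta).

Let W := (prob_pow mu n \x prob_pow (normal_prob (0 : R) 1) n)%E.

Let osc_sup (p : n.-tuple Omega * n.-tuple R) : \bar R :=
  ereal_sup [set `|\sum_(i < n)
       tnth p.2 i * (fstar (tnth p.1 i) - h (tnth p.1 i))|%:E
    | h in [set h | F h /\ l2norm mu (fstar \- h) <= delta]].

Let l2norm_sub_self : l2norm mu (fstar \- fstar) = 0.
Proof.
rewrite (_ : fstar \- fstar = cst 0); last by apply/funext => x /=; rewrite subrr.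
apply/eqP; rewrite -sqrf_eq0 l2norm_sqr//; last first.
  apply: (@bounded_integrable _ _ _ _ _ 0) => [|x] /=; first exact: measurable_cst.
  by rewrite expr0n/= normr0.
by under eq_Rintegral do rewrite /= expr0n/=; rewrite Rintegral_prob_cst.
Qed.

Let osc_sup_ge0 p : (0 <= osc_sup p)%E.
Proof.
apply: (@le_trans _ _ `|\sum_(i < n)
    tnth p.2 i * (fstar (tnth p.1 i) - fstar (tnth p.1 i))|%:E)%E.
  by rewrite lee_fin.
by apply: ereal_sup_ubound; exists fstar => //; split; rewrite // l2norm_sub_self ltW.
Qed.

(** The supremum is nonnegative because [fstar] itself belongs to the localized class. *)
Lemma osc_ge0 : (0 <= osc mu n F fstar delta)%E.
Proof.
apply: mule_ge0; first by rewrite lee_fin invr_ge0 sqrtr_ge0.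
apply: le_ereal_inf_tmp => _ [phi [mphi hphi] <-].
by apply: integral_ge0 => p _; rewrite (le_trans _ (hphi p))// osc_sup_ge0.
Qed.

(** The infimum that defines the outer expectation need not be attained; the factor 2, together with
    c > 0, leaves room to select a measurable majorant. *)
Lemma osc_majorant c : (0 < n)%N -> 0 < c -> (osc mu n F fstar delta <= c%:E)%E ->
  exists phi : n.-tuple Omega * n.-tuple R -> \bar R,
  [/\ measurable_fun setT phi, forall p, (0 <= phi p)%E,
    forall h, F h -> l2norm mu (fstar \- h) <= delta -> forall x g,
      ((\sum_(i < n) tnth g i * (h (tnth x i) - fstar (tnth x i)))%:E <= phi (x, g))%E &
    (\int[W]_p phi p <= (2 * c * Num.sqrt n%:R)%:E)%E].
Proof.
move=> n0 c0 oc; set s := Num.sqrt n%:R.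
have s0 : 0 < s by rewrite sqrtr_gt0 ltr0n.
have : (outer_expectation W osc_sup < (2 * c * s)%:E)%E.
  apply: (@le_lt_trans _ _ (s%:E * c%:E)%E); last by rewrite -EFinM lte_fin; nra.
  have h : ((s^-1)%:E * outer_expectation W osc_sup <= c%:E)%E := oc.
  by rewrite -lee_pdivrMl.
move=> /ereal_inf_lt[_ [phi [mphi hphi] <-]] /ltW hphi2.
exists phi; split => // [p|h Fh hd x g]; first by rewrite (le_trans _ (hphi p))// osc_sup_ge0.
apply: le_trans (hphi (x, g)).
apply: (@le_trans _ _ `|\sum_(i < n) tnth g i * (fstar (tnth x i) - h (tnth x i))|%:E)%E.
  rewrite lee_fin -normrN -sumrN (le_trans _ (ler_norm _))// le_eqVlt.
  by apply/orP; left; apply/eqP; apply: eq_bigr => i _; ring.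
by apply: ereal_sup_ubound; exists h.
Qed.

End oscillation.

Section lower_tail.
Context d (Omega : measurableType d) (R : realType) (mu : probability Omega R).
Variables (F : set (Omega -> R)) (T fstar : Omega -> R).
Hypotheses (FL : forall f, F f -> f \in Lfun mu 2%:E /\ Linfty_ball mu f)
  (TL : Linfty_ball mu T) (Fmin : risk_minimizer mu F T fstar).

Lemma excess_loss_lower_tail (H : R) : 0 < H ->
  (H%:E < gaussian_sup mu (zero_excess_losses mu F T fstar))%E ->
  exists m (f : 'I_m.+1 -> Omega -> R), (forall i, F (f i)) /\
  \forall n \near \oo, 40^-1 <= fine (prob_pow mu n [set x | exists i,
     H / 4 < (\sum_(j < n) - excess_loss T fstar (f i) (tnth x j)) / Num.sqrt n%:R]).
Proof.
move=> H0 /ereal_sup_gt[_ [d' [S [P [G [GA [m [q [qQ ->]]]]]]]] HG].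
have /choice[f fP] i : exists f, [/\ F f, \int[mu]_x excess_loss T fstar f x = 0 &
    q i = excess_loss T fstar f].
  by have [f [Ff f0] <-] := qQ i; exists f.
have qE : q = fun i => excess_loss T fstar (f i) by apply/funext => i; have [] := fP i.
move: HG qQ; rewrite qE => HG qQ.
exists m, f; split; first by move=> i; have [] := fP i.
apply: (gaussian_lower_tail GA qQ (M := 12)) => // i; have [Fi ? _] := fP i => //.
- exact: (measurable_excess_loss FL TL Fmin).
- exact: (excess_loss_bound FL TL Fmin).
Qed.

End lower_tail.

Section localization.
Context d (Omega : measurableType d) (R : realType) (mu : probability Omega R).
Variables (F : set (Omega -> R)) (T fstar : Omega -> R).
Hypotheses (FL : forall f, F f -> f \in Lfun mu 2%:E /\ Linfty_ball mu f)
  (TL : Linfty_ball mu T) (Fmin : risk_minimizer mu F T fstar).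
Variables (n : nat) (delta c lam : R).
Hypotheses (n0 : (0 < n)%N) (delta0 : 0 < delta) (c0 : 0 < c) (lam01 : 0 <= lam <= 1)
  (oc : (osc mu n F fstar delta <= c%:E)%E).

Let Fs : F fstar. Proof. by case: Fmin. Qed.
Let Tl := moved_target lam T fstar.

(* Members of [F] are bounded by 1 only almost everywhere, and [F] need not be
   countable, so that the values of all of them at the sample points cannot be
   controlled at once: the excess loss is therefore truncated from below. *)
Let U (y : Omega) (a : R) :=
  clip 2 a ^+ 2 + clip 4 (2 * (1 - lam) * (fstar y - T y)) * a.

Let coefficient_bound (b : R) : `|b| <= 2 -> `|2 * (1 - lam) * b| <= 4.
Proof.
move: lam01 => /andP[? ?]; rewrite !ler_norml => /andP[? ?]; apply/andP.
by split; nra.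
Qed.

Let excess_lossU f y : excess_loss Tl fstar f y =
  (f y - fstar y) ^+ 2 + 2 * (1 - lam) * (fstar y - T y) * (f y - fstar y).
Proof. by rewrite excess_loss_moved excess_lossE; ring. Qed.

Let U_le_excess f y : `|fstar y - T y| <= 2 ->
  U y (f y - fstar y) <= excess_loss Tl fstar f y.
Proof.
move=> h; rewrite excess_lossU /U (clip_id (coefficient_bound h)).
by rewrite lerD2r clip_sqr_le.
Qed.

Let U_eq_excess f y : `|fstar y - T y| <= 2 -> `|f y - fstar y| <= 2 ->
  U y (f y - fstar y) = excess_loss Tl fstar f y.
Proof.
by move=> h1 h2; rewrite excess_lossU /U (clip_id h2) (clip_id (coefficient_bound h1)).
Qed.

Let U0 x : U x 0 = 0.
Proof. by rewrite /U clip_id ?normr0// expr0n/= mulr0 addr0. Qed.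

(** The constant 8 is 4 for the square of a value clipped at 2 and 4 for the clipped coefficient of
    the linear term. *)
Let UK x a b : `|U x a - U x b| <= 8 * `|a - b|.
Proof.
rewrite /U; have := clip_norm_le (2 * (1 - lam) * (fstar x - T x)) (ler0n R 4).
move: (clip 4 _) => w w4.
have a2 := clip_norm_le a (ler0n R 2); have b2 := clip_norm_le b (ler0n R 2).
have ab := clip_lipschitz 2 a b.
have -> : clip 2 a ^+ 2 + w * a - (clip 2 b ^+ 2 + w * b) =
  (clip 2 a + clip 2 b) * (clip 2 a - clip 2 b) + w * (a - b) by ring.
rewrite (_ : 8 * _ = 4 * `|a - b| + 4 * `|a - b|); last by ring.
rewrite (le_trans (ler_normD _ _))// !normrM lerD// ler_pM//.
by rewrite (le_trans (ler_normD _ _))//; lra.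
Qed.

Let measurable_coefficient :
  measurable_fun setT (fun y => clip 4 (2 * (1 - lam) * (fstar y - T y))).
Proof.
apply: (measurableT_comp (measurable_clip _)).
apply: measurable_funM => //; apply: measurable_funB.
  exact: (class_measurable FL Fs).
by have [] := Linfty_ballP TL.
Qed.

Let mU a : measurable_fun setT (U ^~ a).
Proof. by apply: measurable_funD => //; apply: measurable_funM. Qed.

Let mUh h : F h -> measurable_fun setT (fun x => U x (h x - fstar x)).
Proof.
move=> Fh; have mh : measurable_fun setT (fun x => h x - fstar x).
  by apply: measurable_funB; [exact: (class_measurable FL Fh)|exact: (class_measurable FL Fs)].
apply: measurable_funD; last exact: measurable_funM.
exact/measurable_funX/(measurableT_comp (measurable_clip _)).
Qed.

Let iU h : F h -> mu.-integrable setT (EFin \o (fun x => U x (h x - fstar x))).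
Proof.
move=> Fh; apply: (@ae_bounded_integrable _ _ _ _ _ 16); first exact: mUh.
apply: filterS (class_diff_bound FL Fmin Fh) => x h2.
have := UK x (h x - fstar x) 0; rewrite U0 !subr0 => /le_trans; apply.
by lra.
Qed.

(** For a single [h] the truncation acts on a null set only, so the mean is the true excess risk. *)
Let truncated_risk_ge0 h : F h -> 0 <= \int[mu]_x U x (h x - fstar x).
Proof.
move=> Fh; rewrite (@ae_eq_Rintegral _ _ _ _ _ (excess_loss Tl fstar h)).
- apply: le_trans (excess_risk_moved_ge FL TL Fmin Fh lam01).
  by rewrite mulr_ge0 ?sqr_ge0//; case/andP: lam01.
- exact: mUh.
- rewrite (_ : excess_loss _ _ _ = fun x => (1 - lam) * excess_loss T fstar h x +
      lam * (h x - fstar x) ^+ 2); last by apply/funext => x; rewrite excess_loss_moved.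
  apply: measurable_funD; apply: measurable_funM => //.
    exact: (measurable_excess_loss FL TL Fmin).
  apply: measurable_funX.
  by apply: measurable_funB; [exact: (class_measurable FL Fh)|exact: (class_measurable FL Fs)].
apply: filterS2 (class_diff_bound FL Fmin Fh) (target_diff_bound FL TL Fmin) => x h1 h2.
exact: U_eq_excess.
Qed.

(** Symmetrization with K = 8 and kap = c / sqrt n: the Gaussian term is (8 / half_mean) (2 c sqrt
    n) and the rounding error 4 n 8 kap = 32 c sqrt n is of the same order. The nonnegative mean is
    then dropped. *)
Lemma localized_deviation : exists B : n.-tuple Omega -> \bar R,
  [/\ measurable_fun setT B, forall x, (0 <= B x)%E,
    (\int[prob_pow mu n]_x B x <=
      ((16 / half_mean R + 32) * c * Num.sqrt n%:R)%:E)%E &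
    forall x, (forall j, `|fstar (tnth x j) - T (tnth x j)| <= 2) ->
    forall h, F h -> l2norm mu (fstar \- h) <= delta ->
      ((- \sum_(j < n) excess_loss Tl fstar h (tnth x j))%:E <= B x)%E].
Proof.
have [phi [mphi phi0 phiV iphi]] := osc_majorant Fs delta0 n0 c0 oc.
pose Vc := [set h \- fstar | h in [set h | F h /\ l2norm mu (fstar \- h) <= delta]].
have s0 : 0 < Num.sqrt n%:R :> R by rewrite sqrtr_gt0 ltr0n.
have := @symmetrization _ Omega R mu n phi Vc (c / Num.sqrt n%:R) 8 U mphi phi0.
case=> //.
- by move=> _ [h [Fh hd] <-] x g; exact: phiV.
- by rewrite divr_gt0.
- by move=> _ [h [Fh hd] <-]; exact: iU.
move=> B [mB B0 iB BV]; exists B; split => //.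
- apply: (le_trans iB).
  apply: (@le_trans _ _ ((8 / half_mean R)%:E * (2 * c * Num.sqrt n%:R)%:E +
     (4 * (n%:R * (8 * (c / Num.sqrt n%:R))))%:E)%E).
    rewrite leeD2r// lee_wpmul2l// lee_fin divr_ge0// ltW//; exact: half_mean_gt0.
  rewrite -EFinM -EFinD lee_fin le_eqVlt; apply/orP; left; apply/eqP.
  have hm := @half_mean_gt0 R; have := @sqr_sqrtr R n%:R (ler0n _ _).
  move: (Num.sqrt _) s0 => s s0 <-.
  by field; rewrite !gt_eqF.
move=> x hx h Fh hd; apply: le_trans (BV (h \- fstar) _ x); last by exists h.
rewrite lee_fin lerBrDl (le_trans (y := 0))//.
  rewrite subr_le0; apply: ler_sum => j _; exact: U_le_excess.
by rewrite mulr_ge0// truncated_risk_ge0.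
Qed.

End localization.

(** * The lower bound *)

Section events.
Context d (S : measurableType d) (R : realType) (P : probability S R).

Lemma prob_ge_markov (f : S -> \bar R) (t e : R) : measurable_fun setT f ->
  (forall x, 0 <= f x)%E -> 0 < t -> (\int[P]_x f x <= (t * e)%:E)%E ->
  (P [set x | (t%:E <= f x)%E] <= e%:E)%E.
Proof.
move=> mf f0 t0 fe.
have := @le_integral_comp_abse _ _ _ P _ (@measurableT _ S) f t id
  (@measurable_id _ _ setT) (fun r r0 => r0) (fun x y _ _ xy => xy) mf t0.
rewrite setTI; under eq_integral do rewrite gee0_abs//.
rewrite (_ : [set x | _] = [set x | (t%:E <= f x)%E]); last first.
  by apply/seteqP; split => x /=; rewrite gee0_abs.
move=> /le_trans/(_ fe); set A := P _.
by rewrite EFinM lee_pmul2l// ?lte_fin.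
Qed.

Lemma prob_setD_ge (A B N0 : set S) (a b : R) : measurable A -> measurable B ->
  measurable N0 -> (a%:E <= P A)%E -> (P B <= b%:E)%E -> P N0 = 0%E ->
  ((a - b)%:E <= P (A `\` (B `|` N0)))%E.
Proof.
move=> mA mB mN hA hB hN; rewrite EFinB leeBlDr//.
have mE : measurable (A `\` (B `|` N0)) by apply: measurableD => //; exact: measurableU.
apply: (le_trans hA); apply: (@le_trans _ _ (P (A `\` (B `|` N0)) + P (B `|` N0))%E).
  apply: (@le_trans _ _ (P ((A `\` (B `|` N0)) `|` (B `|` N0)))).
    apply: le_measure; rewrite ?inE//; first by apply: measurableU => //; exact: measurableU.
    by move=> x Ax; have [BN|BN] := pselect ((B `|` N0) x); [right|left].
  by apply: measureU2 => //; exact: measurableU.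
rewrite leeD2l// (le_trans _ hB)//; apply: (le_trans (measureU2 _ mB mN)).
by move: hN => /= ->; rewrite adde0.
Qed.

End events.

Section empirical_minimizers.
Context d (Omega : measurableType d) (R : realType) (mu : probability Omega R).
Variables (F : set (Omega -> R)) (T fstar : Omega -> R).
Hypotheses (FL : forall f, F f -> f \in Lfun mu 2%:E /\ Linfty_ball mu f)
  (TL : Linfty_ball mu T) (Fmin : risk_minimizer mu F T fstar).

Lemma empirical_minimizer_excess n (x : n.-tuple Omega) (H : R) (f h : Omega -> R) :
  (0 < n)%N -> 0 < H -> H <= Num.sqrt n%:R -> F f ->
  (forall j, `|f (tnth x j) - fstar (tnth x j)| <= 2) ->
  H / 8 < (\sum_(j < n) - excess_loss T fstar f (tnth x j)) / Num.sqrt n%:R ->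
  let Tl := moved_target (128^-1 * H / Num.sqrt n%:R) T fstar in
  empirical_minimizer F Tl x h ->
  \sum_(j < n) excess_loss Tl fstar h (tnth x j) <= - (H / 32 * Num.sqrt n%:R).
Proof.
move=> n0 H0 Hn Ff f2 fH Tl [Fh /(_ f Ff)]; rewrite /empirical_mean.
rewrite ler_pM2l ?invr_gt0 ?ltr0n// => hf.
have s0 : 0 < Num.sqrt n%:R :> R by rewrite sqrtr_gt0 ltr0n.
have sn : Num.sqrt n%:R ^+ 2 = n%:R :> R by rewrite sqr_sqrtr.
set lam := _ / _ in Tl hf *; rewrite /Tl in hf *.
apply: (@le_trans _ _ (\sum_(j < n) excess_loss Tl fstar f (tnth x j))).
  by rewrite !sumrB lerD2r.
rewrite (eq_bigr (fun j => (1 - lam) * excess_loss T fstar f (tnth x j) +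
  lam * (f (tnth x j) - fstar (tnth x j)) ^+ 2)); last first.
  by move=> j _; rewrite excess_loss_moved.
rewrite big_split/= -!mulr_sumr.
have h4 : \sum_(j < n) (f (tnth x j) - fstar (tnth x j)) ^+ 2 <= 4 * n%:R.
  rewrite (le_trans (ler_sum _ (G := fun=> 4) _))//.
    by move=> j _; have := f2 j; move: (_ - _) => b; rewrite ler_norml => /andP[? ?]; nra.
  by rewrite sumr_const card_ord mulr_natr.
move: fH; rewrite ltr_pdivlMr// sumrN => fH.
(* The origin of 128: moving the target costs at most 4 lam n = H sqrt n / 32. As lam <= 1/2, at
   least half of H sqrt n / 8 survives, and H / 16 - H / 32 = H / 32. *)
have lamE : lam * Num.sqrt n%:R = H / 128 by rewrite /lam; field; rewrite gt_eqF.
have lam0 : 0 <= lam by rewrite /lam divr_ge0 ?mulr_ge0 ?invr_ge0 ?ltW.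
have lam1 : lam <= 2^-1 by rewrite /lam ler_pdivrMr//; move: Hn s0 H0; move: (Num.sqrt _) => s; lra.
rewrite {Tl hf}-sn in h4; move: h4 fH lamE lam0 lam1 s0; move: (Num.sqrt _) => s.
set A := \sum_(j < n) _; set B := \sum_(j < n) _; move: A B @lam => A B lam hA hB e l0 l1 s0.
have : lam * A <= H / 32 * s.
  have : lam * A <= lam * (4 * s ^+ 2) by rewrite ler_wpM2l.
  have -> : lam * (4 * s ^+ 2) = 4 * (lam * s) * s by ring.
  by rewrite e => /le_trans; apply; rewrite le_eqVlt; apply/orP; left; apply/eqP; field.
have : (1 - lam) * B <= - (H / 16 * s).
  have : (1 - lam) * (H / 8 * s) <= (1 - lam) * - B by rewrite ler_wpM2l ?subr_ge0//; lra.
  have : 2^-1 * (H / 8 * s) <= (1 - lam) * (H / 8 * s) by rewrite ler_wpM2r//; nra.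
  by lra.
by lra.
Qed.

End empirical_minimizers.

Section lower_bound.
Context d (Omega : measurableType d) (R : realType) (mu : probability Omega R).
Variables (F : set (Omega -> R)) (T fstar : Omega -> R).
Hypotheses (FL : forall f, F f -> f \in Lfun mu 2%:E /\ Linfty_ball mu f)
  (TL : Linfty_ball mu T) (Fmin : risk_minimizer mu F T fstar).

(** Chosen so that the mean bound of [localized_deviation] with c = [osc_cst] H is 1/80 of the level
    H sqrt n / 32, as Markov's inequality requires. *)
Definition osc_cst : R := (80 * (32 * (16 / half_mean R + 32)))^-1.

Lemma osc_cst_gt0 : 0 < osc_cst.
Proof.
have h := @half_mean_gt0 R; rewrite /osc_cst invr_gt0.
by rewrite !mulr_gt0 ?ltr0n// addr_gt0 ?ltr0n// divr_gt0 ?ltr0n.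
Qed.

Lemma excess_risk_lower_bound (H : R) : 0 < H ->
  ((H / 2)%:E < gaussian_sup mu (zero_excess_losses mu F T fstar))%E ->
  \forall n \near \oo, forall delta, 0 < delta ->
    (osc mu n F fstar delta <= (osc_cst * H)%:E)%E ->
    let lam := 128^-1 * H / Num.sqrt n%:R in
    let Tl := moved_target lam T fstar in
    forall fhat : n.-tuple Omega -> Omega -> R,
      {ae prob_pow mu n, forall x, empirical_minimizer F Tl x (fhat x)} ->
    exists E : set (n.-tuple Omega),
      [/\ measurable E, (80^-1%:E <= prob_pow mu n E)%E &
        forall x, E x -> lam * delta ^+ 2 <= \int[mu]_y excess_loss Tl fstar (fhat x) y].
Proof.
move=> H0 HG.
have [m [f [Ff tail]]] := excess_loss_lower_tail FL TL Fmin (divr_gt0 H0 (ltr0n R 2)) HG.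
(* The index is taken large before [delta] is introduced: it depends only on the finite family and
   on [H]. *)
near=> n => delta delta0 oscn fhat; set lam := 128^-1 * H / _; set Tl := moved_target _ _ _ => hfhat.
have n0 : (0 < n)%N by near: n; exact: nbhs_infty_gt.
have s0 : 0 < Num.sqrt n%:R :> R by rewrite sqrtr_gt0 ltr0n.
have Hn : H <= Num.sqrt n%:R.
  rewrite -(@ler_pXn2r _ 2) ?nnegrE ?ltW// sqr_sqrtr//.
  by near: n; exact: nbhs_infty_gtr.
have lam01 : 0 <= lam <= 1.
  apply/andP; split; first by rewrite /lam divr_ge0 ?mulr_ge0 ?invr_ge0 ?ltW.
  by rewrite /lam ler_pdivrMr//; move: H0 Hn; move: (Num.sqrt _) => s; lra.
have tailn : 40^-1 <= fine (prob_pow mu n [set x | exists i,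
    H / 2 / 4 < (\sum_(j < n) - excess_loss T fstar (f i) (tnth x j)) / Num.sqrt n%:R]).
  by near: n.
set E1 := [set x | _] in tailn.
have c0 : 0 < osc_cst * H by rewrite mulr_gt0// osc_cst_gt0.
have [B [mB B0 iB BV]] := localized_deviation FL TL Fmin n0 delta0 c0 lam01 oscn.
pose t := H / 32 * Num.sqrt n%:R.
have t0 : 0 < t by rewrite mulr_gt0// divr_gt0.
pose E2 := [set x | (t%:E <= B x)%E].
have mE1 : measurable E1.
  apply: (@measurable_exists_gt _ _ R m.+1 (fun x i => (\sum_(j < n)
    - excess_loss T fstar (f i) (tnth x j)) / Num.sqrt n%:R)) => i.
  apply: measurable_funM => //; apply: measurable_sum => j.
  apply: measurableT_comp => //.
  apply: measurableT_comp (measurable_tnth _).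
  exact: (measurable_excess_loss FL TL Fmin).
have mE2 : measurable E2.
  by rewrite -[X in measurable X]setTI; exact: emeasurable_fun_c_infty.
have PE1 : ((40^-1 : R)%:E <= prob_pow mu n E1)%E.
  by rewrite -(@fineK _ (prob_pow mu n E1)) ?lee_fin// fin_num_measure.
have PE2 : (prob_pow mu n E2 <= (80^-1 : R)%:E)%E.
  apply: prob_ge_markov => //; apply: (le_trans iB).
  rewrite lee_fin le_eqVlt; apply/orP; left; apply/eqP.
  rewrite /t /osc_cst; move: (Num.sqrt _) => s.
  have := @half_mean_gt0 R; move: (half_mean R) => c cp.
  by field; rewrite !gt_eqF// addr_gt0// mulr_gt0.
have good : {ae prob_pow mu n, forall x,
    [/\ forall j i, `|f i (tnth x j) - fstar (tnth x j)| <= 2,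
      forall j, `|fstar (tnth x j) - T (tnth x j)| <= 2 &
      empirical_minimizer F Tl x (fhat x)]}.
  have h1 : {ae mu, forall y, forall i, `|f i y - fstar y| <= 2}.
    by apply: filter_forall => i; exact: (class_diff_bound FL Fmin).
  have h1' := ae_prob_pow n h1.
  have h2 := ae_prob_pow n (target_diff_bound FL TL Fmin).
  by apply: filterS3 h1' h2 hfhat.
have [N0 [mN0 PN0 goodN0]] := good.
(* [fhat] is not assumed measurable, so the event is described without it; the exceptional set of
   the minimizing property is covered by the null set [N0]. *)
exists (E1 `\` (E2 `|` N0)); split.
- by apply: measurableD => //; exact: measurableU.
- have := prob_setD_ge mE1 mE2 mN0 PE1 PE2 PN0.
  by rewrite (_ : 40^-1 - 80^-1 = 80^-1 :> R)//; lra.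
move=> x [[i hi] /not_orP[nE2 nN0]].
have [f2 T2 emp] : [/\ forall j i, `|f i (tnth x j) - fstar (tnth x j)| <= 2,
      forall j, `|fstar (tnth x j) - T (tnth x j)| <= 2 &
      empirical_minimizer F Tl x (fhat x)].
  by apply: contrapT => h; apply: nN0; exact: goodN0.
have Fh : F (fhat x) by case: emp.
have hsum : \sum_(j < n) excess_loss Tl fstar (fhat x) (tnth x j) <= - t.
  apply: (@empirical_minimizer_excess _ _ _ F T fstar n x H (f i)) => //.
  by rewrite (_ : H / 8 = H / 2 / 4)//; field.
have far : delta < l2norm mu (fstar \- fhat x).
  rewrite ltNge; apply/negP => /(BV x T2 _ Fh) hB; apply: nE2.
  by apply: le_trans hB; rewrite lee_fin lerNr.
apply: le_trans (excess_risk_moved_ge FL TL Fmin Fh lam01).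
rewrite ler_wpM2l//; first by case/andP: lam01.
by rewrite lerXn2r ?nnegrE ?l2norm_ge0// ltW.
Unshelve. all: end_near. Qed.

End lower_bound.
Theorem theorem1p1 (R : realType) :
  exists C1 C2 C3 C4 : R,
    [/\ 0 < C1, 0 < C2, 0 < C3 & 0 < C4] /\
    forall (d : measure_display) (Omega : measurableType d)
      (mu : probability Omega R) (F : set (Omega -> R)) (T fstar : Omega -> R),
      (forall f, F f -> f \in Lfun mu 2%:E /\ Linfty_ball mu f) ->
      pre_gaussian mu F ->
      Linfty_ball mu T ->
      risk_minimizer mu F T fstar ->
      let HQ : R := fine (gaussian_sup mu (zero_excess_losses mu F T fstar)) in
      exists N : nat, forall delta : R, 0 < delta ->
        (forall n : nat, (N <= n)%N ->
           (osc mu n F fstar delta <= (C3 * HQ)%:E)%E) ->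
        forall n : nat, (N <= n)%N ->
          let lambda : R := C4 * HQ / Num.sqrt n%:R in
          let Tl : Omega -> R := moved_target lambda T fstar in
          forall fhat : n.-tuple Omega -> Omega -> R,
            {ae prob_pow mu n, forall x, empirical_minimizer F Tl x (fhat x)} ->
            exists E : set (n.-tuple Omega),
              [/\ measurable E,
                  (C1%:E <= prob_pow mu n E)%E &
                  forall x, E x ->
                    C2 * (HQ / Num.sqrt n%:R) * delta ^+ 2 * l2norm mu (T \- fstar)
                    <= \int[mu]_y excess_loss Tl fstar (fhat x) y].
Proof.
(* The proof yields lam delta^2 with lam = H(Q) / (128 sqrt n); since ||T - fstar|| <= 2, halving
   1/128 makes room for that factor. *)
exists 80^-1, 256^-1, (osc_cst R), 128^-1; split.
  by split; [rewrite invr_gt0 ltr0n|rewrite invr_gt0 ltr0n|exact: osc_cst_gt0|rewrite invr_gt0 ltr0n].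
move=> d Omega mu F T fstar FL _ TL Fmin HQ.
have Fs : F fstar by case: Fmin.
have [HQ0|HQ0] := ltP 0 HQ.
  have HG : ((HQ / 2)%:E < gaussian_sup mu (zero_excess_losses mu F T fstar))%E.
    have e : gaussian_sup mu (zero_excess_losses mu F T fstar) \is a fin_num.
      by move: HQ0; rewrite /HQ; case: gaussian_sup => //=; rewrite ltxx.
    by rewrite -(fineK e) lte_fin -/HQ; lra.
  have [N _ bound] := excess_risk_lower_bound FL TL Fmin HQ0 HG.
  exists N => delta delta0 oscN n Nn lambda Tl fhat hfhat.
  have [E [mE PE hE]] := bound n Nn delta delta0 (oscN n Nn) fhat hfhat.
  exists E; split => // x /hE; apply: le_trans.
  have l0 := l2norm_ge0 mu (T \- fstar); have l2 := l2norm_target_le2 FL TL Fmin.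
  have a0 : 0 <= HQ / Num.sqrt n%:R * delta ^+ 2.
    by rewrite mulr_ge0 ?sqr_ge0// divr_ge0 ?sqrtr_ge0// ltW.
  rewrite /lambda -2!(mulrA 256^-1) -2!(mulrA 128^-1).
  move: (l2norm _ _) (_ * _ * _) l0 l2 a0 => l a l0 l2 a0; nra.
(* This case contains the junk value [fine +oo = 0]. *)
exists 0%N => delta delta0 oscN n _ lambda Tl fhat hfhat.
(* A negative value would contradict the nonnegativity of the oscillation. With value 0 the target
   does not move, and the claim becomes the nonnegativity of the excess risk, valid almost
   surely. *)
have HQE : HQ = 0.
  apply/eqP; rewrite eq_le HQ0/= -(@pmulr_rge0 _ (osc_cst R)) ?osc_cst_gt0//.
  by rewrite -lee_fin; apply: le_trans (oscN n _); rewrite ?osc_ge0.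
have TlE : Tl = T.
  apply/funext => x; rewrite /Tl /moved_target /lambda HQE mulr0 mul0r.
  by rewrite subr0 mul1r mul0r addr0.
have [N0 [mN0 PN0 goodN0]] := hfhat.
exists (~` N0); split => [||x nN0]; first exact: measurableC.
  rewrite probability_setC// PN0 sube0 lee_fin; lra.
have [Fh _] : empirical_minimizer F Tl x (fhat x).
  by apply: contrapT => h; apply: nN0; exact: goodN0.
rewrite HQE mul0r mulr0 !mul0r TlE.
exact: (excess_risk_ge0 FL TL Fmin).
Qed.
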